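(* Let $\mathfrak e$ be a finite gap set and let $J$ be a bounded half-line Jacobi matrix in the Nevai class for $\mathfrak e$. Then $\sup_{x_0\in\sigma(J)}p_n(x_0)^2/K_n(x_0,x_0)\to0$ as $n\to\infty$; i.e. the Nevai condition holds for $J$ uniformly on $\sigma(J)$.
   Context: A finite gap set is $\mathfrak e=\bigcup_{j=1}^{\ell+1}[\alpha_j,\beta_j]$ with $\alpha_1<\beta_1<\alpha_2<\beta_2<\cdots<\alpha_{\ell+1}<\beta_{\ell+1}$. Its isospectral torus $\mathcal T_{\mathfrak e}$ is the set of bounded two-sided Jacobi matrices $J'$ (on $\ell^2(\mathbb{Z})$, with $J'_{nn}=b'_n$, $J'_{n,n+1}=J'_{n+1,n}=a'_n>0$) with $\sigma(J')=\mathfrak e$ that are reflectionless on $\mathfrak e$, i.e. for every $n\in\mathbb{Z}$, $\operatorname{Re}\langle\delta_n,(J'-x-i0)^{-1}\delta_n\rangle=0$ for Lebesgue a.e. $x\in\mathfrak e$. A half-line Jacobi matrix $J$ (on $\ell^2(\{1,2,\dots\})$, $J_{nn}=b_n$, $J_{n,n+1}=J_{n+1,n}=a_n>0$) is in the Nevai class for $\mathfrak e$ if all its right limits lie in $\mathcal T_{\mathfrak e}$, where a right limit is a two-sided Jacobi matrix with parameters $a^{(r)}_n=\lim_j a_{m_j+n}$, $b^{(r)}_n=\lim_jb_{m_j+n}$ ($n\in\mathbb{Z}$) for some $m_j\to\infty$. $\rho$ is the spectral measure of $J$ for $\delta_1$, $p_n$ its orthonormal polynomials ($p_{-1}=0$,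 $p_0=1$, $xp_n=a_{n+1}p_{n+1}+b_{n+1}p_n+a_np_{n-1}$), $K_n(x,y)=\sum_{j=0}^np_j(x)p_j(y)$; the Nevai condition at $x_0$ means $K_n(x,x_0)^2d\rho(x)/K_n(x_0,x_0)\to\delta_{x_0}$ weakly. *)

(* Defs.v *)
From Stdlib Require Import Reals ZArith.
Open Scope R_scope.

Definition bounded_nat (s : nat -> R) : Prop := exists M, forall i, Rabs (s i) <= M.
Definition bounded_Z (s : Z -> R) : Prop := exists M, forall i, Rabs (s i) <= M.

(* square-summable real sequences on {1,2,...} (stored 0-based: v i = entry at site i+1)
   and on Z *)
Definition l2N (v : nat -> R) : Prop :=
  exists M, forall N, sum_f_R0 (fun i => v i ^ 2) N <= M.
Definition l2Z (v : Z -> R) : Prop :=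
  exists M, forall N,
    sum_f_R0 (fun i => v (Z.of_nat i) ^ 2 + v (- Z.of_nat i - 1)%Z ^ 2) N <= M.

(* ---------- half-line Jacobi matrix ----------
   a b : nat -> R are 1-based: J_{nn} = b n, J_{n,n+1} = a n  (n >= 1);
   a 0, b 0 are unused.  A vector v : nat -> R is stored 0-based
   (v i is the component at site i+1). *)
Definition halfJ (a b : nat -> R) (v : nat -> R) (i : nat) : R :=
  (match i with O => 0 | S k => a i * v k end) + b (S i) * v i + a (S i) * v (S i).

(* x is in the resolvent set iff J - x : l2 -> l2 is bijective
   (bounded inverse then automatic); spectrum = complement. *)
Definition spec_half (a b : nat -> R) (x : R) : Prop :=
  ~ ( (forall f, l2N f -> exists v, l2N v /\ forall i, halfJ a b v i - x * v i = f i)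
      /\ (forall v w, l2N v -> l2N w ->
            (forall i, halfJ a b v i - x * v i = halfJ a b w i - x * w i) ->
            forall i, v i = w i) ).

Definition twoJ (a b : Z -> R) (v : Z -> R) (k : Z) : R :=
  a (k - 1)%Z * v (k - 1)%Z + b k * v k + a k * v (k + 1)%Z.

Definition spec_two (a b : Z -> R) (x : R) : Prop :=
  ~ ( (forall f, l2Z f -> exists v, l2Z v /\ forall k, twoJ a b v k - x * v k = f k)
      /\ (forall v w, l2Z v -> l2Z w ->
            (forall k, twoJ a b v k - x * v k = twoJ a b w k - x * w k) ->
            forall k, v k = w k) ).

(* (ur + i ui) in l2(Z) solves (J' - (x + i eps)) u = delta_n, i.e.
   u = (J' - x - i eps)^{-1} delta_n, so ur n = Re <delta_n,(J'-x-i eps)^{-1} delta_n>. *)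
Definition resolvent_sol (a b : Z -> R) (n : Z) (x eps : R) (ur ui : Z -> R) : Prop :=
  l2Z ur /\ l2Z ui /\
  forall k,
    twoJ a b ur k - x * ur k + eps * ui k = (if Z.eq_dec k n then 1 else 0) /\
    twoJ a b ui k - x * ui k - eps * ur k = 0.

(* Re <delta_n,(J'-x-i0)^{-1} delta_n> = 0, i.e. lim_{eps->0+} Re G_nn(x+i eps) = 0 *)
Definition re_green_bv_zero (a b : Z -> R) (n : Z) (x : R) : Prop :=
  forall d, 0 < d -> exists eta, 0 < eta /\
    forall eps ur ui, 0 < eps < eta -> resolvent_sol a b n x eps ur ui -> Rabs (ur n) < d.

Definition leb_null (S : R -> Prop) : Prop :=
  forall eps, 0 < eps -> exists lo hi : nat -> R,
    (forall x, S x -> exists j, lo j < x < hi j) /\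
    (forall j, lo j <= hi j) /\
    (forall N, sum_f_R0 (fun j => hi j - lo j) N <= eps).

Definition finite_gap_set (l : nat) (alpha beta : nat -> R) : Prop :=
  (forall j, (j <= l)%nat -> alpha j < beta j) /\
  (forall j, (j < l)%nat -> beta j < alpha (S j)).

Definition in_fgs (l : nat) (alpha beta : nat -> R) (x : R) : Prop :=
  exists j, (j <= l)%nat /\ alpha j <= x <= beta j.

Definition in_iso_torus (l : nat) (alpha beta : nat -> R) (a b : Z -> R) : Prop :=
  bounded_Z a /\ bounded_Z b /\ (forall k, 0 < a k) /\
  (forall x, spec_two a b x <-> in_fgs l alpha beta x) /\
  (forall n : Z, leb_null (fun x => in_fgs l alpha beta x /\ ~ re_green_bv_zero a b n x)).

Definition right_limit (a b : nat -> R) (a' b' : Z -> R) : Prop :=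
  exists m : nat -> nat,
    (forall K, exists j0, forall j, (j0 <= j)%nat -> (K <= m j)%nat) /\
    (forall n : Z, Un_cv (fun j => a (Z.to_nat (Z.of_nat (m j) + n))) (a' n)) /\
    (forall n : Z, Un_cv (fun j => b (Z.to_nat (Z.of_nat (m j) + n))) (b' n)).

Definition nevai_class (l : nat) (alpha beta : nat -> R) (a b : nat -> R) : Prop :=
  forall a' b', right_limit a b a' b' -> in_iso_torus l alpha beta a' b'.

(* ---------- orthonormal polynomials ----------
   opp n = (p_n(x), p_{n+1}(x)) from x p_n = a_{n+1} p_{n+1} + b_{n+1} p_n + a_n p_{n-1} *)
Fixpoint opp (a b : nat -> R) (x : R) (n : nat) : R * R :=
  match n with
  | O => (1, (x - b 1%nat) / a 1%nat)
  | S k => let (p, q) := opp a b x k in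
           (q, ((x - b (S (S k))) * q - a (S k) * p) / a (S (S k)))
  end.

Definition opoly (a b : nat -> R) (n : nat) (x : R) : R := fst (opp a b x n).

Definition CD_kernel (a b : nat -> R) (n : nat) (x y : R) : R :=
  sum_f_R0 (fun j => opoly a b j x * opoly a b j y) n.

(* Main.v *)
(* Suppose p_n(x_n)^2 > eps K_n(x_n,x_n) for infinitely many n and x_n in sigma(J). Normalizing the
   orthonormal polynomials at n and passing to the limit gives x_n -> y, a right limit J' and a
   solution of J'u = yu on the left half-line with u_0 = 1 and u square summable at -oo.

   If y is not in e, then no right limit has a nonzero bounded solution at y, so far out solutions
   of Jv = xv with x near y have no local maximum on windows of a fixed length. Hence an x in
   sigma(J) near y has bounded p_n(x), these p_n(x) decay exponentially at a uniform rate, and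
   p_n(x)^2 / K_n(x,x) is small.

   If y is in e, put psi = u 1_{k < 0} and f = (J' - y) psi, which is supported on {-1, 0}. Write
   G_mn(z) for the matrix elements of (J' - z)^{-1} and P(z) = Im <f, (J' - z)^{-1} f>. From
   (J' - z)^{-1} f = psi + (z - y) (J' - z)^{-1} psi and the bound on the integral of
   Im <psi, (J' - x - i eps)^{-1} psi> over x one gets a bound, uniform in eps, on the integral of
   P(x + i eps) / (x - y)^2 away from y. Where J' is reflectionless, P Im G_00 >= 1/8, so
   Im G_00 + P / (x - y)^2 >= 1 / (2 |x - y|); integrating over a one-sided neighbourhood of y
   contained in e, the left side stays bounded while the right side diverges logarithmically. *)

(* Reflectionlessness enters only in its raw form: for almost every x in e the real parts of the
   diagonal Green functions tend to 0, without a uniform bound and without information on the entry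
   G_{-1,0} contained in P. So all estimates are made at positive eps. The equations at site 0 and
   the Wronskian of two columns control H = 2 a_{-1} G_{-1,0} - 1 by diagonal entries; the first
   relation carries a factor x - b_0, so the interval of integration has to avoid b_0. As a
   quadratic form in u_{-1}, P has a fixed discriminant, and in the limit P Im G_00 is at least 1/4
   for every u_{-1}; the value 1/8 leaves room for errors. The errors are real parts truncated at 1,
   whose integrals vanish by bounded convergence, and eps times imaginary parts, whose integrals are
   bounded uniformly in eps. The distance eta kept from y is fixed before eps tends to 0, small
   enough for the logarithm to exceed the uniform bound. Since the energies x_n move with n, the
   estimates outside e hold uniformly for x near y, and a point of sigma(J) is used only through its
   approximate eigenvectors. *)
Require Import Defs.
From Stdlib Require Import Reals ZArith Lra Lia Psatz Classical ClassicalEpsilon FunctionalExtensionality ProofIrrelevance.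
From Coquelicot Require Import Coquelicot.
Open Scope R_scope.

(** * Real Hilbert spaces *)

(* The vector space axioms are omitted: they follow from bilinearity and [ip_sep]. *)
Record hilbert := Hilbert {
  hcar :> Type;
  hzero : hcar;
  hadd : hcar -> hcar -> hcar;
  hscal : R -> hcar -> hcar;
  ip : hcar -> hcar -> R;
  ip_comm : forall u v, ip u v = ip v u;
  ip_zero_l : forall u, ip hzero u = 0;
  ip_add_l : forall u v w, ip (hadd u v) w = ip u w + ip v w;
  ip_scal_l : forall c u v, ip (hscal c u) v = c * ip u v;
  ip_ge0 : forall u, 0 <= ip u u;
  ip_sep : forall u v,
    ip (hadd u (hscal (-1) v)) (hadd u (hscal (-1) v)) = 0 -> u = v;
  ip_complete : forall s : nat -> hcar,
    (forall e, 0 < e -> exists N, forall n m, (N <= n)%nat -> (N <= m)%nat ->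
       ip (hadd (s n) (hscal (-1) (s m))) (hadd (s n) (hscal (-1) (s m))) <= e) ->
    exists v, forall e, 0 < e -> exists N, forall n, (N <= n)%nat ->
       ip (hadd (s n) (hscal (-1) v)) (hadd (s n) (hscal (-1) v)) <= e }.

Arguments hzero {h}.
Arguments hadd {h} u v.
Arguments hscal {h} c u.
Arguments ip {h} u v.

Definition hsub {E : hilbert} (u v : E) : E := hadd u (hscal (-1) v).

(** [op_norm] is some bound of the operator, not necessarily the smallest one. *)
Record selfadj (E : hilbert) := Selfadj {
  op :> E -> E;
  op_add : forall u v, op (hadd u v) = hadd (op u) (op v);
  op_scal : forall (c : R) u, op (hscal c u) = hscal c (op u);
  op_sym : forall u v, ip (op u) v = ip u (op v);
  op_norm : R;
  op_norm_ge0 : 0 <= op_norm;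
  op_bound : forall u, ip (op u) (op u) <= op_norm ^ 2 * ip u u }.

Arguments op_norm {E} s.

Section InnerProduct.
Context {E : hilbert}.
Implicit Types (u v w : E) (c : R).

Lemma ip_add_r u v w : ip u (hadd v w) = ip u v + ip u w.
Proof. now rewrite ip_comm, ip_add_l, 2!(ip_comm _ u). Qed.

Lemma ip_scal_r c u v : ip u (hscal c v) = c * ip u v.
Proof. now rewrite ip_comm, ip_scal_l, ip_comm. Qed.

Lemma ip_sub_l u v w : ip (hsub u v) w = ip u w - ip v w.
Proof. unfold hsub. rewrite ip_add_l, ip_scal_l. ring. Qed.

Lemma ip_sub_r u v w : ip u (hsub v w) = ip u v - ip u w.
Proof. now rewrite ip_comm, ip_sub_l, 2!(ip_comm _ u). Qed.

Lemma ip_zero_r u : ip u hzero = 0.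
Proof. rewrite ip_comm. apply ip_zero_l. Qed.

Lemma ip_cauchy u v : (ip u v) ^ 2 <= ip u u * ip v v.
Proof.
assert (H : forall t, 0 <= ip u u + 2 * t * ip u v + t ^ 2 * ip v v).
{ intros t.
  replace (ip u u + 2 * t * ip u v + t ^ 2 * ip v v)
    with (ip (hadd u (hscal t v)) (hadd u (hscal t v))).
  - apply ip_ge0.
  - rewrite !ip_add_l, !ip_add_r, !ip_scal_l, !ip_scal_r, (ip_comm _ v u). ring. }
destruct (Req_dec (ip v v) 0) as [Hv|Hv].
- rewrite Hv.
  assert (ip u v = 0).
  { destruct (Req_dec (ip u v) 0) as [?|Huv]; trivial.
    exfalso.
    (* When |v| = 0 the quadratic is affine in t, and this t gives it the value -1. *)
    specialize (H (- (ip u u + 1) / (2 * ip u v))). rewrite Hv in H.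
    replace (ip u u + 2 * (- (ip u u + 1) / (2 * ip u v)) * ip u v
      + (- (ip u u + 1) / (2 * ip u v)) ^ 2 * 0) with (-1) in H by (field; trivial).
    lra. }
  rewrite H0. simpl; lra.
- assert (Hp : 0 < ip v v) by (assert (h := ip_ge0 E v); lra).
  specialize (H (- ip u v / ip v v)).
  replace (ip u u + 2 * (- ip u v / ip v v) * ip u v + (- ip u v / ip v v) ^ 2 * ip v v)
    with ((ip u u * ip v v - ip u v ^ 2) / ip v v) in H by (field; lra).
  assert (0 <= (ip u u * ip v v - ip u v ^ 2) / ip v v * ip v v).
  { apply Rmult_le_pos; lra. }
  replace ((ip u u * ip v v - ip u v ^ 2) / ip v v * ip v v) with
    (ip u u * ip v v - ip u v ^ 2) in H0 by (field; lra).
  lra.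
Qed.

Definition hnorm u := sqrt (ip u u).

Lemma hnorm_ge0 u : 0 <= hnorm u.
Proof. apply sqrt_pos. Qed.

Lemma hnorm_sq u : hnorm u ^ 2 = ip u u.
Proof. unfold hnorm. apply pow2_sqrt, ip_ge0. Qed.

Lemma hnorm_le u c : 0 <= c -> ip u u <= c ^ 2 -> hnorm u <= c.
Proof. intros Hc H. apply Rsqr_incr_0_var; trivial. rewrite 2!Rsqr_pow2, hnorm_sq. trivial. Qed.

Lemma Rabs_ip u v : Rabs (ip u v) <= hnorm u * hnorm v.
Proof.
apply Rsqr_incr_0_var; [|apply Rmult_le_pos; apply hnorm_ge0].
rewrite <- Rsqr_abs, 2!Rsqr_pow2, Rpow_mult_distr, 2!hnorm_sq. apply ip_cauchy.
Qed.

Lemma hnorm_add u v : hnorm (hadd u v) <= hnorm u + hnorm v.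
Proof.
assert (h1 := hnorm_ge0 u). assert (h2 := hnorm_ge0 v).
apply hnorm_le; [lra|].
rewrite ip_add_l, 2!ip_add_r, (ip_comm _ v u), <- !hnorm_sq.
assert (h := Rabs_ip u v). assert (h3 := Rle_abs (ip u v)). nra.
Qed.

Lemma ip_parallelogram u v : ip (hadd u v) (hadd u v) <= 2 * ip u u + 2 * ip v v.
Proof.
assert (h := ip_ge0 E (hsub u v)).
rewrite ip_sub_l, 2!ip_sub_r in h.
rewrite ip_add_l, 2!ip_add_r. lra.
Qed.

Lemma ip_ext u v : (forall w, ip u w = ip v w) -> u = v.
Proof.
intros H. apply ip_sep. change (ip (hsub u v) (hsub u v) = 0). rewrite ip_sub_l, H. ring.
Qed.

Lemma hnorm_eq0 u : hnorm u = 0 -> u = hzero.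
Proof.
intros H. apply ip_sep. change (ip (hsub u hzero) (hsub u hzero) = 0).
rewrite ip_sub_l, 2!ip_sub_r, !ip_zero_l, ip_zero_r, <- hnorm_sq, H. ring.
Qed.

Lemma hnorm_scal c u : hnorm (hscal c u) = Rabs c * hnorm u.
Proof.
unfold hnorm. rewrite ip_scal_l, ip_scal_r, <- Rmult_assoc, sqrt_mult_alt by apply Rle_0_sqr.
f_equal. apply sqrt_Rsqr_abs.
Qed.

Lemma hnorm_sub_sym u v : hnorm (hsub u v) = hnorm (hsub v u).
Proof. unfold hnorm. f_equal. rewrite !ip_sub_l, !ip_sub_r. ring. Qed.

Lemma hnorm_sub_trans u v w : hnorm (hsub u w) <= hnorm (hsub u v) + hnorm (hsub v w).
Proof. replace (hsub u w) with (hadd (hsub u v) (hsub v w)); [apply hnorm_add|].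
apply ip_ext; intros t; rewrite ip_sub_l, ip_add_l, !ip_sub_l. ring. Qed.

End InnerProduct.

Ltac ip_expand := repeat progress rewrite ?ip_sub_l, ?ip_sub_r, ?ip_add_l, ?ip_add_r,
  ?ip_scal_l, ?ip_scal_r, ?ip_zero_l, ?ip_zero_r.

Lemma geometric_cauchy {E : hilbert} (s : nat -> E) (D r : R) :
  0 <= D -> 0 <= r < 1 ->
  (forall k, hnorm (hsub (s (S k)) (s k)) <= D * r ^ k) ->
  exists v, forall e, 0 < e -> exists N, forall n, (N <= n)%nat -> hnorm (hsub (s n) v) <= e.
Proof.
intros HD Hr Hs.
assert (Hstep : forall m p, hnorm (hsub (s (m + p)%nat) (s m)) * (1 - r) <= D * r ^ m * (1 - r ^ p)).
{ intros m p. induction p as [|p IH].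
  - rewrite Nat.add_0_r. unfold hnorm.
    rewrite ip_sub_l, Rminus_diag, sqrt_0. simpl; lra.
  - rewrite Nat.add_succ_r.
    assert (h := hnorm_sub_trans (s (S (m + p))) (s (m + p)%nat) (s m)).
    assert (h' := Hs (m + p)%nat). rewrite pow_add in h'. simpl.
    apply Rle_trans with ((D * (r ^ m * r ^ p)) * (1 - r) +
      hnorm (hsub (s (m + p)%nat) (s m)) * (1 - r)); nra. }
assert (Hlim : forall e, 0 < e -> exists N, forall m, (N <= m)%nat -> D * r ^ m <= e * (1 - r)).
{ intros e He.
  destruct (pow_lt_1_zero r) with (y := e * (1 - r) / (D + 1)) as [N HN].
  - rewrite Rabs_pos_eq; lra.
  - apply Rdiv_lt_0_compat; nra.
  - exists N. intros m Hm. specialize (HN m Hm).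
    rewrite Rabs_pos_eq in HN by (apply pow_le; lra).
    apply Rmult_lt_compat_r with (r := D + 1) in HN; [|lra].
    replace (e * (1 - r) / (D + 1) * (D + 1)) with (e * (1 - r)) in HN by (field; lra).
    assert (0 <= r ^ m) by (apply pow_le; lra). nra. }
assert (Hc : forall e, 0 < e -> exists N, forall n m, (N <= n)%nat -> (N <= m)%nat ->
  hnorm (hsub (s n) (s m)) <= e).
{ assert (Haux : forall e, 0 < e -> exists N, forall n m, (N <= m)%nat -> (m <= n)%nat ->
    hnorm (hsub (s n) (s m)) <= e).
  { intros e He. destruct (Hlim e He) as [N HN]. exists N. intros n m Hm Hmn.
    specialize (Hstep m (n - m)%nat). replace (m + (n - m))%nat with n in Hstep by lia.
    specialize (HN m Hm).
    assert (0 <= r ^ m) by (apply pow_le; lra).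
    assert (0 <= r ^ (n - m)) by (apply pow_le; lra).
    apply Rmult_le_reg_r with (1 - r); [lra|].
    assert (0 <= D * r ^ m * r ^ (n - m)) by (repeat apply Rmult_le_pos; lra). lra. }
  intros e He. destruct (Haux e He) as [N HN]. exists N. intros n m Hn Hm.
  destruct (Nat.le_ge_cases m n) as [h|h]; [now apply HN|].
  rewrite hnorm_sub_sym. now apply HN. }
destruct (ip_complete E s) as [v Hv].
- intros e He. destruct (Hc (sqrt e)) as [N HN]; [now apply sqrt_lt_R0|].
  exists N. intros n m Hn Hm. rewrite <- hnorm_sq.
  rewrite <- (pow2_sqrt e) by lra. apply pow_incr. split; [apply hnorm_ge0|now apply HN].
- exists v. intros e He. destruct (Hv (e ^ 2)) as [N HN]; [nra|].
  exists N. intros n Hn. apply hnorm_le; [lra|]. now apply HN.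
Qed.

(* Richardson iteration [s (k+1) = s k + t (f - B (s k))] with [t = c / K^2]: the error
   contracts because [|u - t B u|^2 <= (1 - 2 t c + t^2 K^2) |u|^2 = (1 - c^2 / K^2) |u|^2]. *)
Lemma lax_milgram {E : hilbert} (B : E -> E) (c K : R) :
  (forall u v, B (hadd u v) = hadd (B u) (B v)) ->
  (forall (t : R) u, B (hscal t u) = hscal t (B u)) ->
  0 < c -> c <= K ->
  (forall u, ip (B u) (B u) <= K ^ 2 * ip u u) ->
  (forall u, c * ip u u <= ip (B u) u) ->
  forall f, exists w, B w = f.
Proof.
intros Bp Bs Hc HcK Bb Bc f.
assert (Bm : forall u v, B (hsub u v) = hsub (B u) (B v)).
{ intros u v. unfold hsub. now rewrite Bp, Bs. }
pose (t := c / K ^ 2).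
pose (s := fix s (k : nat) : E := match k with O => hzero | S k => hadd (s k) (hscal t (hsub f (B (s k)))) end).
assert (HK : 0 < K ^ 2) by nra.
assert (Ht : 0 < t) by (apply Rdiv_lt_0_compat; trivial).
assert (HtK : t * K ^ 2 = c) by (unfold t; field; lra).
pose (q := 1 - t * c).
assert (Hq : 0 <= q < 1).
{ unfold q. split; [|nra].
  assert (t * c <= 1); [|lra].
  unfold t. apply Rmult_le_reg_r with (K ^ 2); trivial.
  replace (c / K ^ 2 * c * K ^ 2) with (c * c) by (field; lra). nra. }
pose (d := fun k => hsub (s (S k)) (s k)).
(* The increments are t times the residuals, so their geometric decay yields both the limit and the
   equation it satisfies. *)
assert (Hd0 : forall k, d k = hscal t (hsub f (B (s k)))).
{ intros k. unfold d. apply ip_ext. intros w. simpl. ip_expand. ring. }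
assert (Hd : forall k, d (S k) = hsub (d k) (hscal t (B (d k)))).
{ intros k. rewrite Hd0. unfold d at 2. rewrite Bm, Hd0.
  apply ip_ext; intros w; ip_expand. ring. }
assert (Hn : forall k, ip (d (S k)) (d (S k)) <= q * ip (d k) (d k)).
{ intros k. rewrite Hd. ip_expand. rewrite (ip_comm _ (d k) (B (d k))).
  assert (h1 := Bb (d k)). assert (h2 := Bc (d k)).
  apply Rmult_le_compat_l with (r := t * t) in h1; [|nra].
  apply Rmult_le_compat_l with (r := 2 * t) in h2; [|lra].
  replace (t * t * (K ^ 2 * ip (d k) (d k))) with (t * c * ip (d k) (d k)) in h1
    by (rewrite <- HtK; ring).
  unfold q. lra. }
assert (Hr : 0 <= sqrt q < 1).
{ split; [apply sqrt_pos|]. rewrite <- sqrt_1. apply sqrt_lt_1; lra. }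
assert (Hdk : forall k, hnorm (d k) <= hnorm (d 0%nat) * sqrt q ^ k).
{ induction k as [|k IH]; [simpl; lra|].
  assert (h : hnorm (d (S k)) <= sqrt q * hnorm (d k)).
  { apply hnorm_le; [apply Rmult_le_pos; [lra|apply hnorm_ge0]|].
    rewrite Rpow_mult_distr, hnorm_sq, pow2_sqrt by lra. apply Hn. }
  simpl. apply Rle_trans with (1 := h).
  apply Rmult_le_compat_l with (r := sqrt q) in IH; lra. }
destruct (geometric_cauchy s (hnorm (d 0%nat)) (sqrt q)) as [v Hv]; trivial.
{ apply hnorm_ge0. }
exists v. apply ip_ext.
assert (Hz : hsub (B v) f = hzero).
{ apply hnorm_eq0. apply Rle_antisym; [|apply hnorm_ge0].
  apply le_epsilon. intros e He.
  pose (e' := e / (K + 2 / t)).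
  assert (H2t : 0 < 2 / t) by (apply Rdiv_lt_0_compat; lra).
  assert (He' : 0 < e') by (apply Rdiv_lt_0_compat; lra).
  destruct (Hv e' He') as [N HN].
  assert (h1 := HN N (Nat.le_refl _)). assert (h2 := HN (S N) (Nat.le_succ_diag_r _)).
  assert (h3 : hnorm (hsub (B v) (B (s N))) <= K * e').
  { rewrite <- Bm. apply hnorm_le; [apply Rmult_le_pos; lra|].
    apply Rle_trans with (1 := Bb _). rewrite Rpow_mult_distr.
    apply Rmult_le_compat_l; [lra|]. rewrite <- hnorm_sq, hnorm_sub_sym.
    apply pow_incr. split; [apply hnorm_ge0|trivial]. }
  assert (h4 : t * hnorm (hsub (B (s N)) f) <= 2 * e').
  { rewrite hnorm_sub_sym. replace t with (Rabs t) by (apply Rabs_pos_eq; lra).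
    rewrite <- hnorm_scal, <- Hd0. unfold d.
    assert (h := hnorm_sub_trans (s (S N)) v (s N)).
    rewrite (hnorm_sub_sym v) in h. lra. }
  assert (h5 : hnorm (hsub (B (s N)) f) <= 2 / t * e').
  { apply Rmult_le_reg_l with t; trivial.
    replace (t * (2 / t * e')) with (2 * e') by (field; lra). trivial. }
  assert (h6 := hnorm_sub_trans (B v) (B (s N)) f).
  assert (h7 : (K + 2 / t) * e' = e) by (unfold e'; field; split; try lra; nra).
  lra. }
intros w. assert (h : ip (hsub (B v) f) w = 0) by (rewrite Hz; apply ip_zero_l).
rewrite ip_sub_l in h. lra.
Qed.

(** * Resolvents of bounded self-adjoint operators *)

Section Resolvent.
Context {E : hilbert} (A : selfadj E).
Implicit Types (u v f psi phi : E) (x y : R).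

Definition shift x u : E := hsub (A u) (hscal x u).

Lemma shift_add x u v : shift x (hadd u v) = hadd (shift x u) (shift x v).
Proof. unfold shift. rewrite op_add. apply ip_ext; intros w; ip_expand. ring. Qed.

Lemma shift_scal x (t : R) u : shift x (hscal t u) = hscal t (shift x u).
Proof. unfold shift. rewrite op_scal. apply ip_ext; intros w; ip_expand. ring. Qed.

Lemma shift_sub x u v : shift x (hsub u v) = hsub (shift x u) (shift x v).
Proof. unfold hsub. now rewrite shift_add, shift_scal. Qed.

Lemma shift_sym x u v : ip (shift x u) v = ip u (shift x v).
Proof. unfold shift. ip_expand. rewrite op_sym. ring. Qed.

Lemma ip_shift_move x x' u v : ip u (shift x' v) = ip u (shift x v) - (x' - x) * ip u v.
Proof. unfold shift. ip_expand. ring. Qed.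

Lemma ip_sub_le u v : ip (hsub u v) (hsub u v) <= 2 * ip u u + 2 * ip v v.
Proof.
assert (h := ip_ge0 E (hadd u v)).
rewrite ip_add_l, 2!ip_add_r in h. rewrite ip_sub_l, 2!ip_sub_r. lra.
Qed.

Lemma shift_bound x u :
  ip (shift x u) (shift x u) <= (2 * op_norm A ^ 2 + 2 * x ^ 2) * ip u u.
Proof.
unfold shift. apply Rle_trans with (1 := ip_sub_le _ _).
rewrite ip_scal_l, ip_scal_r. assert (h := op_bound _ A u). lra.
Qed.

(** From |x| |u| <= |A u| + |(A - x) u|. The unit margin fixes the constant 1, used on the vertical
    sides of a contour and to bound the half-line spectrum. *)
Lemma shift_below x u : op_norm A + 1 <= Rabs x -> ip u u <= ip (shift x u) (shift x u).
Proof.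
intros Hx. rewrite <- 2!hnorm_sq. apply pow_incr. split; [apply hnorm_ge0|].
assert (h1 : hnorm (A u) <= op_norm A * hnorm u).
{ apply hnorm_le; [apply Rmult_le_pos; [apply op_norm_ge0|apply hnorm_ge0]|].
  rewrite Rpow_mult_distr, hnorm_sq. apply op_bound. }
assert (h2 : hnorm (hscal x u) <= hnorm (A u) + hnorm (shift x u)).
{ replace (hscal x u) with (hadd (A u) (hscal (-1) (shift x u))).
  - apply Rle_trans with (1 := hnorm_add _ _). rewrite hnorm_scal, Rabs_left; lra.
  - unfold shift. apply ip_ext; intros w; ip_expand. ring. }
rewrite hnorm_scal in h2. assert (h := hnorm_ge0 u). nra.
Qed.

(** (A - x)^2 + y^2 is (A - z)(A - conj z) for z = x + i y, a real operator whose quadratic form is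
    |(A - x) u|^2 + y^2 |u|^2; coercivity of that form is the hypothesis. The case y <> 0 yields the
    resolvent, the case y = 0 the resolvent set on the real line. *)
Lemma shift_sq_surjective x y c : 0 < c ->
  (forall u, c * ip u u <= ip (shift x u) (shift x u) + y ^ 2 * ip u u) ->
  forall f, exists w, hadd (shift x (shift x w)) (hscal (y ^ 2) w) = f.
Proof.
intros Hc H f.
pose (m := 2 * op_norm A ^ 2 + 2 * x ^ 2).
assert (Hm : 0 <= m) by (unfold m; nra).
assert (Hy : 0 <= y ^ 2) by nra.
apply (lax_milgram (fun w => hadd (shift x (shift x w)) (hscal (y ^ 2) w)) c (2 * m + 2 * y ^ 2 + c)).
- intros u v. rewrite 2!shift_add. apply ip_ext; intros w; ip_expand. ring.
- intros t u. rewrite 2!shift_scal. apply ip_ext; intros w; ip_expand. ring.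
- trivial.
- nra.
- intros u. apply Rle_trans with (1 := ip_parallelogram _ _).
  assert (h1 := shift_bound x (shift x u)). assert (h2 := shift_bound x u). fold m in h1, h2.
  rewrite ip_scal_l, ip_scal_r. assert (h := ip_ge0 E u).
  apply Rle_trans with ((2 * m * m + 2 * y ^ 2 * y ^ 2) * ip u u); [nra|].
  apply Rmult_le_compat_r; trivial. nra.
- intros u. rewrite ip_add_l, ip_scal_l, shift_sym. apply H.
Qed.

Lemma shift_surjective x c : 0 < c ->
  (forall u, c * ip u u <= ip (shift x u) (shift x u)) ->
  forall f, exists w, shift x w = f.
Proof.
intros Hc H f. destruct (shift_sq_surjective x 0 c Hc) with (f := f) as [w Hw].
- intros u. specialize (H u). lra.
- exists (shift x w). rewrite <- Hw. apply ip_ext; intros t; ip_expand. ring.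
Qed.

(* [u + i v = (A - x - i y)^{-1} psi], split into real and imaginary parts. *)
Definition is_resolvent x y psi u v :=
  hadd (shift x u) (hscal y v) = psi /\ shift x v = hscal y u.

(** With w = u + i v this reads |(A - z) w|^2 = |(A - x) w|^2 + y^2 |w|^2; the cross terms cancel by
    symmetry of A - x. *)
Lemma complex_shift_norm x y u v :
  let f := hadd (shift x u) (hscal y v) in
  let g := hsub (shift x v) (hscal y u) in
  ip f f + ip g g = ip (shift x u) (shift x u) + ip (shift x v) (shift x v)
    + y ^ 2 * (ip u u + ip v v).
Proof.
simpl. ip_expand. rewrite (ip_comm _ u (shift x v)), (shift_sym x v u), (ip_comm _ v (shift x u)). ring.
Qed.

Lemma is_resolvent_norm x y psi u v : is_resolvent x y psi u v ->
  ip psi psi = ip (shift x u) (shift x u) + ip (shift x v) (shift x v)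
    + y ^ 2 * (ip u u + ip v v).
Proof.
intros [H1 H2]. rewrite <- complex_shift_norm. rewrite H1, H2.
ip_expand. ring.
Qed.

Lemma is_resolvent_exists x y psi : y <> 0 -> exists u v, is_resolvent x y psi u v.
Proof.
intros Hy.
destruct (shift_sq_surjective x y (y ^ 2)) with (f := psi) as [w Hw].
- nra.
- intros u. assert (h := ip_ge0 E (shift x u)). lra.
(* (A - z)^{-1} = (A - conj z) ((A - x)^2 + y^2)^{-1}, and A - conj z = (A - x) + i y. *)
- exists (shift x w), (hscal y w). split.
  + rewrite <- Hw. apply ip_ext; intros t; ip_expand. ring.
  + apply shift_scal.
Qed.

Lemma is_resolvent_unique x y psi u v u' v' : y <> 0 ->
  is_resolvent x y psi u v -> is_resolvent x y psi u' v' -> u = u' /\ v = v'.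
Proof.
intros Hy [H1 H2] [H1' H2'].
assert (H : is_resolvent x y hzero (hsub u u') (hsub v v')).
{ split; rewrite shift_sub; apply ip_ext; intros w; ip_expand.
  - assert (h1 := f_equal (fun t => ip t w) H1). assert (h2 := f_equal (fun t => ip t w) H1').
    cbv beta in h1, h2. rewrite ip_add_l, ip_scal_l in h1, h2. lra.
  - rewrite H2, H2'. ip_expand. ring. }
apply is_resolvent_norm in H. rewrite ip_zero_l in H.
assert (h1 := ip_ge0 E (hsub u u')). assert (h2 := ip_ge0 E (hsub v v')).
assert (h3 := ip_ge0 E (shift x (hsub u u'))). assert (h4 := ip_ge0 E (shift x (hsub v v'))).
assert (0 < y ^ 2) by nra.
split; apply ip_sep; fold (hsub u u'); fold (hsub v v'); nra.
Qed.

(** A choice among solutions, meaningful for y <> 0, where the solution exists and is unique. *)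
Definition resolvent x y psi : E * E :=
  epsilon (inhabits (hzero, hzero)) (fun p => is_resolvent x y psi (fst p) (snd p)).
Definition resRe x y psi : E := fst (resolvent x y psi).
Definition resIm x y psi : E := snd (resolvent x y psi).

Lemma resolventP x y psi : y <> 0 -> is_resolvent x y psi (resRe x y psi) (resIm x y psi).
Proof.
intros Hy. destruct (is_resolvent_exists x y psi Hy) as [u [v H]].
apply (epsilon_spec (inhabits (hzero, hzero)) (fun p => is_resolvent x y psi (fst p) (snd p))).
now exists (u, v).
Qed.

Lemma resolventE x y psi u v : y <> 0 -> is_resolvent x y psi u v ->
  resRe x y psi = u /\ resIm x y psi = v.
Proof. intros Hy H. apply (is_resolvent_unique x y psi); trivial. now apply resolventP. Qed.

Lemma res_lin x y (s t : R) phi psi : y <> 0 ->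
  resRe x y (hadd (hscal s phi) (hscal t psi)) =
    hadd (hscal s (resRe x y phi)) (hscal t (resRe x y psi)) /\
  resIm x y (hadd (hscal s phi) (hscal t psi)) =
    hadd (hscal s (resIm x y phi)) (hscal t (resIm x y psi)).
Proof.
intros Hy. apply resolventE; trivial.
destruct (resolventP x y phi Hy) as [H1 H2], (resolventP x y psi Hy) as [H3 H4].
set (u := resRe x y phi) in *. set (v := resIm x y phi) in *.
set (u' := resRe x y psi) in *. set (v' := resIm x y psi) in *.
split; rewrite shift_add, !shift_scal; [rewrite <- H1, <- H3|rewrite H2, H4];
  apply ip_ext; intros w; ip_expand; ring.
Qed.

(** The resolvent of a real symmetric operator is complex symmetric, without conjugation, so its
    real and imaginary parts are both symmetric forms. *)
Lemma ip_res_sym x y phi psi : y <> 0 ->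
  ip phi (resRe x y psi) = ip (resRe x y phi) psi /\
  ip phi (resIm x y psi) = ip (resIm x y phi) psi.
Proof.
intros Hy.
destruct (resolventP x y phi Hy) as [H1 H2], (resolventP x y psi Hy) as [H3 H4].
set (u := resRe x y phi) in *. set (v := resIm x y phi) in *.
set (u' := resRe x y psi) in *. set (v' := resIm x y psi) in *.
assert (h := shift_sym x v v'). rewrite H2, H4, ip_scal_l, ip_scal_r in h.
assert (h' := Rmult_eq_reg_l _ _ _ h Hy).
split; rewrite <- H1, <- H3; ip_expand; rewrite shift_sym.
- rewrite h'. ring.
- rewrite H4, <- shift_sym, H2. ip_expand. ring.
Qed.

(** The resolvent identity R_{z'} - R_z = (z' - z) R_z R_{z'} paired with psi, imaginary part first.
    Moving R_z to the left gives the bilinear, not sesquilinear, pairing of u + i v with u' + i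
    v'. *)
Lemma ip_res_diff x y x' y' psi : y <> 0 -> y' <> 0 ->
  let u := resRe x y psi in let v := resIm x y psi in
  let u' := resRe x' y' psi in let v' := resIm x' y' psi in
  ip psi v' - ip psi v = (x' - x) * (ip u v' + ip u' v) + (y' - y) * (ip u u' - ip v v') /\
  ip psi u' - ip psi u = (x' - x) * (ip u u' - ip v v') - (y' - y) * (ip u v' + ip u' v).
Proof.
intros Hy Hy' u v u' v'.
destruct (resolventP x y psi Hy) as [H1 H2], (resolventP x' y' psi Hy') as [H3 H4].
fold u v in H1, H2. fold u' v' in H3, H4.
assert (F1 : ip psi v' = ip u (shift x v') + y * ip v v').
{ rewrite <- H1. ip_expand. now rewrite shift_sym. }
assert (F2 : ip psi v = ip u' (shift x' v) + y' * ip v' v).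
{ rewrite <- H3. ip_expand. now rewrite shift_sym. }
assert (F3 : ip psi u' = ip u (shift x u') + y * ip v u').
{ rewrite <- H1. ip_expand. now rewrite shift_sym. }
assert (F4 : ip u (shift x' u') = ip psi u - y' * ip u v').
{ rewrite <- H3, (ip_comm _ _ u). ip_expand. ring. }
assert (F5 : ip v (shift x v') = y * ip u v').
{ now rewrite <- shift_sym, H2, ip_scal_l. }
rewrite (ip_shift_move x' x), H4, ip_scal_r in F1, F5.
rewrite (ip_shift_move x x'), H2, ip_scal_r in F2.
rewrite (ip_shift_move x' x), F4 in F3.
rewrite (ip_comm _ u' u), (ip_comm _ v' v) in F2. rewrite (ip_comm _ u' v). rewrite (ip_comm _ v u') in *.
split; lra.
Qed.

Lemma res_bound x y psi : 0 < y ->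
  y * hnorm (resRe x y psi) <= hnorm psi /\ y * hnorm (resIm x y psi) <= hnorm psi.
Proof.
intros Hy.
assert (H := is_resolvent_norm x y psi _ _ (resolventP x y psi (Rgt_not_eq _ _ Hy))).
set (u := resRe x y psi) in *. set (v := resIm x y psi) in *.
assert (h1 := ip_ge0 E u). assert (h2 := ip_ge0 E v).
assert (h3 := ip_ge0 E (shift x u)). assert (h4 := ip_ge0 E (shift x v)).
assert (h5 : 0 <= y ^ 2 * ip u u) by (apply Rmult_le_pos; nra).
assert (h6 : 0 <= y ^ 2 * ip v v) by (apply Rmult_le_pos; nra).
split; (apply Rsqr_incr_0_var; [|apply hnorm_ge0]);
  rewrite 2!Rsqr_pow2, Rpow_mult_distr, 2!hnorm_sq; lra.
Qed.

(** The difference w of the two resolvent vectors satisfies (A - z') w = (z' - z) R_z psi, and each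
    of the two inversions costs a factor 1 / y0. *)
Lemma res_lipschitz x y x' y' psi y0 : 0 < y0 -> y0 <= y -> y0 <= y' ->
  let L := (Rabs (x' - x) + Rabs (y' - y)) * hnorm psi / y0 ^ 2 in
  hnorm (hsub (resRe x' y' psi) (resRe x y psi)) <= L /\
  hnorm (hsub (resIm x' y' psi) (resIm x y psi)) <= L.
Proof.
intros H0 Hy Hy' L.
assert (Hyn : y <> 0) by lra. assert (Hyn' : y' <> 0) by lra.
destruct (resolventP x y psi Hyn) as [H1 H2], (resolventP x' y' psi Hyn') as [H3 H4].
assert (Hn := is_resolvent_norm x y psi _ _ (resolventP x y psi Hyn)).
set (u := resRe x y psi) in *. set (v := resIm x y psi) in *.
set (u' := resRe x' y' psi) in *. set (v' := resIm x' y' psi) in *.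
assert (h := complex_shift_norm x' y' (hsub u' u) (hsub v' v)). cbv zeta in h.
pose (h1 := x' - x). pose (h2 := y' - y).
replace (hadd (shift x' (hsub u' u)) (hscal y' (hsub v' v)))
  with (hsub (hscal h1 u) (hscal h2 v)) in h.
2:{ rewrite shift_sub. apply ip_ext; intros w. ip_expand.
    assert (e1 := f_equal (fun t => ip t w) H1). assert (e2 := f_equal (fun t => ip t w) H3).
    cbv beta in e1, e2. rewrite ip_add_l, ip_scal_l in e1, e2.
    rewrite (ip_comm _ (shift x' u) w), (ip_shift_move x x'), (ip_comm _ w (shift x u)), (ip_comm _ w u).
    unfold h1, h2. lra. }
replace (hsub (shift x' (hsub v' v)) (hscal y' (hsub u' u)))
  with (hadd (hscal h1 v) (hscal h2 u)) in h.
2:{ rewrite shift_sub, H4. apply ip_ext; intros w. ip_expand.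
    rewrite (ip_comm _ (shift x' v) w), (ip_shift_move x x'), H2, (ip_comm _ w v). ip_expand.
    rewrite (ip_comm _ w u). unfold h1, h2. ring. }
assert (k1 := ip_ge0 E (shift x' (hsub u' u))). assert (k2 := ip_ge0 E (shift x' (hsub v' v))).
assert (k3 := ip_ge0 E (hsub u' u)). assert (k4 := ip_ge0 E (hsub v' v)).
assert (k5 := ip_ge0 E u). assert (k6 := ip_ge0 E v).
assert (k7 := ip_ge0 E (shift x u)). assert (k8 := ip_ge0 E (shift x v)).
replace (ip (hsub (hscal h1 u) (hscal h2 v)) (hsub (hscal h1 u) (hscal h2 v)) +
    ip (hadd (hscal h1 v) (hscal h2 u)) (hadd (hscal h1 v) (hscal h2 u)))
  with ((h1 ^ 2 + h2 ^ 2) * (ip u u + ip v v)) in h.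
2:{ ip_expand. rewrite (ip_comm _ v u). ring. }
assert (Hy2 : y0 ^ 2 <= y ^ 2) by (apply pow_incr; lra).
assert (Hy2' : y0 ^ 2 <= y' ^ 2) by (apply pow_incr; lra).
assert (Hp : 0 < y0 ^ 2) by (apply pow_lt; lra).
assert (a1 := Rabs_pos (x' - x)). assert (a2 := Rabs_pos (y' - y)).
assert (a3 := hnorm_ge0 psi).
assert (HL : 0 <= L).
{ unfold L. apply Rmult_le_pos; [|apply Rlt_le, Rinv_0_lt_compat; trivial].
  apply Rmult_le_pos; lra. }
assert (Hsq : y0 ^ 2 * y0 ^ 2 * L ^ 2 = (Rabs h1 + Rabs h2) ^ 2 * ip psi psi).
{ unfold L. fold h1 h2. rewrite <- hnorm_sq. field. lra. }
assert (Hh : h1 ^ 2 + h2 ^ 2 <= (Rabs h1 + Rabs h2) ^ 2).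
{ rewrite <- (pow2_abs h1), <- (pow2_abs h2). fold h1 in a1. fold h2 in a2. nra. }
assert (b1 : y0 ^ 2 * (ip u u + ip v v) <= ip psi psi).
{ apply Rle_trans with (y ^ 2 * (ip u u + ip v v)); [apply Rmult_le_compat_r; lra|lra]. }
assert (b2 : y0 ^ 2 * (ip (hsub u' u) (hsub u' u) + ip (hsub v' v) (hsub v' v))
    <= (h1 ^ 2 + h2 ^ 2) * (ip u u + ip v v)).
{ apply Rle_trans with (y' ^ 2 * (ip (hsub u' u) (hsub u' u) + ip (hsub v' v) (hsub v' v)));
    [apply Rmult_le_compat_r; lra|lra]. }
assert (b3 : y0 ^ 2 * (y0 ^ 2 * (ip (hsub u' u) (hsub u' u) + ip (hsub v' v) (hsub v' v)))
   <= y0 ^ 2 * (y0 ^ 2 * L ^ 2)).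
{ rewrite <- Rmult_assoc with (r3 := L ^ 2), Hsq.
  apply Rle_trans with ((h1 ^ 2 + h2 ^ 2) * (y0 ^ 2 * (ip u u + ip v v))).
  - replace ((h1 ^ 2 + h2 ^ 2) * (y0 ^ 2 * (ip u u + ip v v))) with
      (y0 ^ 2 * ((h1 ^ 2 + h2 ^ 2) * (ip u u + ip v v))) by ring.
    apply Rmult_le_compat_l; lra.
  - apply Rmult_le_compat; trivial; nra. }
apply Rmult_le_reg_l in b3; trivial. apply Rmult_le_reg_l in b3; trivial.
split; apply hnorm_le; trivial; lra.
Qed.

End Resolvent.

(** * Derivatives of the resolvent form and its integrals along horizontal lines *)

Section Poisson.
Context {E : hilbert} (A : selfadj E).
Implicit Types (u v f psi phi : E) (x y : R).

Lemma Rabs_ip_diff u v u' v' (B d : R) :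
  hnorm u <= B -> hnorm v' <= B -> hnorm (hsub u' u) <= d -> hnorm (hsub v' v) <= d ->
  Rabs (ip u' v' - ip u v) <= 2 * B * d.
Proof.
intros h1 h2 h3 h4.
replace (ip u' v' - ip u v) with (ip (hsub u' u) v' + ip u (hsub v' v)) by (ip_expand; ring).
apply Rle_trans with (1 := Rabs_triang _ _).
assert (a := Rabs_ip (hsub u' u) v'). assert (b := Rabs_ip u (hsub v' v)).
assert (k1 := hnorm_ge0 u). assert (k2 := hnorm_ge0 v').
assert (k3 := hnorm_ge0 (hsub u' u)). assert (k4 := hnorm_ge0 (hsub v' v)).
assert (hnorm (hsub u' u) * hnorm v' <= d * B) by (apply Rmult_le_compat; lra).
assert (hnorm u * hnorm (hsub v' v) <= B * d) by (apply Rmult_le_compat; lra).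
lra.
Qed.

Lemma res_bound_unif x y y0 psi : 0 < y0 -> y0 <= y ->
  hnorm (resRe A x y psi) <= hnorm psi / y0 /\ hnorm (resIm A x y psi) <= hnorm psi / y0.
Proof.
intros H0 Hy. destruct (res_bound A x y psi) as [h1 h2]; [lra|].
assert (k1 := hnorm_ge0 (resRe A x y psi)). assert (k2 := hnorm_ge0 (resIm A x y psi)).
split; apply Rmult_le_reg_l with y0; trivial; unfold Rdiv;
  rewrite (Rmult_comm (hnorm psi)), <- Rmult_assoc, Rinv_r, Rmult_1_l by lra; nra.
Qed.

(* Real part of [<psi, (A - z)^{-2} psi>], the derivative of [<psi, (A - z)^{-1} psi>]. *)
Definition res2 psi x y : R :=
  ip (resRe A x y psi) (resRe A x y psi) - ip (resIm A x y psi) (resIm A x y psi).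

(** By the resolvent identity the first bracket is a difference quotient of <psi, R_z psi>, so the
    first bound gives differentiability with derivative [res2]; the second gives continuity of that
    derivative. *)
Lemma res_quad_lipschitz psi y0 : 0 < y0 -> exists C, 0 <= C /\
  forall x y x' y', y0 <= y -> y0 <= y' ->
    let d := Rabs (x' - x) + Rabs (y' - y) in
    Rabs (ip (resRe A x y psi) (resRe A x' y' psi) - ip (resIm A x y psi) (resIm A x' y' psi)
      - res2 psi x y) <= C * d /\
    Rabs (res2 psi x' y' - res2 psi x y) <= C * d.
Proof.
intros H0.
pose (n := hnorm psi). assert (Hn : 0 <= n) by apply hnorm_ge0.
exists (4 * (n / y0) * (n / y0 ^ 2)). split.
{ assert (0 <= n / y0) by (apply Rdiv_le_0_compat; trivial).
  assert (0 <= n / y0 ^ 2) by (apply Rdiv_le_0_compat; [trivial|apply pow_lt; lra]). nra. }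
intros x y x' y' Hy Hy' d.
destruct (res_bound_unif x y y0 psi H0 Hy) as [b1 b2].
destruct (res_bound_unif x' y' y0 psi H0 Hy') as [b3 b4].
destruct (res_lipschitz A x y x' y' psi y0 H0 Hy Hy') as [l1 l2].
fold d n in l1, l2. fold n in b1, b2, b3, b4.
assert (Z : forall w : E, hnorm (hsub w w) <= d * n / y0 ^ 2).
{ intros w. apply hnorm_le.
  - apply Rdiv_le_0_compat; [|apply pow_lt; lra]. apply Rmult_le_pos; trivial.
    assert (a := Rabs_pos (x' - x)). assert (b := Rabs_pos (y' - y)). unfold d. lra.
  - ip_expand. apply Rle_trans with 0; [right; ring|apply pow2_ge_0]. }
assert (e : 4 * (n / y0) * (n / y0 ^ 2) * d
  = 2 * (n / y0) * (d * n / y0 ^ 2) + 2 * (n / y0) * (d * n / y0 ^ 2)) by (field; lra).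
rewrite e. unfold res2. split.
- assert (i1 := Rabs_ip_diff (resRe A x y psi) (resRe A x y psi) (resRe A x y psi) (resRe A x' y' psi)
    _ _ b1 b3 (Z _) l1).
  assert (i2 := Rabs_ip_diff (resIm A x y psi) (resIm A x y psi) (resIm A x y psi) (resIm A x' y' psi)
    _ _ b2 b4 (Z _) l2).
  apply Rabs_le. apply Rabs_le_between in i1, i2. lra.
- assert (i1 := Rabs_ip_diff (resRe A x y psi) (resRe A x y psi) (resRe A x' y' psi) (resRe A x' y' psi)
    _ _ b1 b3 l1 l1).
  assert (i2 := Rabs_ip_diff (resIm A x y psi) (resIm A x y psi) (resIm A x' y' psi) (resIm A x' y' psi)
    _ _ b2 b4 l2 l2).
  apply Rabs_le. apply Rabs_le_between in i1, i2. lra.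
Qed.

(** A Cauchy-Riemann equation for F(z) = <psi, (A - z)^{-1} psi>: the y-derivative of Im F and the
    x-derivative of Re F both equal Re F'. *)
Lemma is_derive_res psi x y : 0 < y ->
  is_derive (fun t => ip psi (resIm A x t psi)) y (res2 psi x y) /\
  is_derive (fun t => ip psi (resRe A t y psi)) x (res2 psi x y).
Proof.
intros Hy.
destruct (res_quad_lipschitz psi (y / 2)) as [C [HC H]]; [lra|].
assert (Hd : forall eps, 0 < eps -> 0 < Rmin (y / 2) (eps / (C + 1))).
{ intros eps He. apply Rmin_glb_lt; [lra|apply Rdiv_lt_0_compat; lra]. }
assert (Hf : forall eps h, 0 < eps -> Rabs h < Rmin (y / 2) (eps / (C + 1)) -> C * Rabs h < eps).
{ intros eps h He Hh. assert (h1 := Rlt_le_trans _ _ _ Hh (Rmin_r _ _)).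
  assert (h2 := Rabs_pos h).
  apply Rmult_lt_compat_r with (r := C + 1) in h1; [|lra].
  replace (eps / (C + 1) * (C + 1)) with eps in h1 by (field; lra). nra. }
split; apply is_derive_Reals; intros eps He; exists (mkposreal _ (Hd eps He)); simpl;
  intros h Hh0 Hh; assert (h3 := Hf eps h He Hh);
  assert (h4 := Rlt_le_trans _ _ _ Hh (Rmin_l _ _)); apply Rabs_lt_between in h4.
- destruct (ip_res_diff A x y x (y + h) psi) as [D _]; [lra|lra|].
  destruct (H x y x (y + h)) as [D' _]; [lra|lra|].
  replace ((ip psi (resIm A x (y + h) psi) - ip psi (resIm A x y psi)) / h)
    with (ip (resRe A x y psi) (resRe A x (y + h) psi) - ip (resIm A x y psi) (resIm A x (y + h) psi)).
  2:{ rewrite D. field. trivial. }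
  replace (x - x) with 0 in D' by ring. replace (y + h - y) with h in D' by ring.
  rewrite Rabs_R0, Rplus_0_l in D'. lra.
- destruct (ip_res_diff A x y (x + h) y psi) as [_ D]; [lra|lra|].
  destruct (H x y (x + h) y) as [D' _]; [lra|lra|].
  replace ((ip psi (resRe A (x + h) y psi) - ip psi (resRe A x y psi)) / h)
    with (ip (resRe A x y psi) (resRe A (x + h) y psi) - ip (resIm A x y psi) (resIm A (x + h) y psi)).
  2:{ rewrite D. field. trivial. }
  replace (y - y) with 0 in D' by ring. replace (x + h - x) with h in D' by ring.
  rewrite Rabs_R0, Rplus_0_r in D'. lra.
Qed.

Lemma res2_continuity_2d psi x y : 0 < y -> continuity_2d_pt (fun t s => res2 psi s t) y x.
Proof.
intros Hy eps.
destruct (res_quad_lipschitz psi (y / 2)) as [C [HC H]]; [lra|].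
assert (Hd : 0 < Rmin (y / 2) (eps / (2 * (C + 1)))).
{ apply Rmin_glb_lt; [lra|apply Rdiv_lt_0_compat; [apply cond_pos|lra]]. }
exists (mkposreal _ Hd). simpl. intros t s Ht Hs.
assert (h1 := Rlt_le_trans _ _ _ Ht (Rmin_l _ _)). apply Rabs_lt_between in h1.
assert (h2 := Rlt_le_trans _ _ _ Ht (Rmin_r _ _)).
assert (h3 := Rlt_le_trans _ _ _ Hs (Rmin_r _ _)).
destruct (H x y s t) as [_ D]; [lra|lra|].
apply Rle_lt_trans with (1 := D).
apply Rle_lt_trans with ((C + 1) * (Rabs (s - x) + Rabs (t - y))).
- apply Rmult_le_compat_r; [|lra]. assert (a := Rabs_pos (s - x)). assert (b := Rabs_pos (t - y)). lra.
- replace (pos eps) with ((C + 1) * (eps / (2 * (C + 1)) + eps / (2 * (C + 1)))) by (field; lra).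
  apply Rmult_lt_compat_l; lra.
Qed.

Lemma continuous_res phi psi x y : 0 < y ->
  continuous (fun t => ip phi (resRe A t y psi)) x /\ continuous (fun t => ip phi (resIm A t y psi)) x.
Proof.
intros Hy.
pose (C := hnorm phi * (hnorm psi / y ^ 2)).
assert (Hn := hnorm_ge0 psi). assert (Hf := hnorm_ge0 phi).
assert (HC : 0 <= C).
{ apply Rmult_le_pos; trivial. apply Rdiv_le_0_compat; [trivial|apply pow_lt; lra]. }
assert (K : forall F : R -> R, (forall t, Rabs (F t - F x) <= C * Rabs (t - x)) -> continuous F x).
{ intros F HF. apply continuity_pt_filterlim. intros eps He.
  exists (eps / (C + 1)). split; [apply Rdiv_lt_0_compat; lra|].
  intros t [_ Ht]. simpl in Ht |- *. unfold R_dist in *.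
  apply Rle_lt_trans with (1 := HF t).
  apply Rmult_lt_compat_r with (r := C + 1) in Ht; [|lra].
  replace (eps / (C + 1) * (C + 1)) with eps in Ht by (field; lra).
  assert (h := Rabs_pos (t - x)). nra. }
split; apply K; intros t; destruct (res_lipschitz A x y t y psi y Hy) as [l1 l2]; try lra;
  replace (y - y) with 0 in l1, l2 by ring; rewrite Rabs_R0, Rplus_0_r in l1, l2;
  rewrite <- ip_sub_r; apply Rle_trans with (1 := Rabs_ip _ _);
  unfold C; rewrite Rmult_assoc; apply Rmult_le_compat_l; trivial;
  unfold Rdiv in *; lra.
Qed.

(** The Herglotz identity Im <psi, R_z psi> = Im z |R_z psi|^2, which makes the imaginary part
    nonnegative in the upper half-plane. *)
Lemma ip_resIm_self psi x y : y <> 0 -> ip psi (resIm A x y psi) =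
  y * (ip (resRe A x y psi) (resRe A x y psi) + ip (resIm A x y psi) (resIm A x y psi)).
Proof.
intros Hy. destruct (resolventP A x y psi Hy) as [H1 H2].
set (u := resRe A x y psi) in *. set (v := resIm A x y psi) in *.
rewrite <- H1. ip_expand. rewrite shift_sym, H2. ip_expand. ring.
Qed.

(* Contour deformation: by the Cauchy-Riemann equations the integral along [Im z = e] differs from
   that along [Im z = 1] by the contribution of two vertical sides, which keep at distance [1] from
   the spectrum. *)
Lemma resIm_integral_bound psi D e : op_norm A + 1 <= D -> 0 < e <= 1 ->
  RInt (fun x => ip psi (resIm A x e psi)) (- D) D <= (2 * D + 2) * ip psi psi.
Proof.
intros HD He.
assert (HN := op_norm_ge0 _ A).
pose (F := fun y => RInt (fun x => ip psi (resIm A x y psi)) (- D) D).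
pose (dF := fun y => ip psi (resRe A D y psi) - ip psi (resRe A (- D) y psi)).
assert (HF : forall y, 0 < y -> is_derive F y (dF y)).
{ intros y Hy.
  assert (Hloc : locally y (fun t => 0 < t)).
  { exists (mkposreal y Hy). intros t Ht. change (Rabs (t - y) < y) in Ht. apply Rabs_lt_between in Ht. lra. }
  assert (HD2 : forall t s : R, 0 < t -> Derive (fun z => ip psi (resIm A s z psi)) t = res2 psi s t).
  { intros t s Ht. apply is_derive_unique; now apply is_derive_res. }
  replace (dF y) with (RInt (fun t => Derive (fun z => ip psi (resIm A t z psi)) y) (- D) D).
  - apply (is_derive_RInt_param (fun y x => ip psi (resIm A x y psi)) (- D) D y).
    + revert Hloc. apply filter_imp. intros t Ht s _.
      exists (res2 psi s t). now apply is_derive_res.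
    + intros s _. apply continuity_2d_pt_ext_loc with (fun t s => res2 psi s t).
      * exists (mkposreal y Hy). simpl. intros t s' Ht _. rewrite HD2; trivial.
        apply Rabs_lt_between in Ht. lra.
      * now apply res2_continuity_2d.
    + revert Hloc. apply filter_imp. intros t Ht. apply (ex_RInt_continuous (V := R_CompleteNormedModule)).
      intros s _. now apply continuous_res.
  - rewrite RInt_ext with (g := Derive (fun s => ip psi (resRe A s y psi))).
    + unfold dF. apply RInt_Derive.
      * intros s _. exists (res2 psi s y). now apply is_derive_res.
      * intros s _. apply continuous_ext with (fun s => res2 psi s y).
        { intros t. symmetry. apply is_derive_unique; now apply is_derive_res. }
        intros P [d HP]. destruct (res2_continuity_2d psi s y Hy d) as [d' Hd'].
        exists d'. intros t Ht. apply HP. apply Hd'; [|apply Ht].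
        rewrite Rminus_diag, Rabs_R0. apply cond_pos.
    + intros s _. rewrite HD2 by trivial. symmetry. apply is_derive_unique; now apply is_derive_res. }
assert (Hside : forall x y, D <= Rabs x -> 0 < y -> Rabs (ip psi (resRe A x y psi)) <= ip psi psi).
{ intros x y Hx Hy. apply Rle_trans with (1 := Rabs_ip _ _).
  assert (Hyn : y <> 0) by lra.
  assert (h := is_resolvent_norm A x y psi _ _ (resolventP A x y psi Hyn)).
  set (u := resRe A x y psi) in *. set (v := resIm A x y psi) in *.
  assert (h1 := shift_below A x u). assert (h2 := ip_ge0 E (shift A x v)).
  assert (h3 := ip_ge0 E u). assert (h4 := ip_ge0 E v). assert (h5 : 0 <= y ^ 2) by nra.
  assert (hnorm u <= hnorm psi).
  { apply hnorm_le; [apply hnorm_ge0|]. rewrite hnorm_sq. specialize (h1 ltac:(lra)). nra. }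
  rewrite <- (hnorm_sq psi). assert (h6 := hnorm_ge0 psi). nra. }
assert (HdF : forall y, 0 < y -> - (2 * ip psi psi) <= dF y).
{ intros y Hy. unfold dF.
  assert (h1 := Hside D y). assert (h2 := Hside (- D) y). rewrite Rabs_Ropp in h2.
  rewrite (Rabs_pos_eq D) in h1, h2 by lra.
  specialize (h1 (Rle_refl _) Hy). specialize (h2 (Rle_refl _) Hy).
  apply Rabs_le_between in h1, h2. lra. }
(* Origin of 2 * D + 2: the line Im z = 1 contributes length 2 * D times a resolvent norm of at most
   1, and each of the two vertical sides has length at most 1 and real part at most |psi|^2. *)
assert (HF1 : F 1 <= 2 * D * ip psi psi).
{ unfold F. replace (2 * D * ip psi psi) with (RInt (fun _ => ip psi psi) (- D) D).
  2:{ rewrite RInt_const. unfold scal; simpl; unfold mult; simpl. ring. }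
  apply RInt_le.
  - lra.
  - apply (ex_RInt_continuous (V := R_CompleteNormedModule)). intros s _. apply continuous_res; lra.
  - apply ex_RInt_const.
  - intros x _. apply Rle_trans with (1 := Rle_abs _). apply Rle_trans with (1 := Rabs_ip _ _).
    destruct (res_bound A x 1 psi) as [_ h]; [lra|]. rewrite <- (hnorm_sq psi).
    assert (h6 := hnorm_ge0 psi). nra. }
assert (h0 := ip_ge0 E psi).
change (F e <= (2 * D + 2) * ip psi psi).
destruct (MVT_gen F e 1 dF) as [c [Hc Hc']].
- intros y Hy. apply HF. rewrite Rmin_left in Hy; lra.
- intros y Hy. apply continuity_pt_filterlim. apply (ex_derive_continuous F y).
  exists (dF y). apply HF. rewrite Rmin_left in Hy; lra.
- rewrite Rmin_left, Rmax_right in Hc by lra. assert (h := HdF c ltac:(lra)). nra.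
Qed.

End Poisson.

(** * Square-summable sequences on Z *)

Definition zpair (f : Z -> R) (i : nat) : R := f (Z.of_nat i) + f (- Z.of_nat i - 1)%Z.
(** The sum over -N-1 <= k <= N, in the pairing used by [l2Z]. The asymmetric window is why
    telescoping leaves boundary terms at N and -N-2. *)
Definition zsum (f : Z -> R) (N : nat) : R := sum_f_R0 (zpair f) N.

Lemma zsum_le f g N : (forall k, f k <= g k) -> zsum f N <= zsum g N.
Proof. intros H. apply sum_Rle. intros i _. apply Rplus_le_compat; apply H. Qed.

Lemma zsum_ext f g N : (forall k, f k = g k) -> zsum f N = zsum g N.
Proof. intros H. apply sum_eq. intros i _. unfold zpair. now rewrite 2!H. Qed.

Lemma zsum_plus f g N : zsum (fun k => f k + g k) N = zsum f N + zsum g N.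
Proof. unfold zsum. rewrite <- sum_plus. apply sum_eq. intros i _. unfold zpair. ring. Qed.

Lemma zsum_scal c f N : zsum (fun k => c * f k) N = c * zsum f N.
Proof. unfold zsum. rewrite scal_sum. apply sum_eq. intros i _. unfold zpair. ring. Qed.

Lemma zsum_ge0 f N : (forall k, 0 <= f k) -> 0 <= zsum f N.
Proof. intros H. apply cond_pos_sum. intros i. unfold zpair. apply Rplus_le_le_0_compat; apply H. Qed.

Lemma zsum_succ_shift f N :
  zsum (fun k => f (k + 1)%Z) N = zsum f N + f (Z.of_nat N + 1)%Z - f (- Z.of_nat N - 1)%Z.
Proof.
unfold zsum. induction N as [|N IH].
- unfold zpair; simpl. ring.
- rewrite 2!tech5, IH. unfold zpair.
  replace (Z.of_nat (S N)) with (Z.of_nat N + 1)%Z by lia.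
  replace (- (Z.of_nat N + 1) - 1 + 1)%Z with (- Z.of_nat N - 1)%Z by lia. ring.
Qed.

Lemma zsum_telescope c N :
  zsum (fun k => c k - c (k - 1)%Z) N = c (Z.of_nat N) - c (- Z.of_nat N - 2)%Z.
Proof.
unfold zsum. induction N as [|N IH].
- unfold zpair; simpl. ring.
- rewrite tech5, IH. unfold zpair.
  replace (Z.of_nat (S N)) with (Z.of_nat N + 1)%Z by lia.
  replace (- (Z.of_nat N + 1) - 1)%Z with (- Z.of_nat N - 2)%Z by lia.
  replace (- Z.of_nat N - 2 - 1)%Z with (- (Z.of_nat N + 1) - 2)%Z by lia.
  replace (Z.of_nat N + 1 - 1)%Z with (Z.of_nat N) by lia. ring.
Qed.

Lemma zsum_incr f N : (forall k, 0 <= f k) -> zsum f N <= zsum f (S N).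
Proof.
intros H. unfold zsum. rewrite tech5.
assert (h1 := H (Z.of_nat (S N))). assert (h2 := H (- Z.of_nat (S N) - 1)%Z).
unfold zpair at 3. lra.
Qed.

Lemma zsum_shift_le f N : (forall k, 0 <= f k) ->
  zsum (fun k => f (k + 1)%Z) N <= zsum f (S N) /\ zsum (fun k => f (k - 1)%Z) N <= zsum f (S N).
Proof.
intros H.
assert (e : zsum f (S N) = zsum f N + (f (Z.of_nat N + 1)%Z + f (- Z.of_nat N - 2)%Z)).
{ unfold zsum. rewrite tech5. unfold zpair at 2.
  replace (Z.of_nat (S N)) with (Z.of_nat N + 1)%Z by lia.
  replace (- (Z.of_nat N + 1) - 1)%Z with (- Z.of_nat N - 2)%Z by lia. ring. }
assert (h1 := H (Z.of_nat N + 1)%Z). assert (h2 := H (- Z.of_nat N - 2)%Z).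
assert (h3 := H (- Z.of_nat N - 1)%Z). assert (h4 := H (Z.of_nat N)).
split.
- rewrite zsum_succ_shift. lra.
- assert (h := zsum_telescope f N).
  assert (h' := zsum_plus (fun k => f k - f (k - 1)%Z) (fun k => f (k - 1)%Z) N). cbv beta in h'.
  rewrite (zsum_ext _ f) in h' by (intros; ring). lra.
Qed.

Lemma zsum_coord f k : (forall k, 0 <= f k) -> forall N, (Z.abs_nat k <= N)%nat -> f k <= zsum f N.
Proof.
intros H N. induction N as [|N IH]; intros HN.
- replace k with 0%Z by lia. unfold zsum, zpair; simpl. assert (h := H (-1)%Z). lra.
- destruct (Nat.eq_dec (Z.abs_nat k) (S N)) as [e|e].
  + unfold zsum. rewrite tech5. fold (zsum f N). assert (h := zsum_ge0 f N H).
    unfold zpair. assert (h1 := H (Z.of_nat (S N))). assert (h2 := H (- Z.of_nat (S N) - 1)%Z).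
    destruct (Z.le_ge_cases 0 k) as [g|g].
    * replace k with (Z.of_nat (S N)) by lia. lra.
    * assert (h4 : f k <= zsum f N); [|lra].
      replace k with (- Z.of_nat N - 1)%Z by lia.
      destruct N as [|N].
      { unfold zsum, zpair; simpl. assert (h3 := H 0%Z). lra. }
      unfold zsum. rewrite tech5. fold (zsum f N). assert (h5 := zsum_ge0 f N H).
      unfold zpair. assert (h6 := H (Z.of_nat (S N))). lra.
  + apply Rle_trans with (zsum f N); [apply IH; lia|]. now apply zsum_incr.
Qed.

(** Fatou's lemma on one window; applied to every N it turns pointwise convergence and a bound on
    the squares into a norm bound for the limit. *)
Lemma zsum_fatou (w : nat -> Z -> R) (v : Z -> R) (e : R) (N N0 : nat) :
  (forall k, Un_cv (fun m => w m k) (v k)) ->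
  (forall m, (N0 <= m)%nat -> zsum (fun k => w m k ^ 2) N <= e) ->
  zsum (fun k => v k ^ 2) N <= e.
Proof.
intros Hw He.
assert (H1 : forall k, is_lim_seq (fun m => w m k ^ 2) (v k ^ 2)).
{ intros k. simpl. specialize (Hw k). apply is_lim_seq_Reals in Hw.
  apply is_lim_seq_mult'; trivial. apply is_lim_seq_mult'; trivial. apply is_lim_seq_const. }
assert (H2 : is_lim_seq (fun m => zsum (fun k => w m k ^ 2) N) (zsum (fun k => v k ^ 2) N)).
{ unfold zsum. induction N as [|N IH].
  - simpl. unfold zpair. apply is_lim_seq_plus'; apply H1.
  - rewrite tech5. apply is_lim_seq_ext with (fun m => sum_f_R0 (zpair (fun k => w m k ^ 2)) N +
      zpair (fun k => w m k ^ 2) (S N)).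
    { intros m. now rewrite tech5. }
    apply is_lim_seq_plus'.
    + apply IH. intros m Hm. apply Rle_trans with (2 := He m Hm). apply zsum_incr. intros k. apply pow2_ge_0.
    + unfold zpair. apply is_lim_seq_plus'; apply H1. }
assert (h : Rbar_le (zsum (fun k => v k ^ 2) N) e); [|exact h].
apply is_lim_seq_le_loc with (fun m => zsum (fun k => w m k ^ 2) N) (fun _ => e); trivial.
- exists N0. apply He.
- apply is_lim_seq_const.
Qed.

Lemma l2ZE v : l2Z v <-> exists M, forall N, zsum (fun k => v k ^ 2) N <= M.
Proof. split; intros [M H]; exists M; exact H. Qed.

Lemma nonneg_bounded_series (a : nat -> R) M : (forall i, 0 <= a i) -> (forall N, sum_f_R0 a N <= M) ->
  ex_series a /\ Series a <= M.
Proof.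
intros Ha HM.
assert (H : ex_finite_lim_seq (sum_n a)).
{ apply ex_finite_lim_seq_incr with M.
  - intros n. rewrite sum_Sn. unfold plus; simpl. specialize (Ha (S n)). lra.
  - intros n. rewrite sum_n_Reals. apply HM. }
destruct H as [l Hl].
assert (Hs : is_series a l) by exact Hl.
split; [now exists l|].
rewrite (is_series_unique _ _ Hs).
assert (h : Rbar_le l M); [|exact h].
apply is_lim_seq_le with (sum_n a) (fun _ => M); trivial.
- intros n. rewrite sum_n_Reals. apply HM.
- apply is_lim_seq_const.
Qed.

Lemma partial_sum_le (a : nat -> R) N : (forall i, 0 <= a i) -> ex_series a -> sum_f_R0 a N <= Series a.
Proof.
intros Ha [l Hl]. rewrite (is_series_unique _ _ Hl), <- sum_n_Reals.
assert (h : Rbar_le (sum_n a N) l); [|exact h].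
apply is_lim_seq_incr_compare with (1 := Hl).
intros n. rewrite sum_Sn. unfold plus; simpl. specialize (Ha (S n)). lra.
Qed.

Lemma ex_series_sq v : l2Z v -> ex_series (zpair (fun k => v k ^ 2)).
Proof.
intros [M H]. apply (nonneg_bounded_series _ M); trivial.
intros i. unfold zpair. assert (h1 := pow2_ge_0 (v (Z.of_nat i))).
assert (h2 := pow2_ge_0 (v (- Z.of_nat i - 1)%Z)). lra.
Qed.

Lemma l2Z_lin s t u v : l2Z u -> l2Z v -> l2Z (fun k => s * u k + t * v k).
Proof.
rewrite 3!l2ZE. intros [M HM] [M' HM']. exists (2 * s ^ 2 * M + 2 * t ^ 2 * M'). intros N.
apply Rle_trans with (zsum (fun k => 2 * s ^ 2 * u k ^ 2 + 2 * t ^ 2 * v k ^ 2) N).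
- apply zsum_le. intros k. assert (h := pow2_ge_0 (s * u k - t * v k)). nra.
- rewrite zsum_plus, 2!zsum_scal. specialize (HM N). specialize (HM' N).
  assert (h1 := pow2_ge_0 s). assert (h2 := pow2_ge_0 t). nra.
Qed.

(** Polarization: u v = ((u + v) / 2)^2 - ((u - v) / 2)^2, a difference of two convergent series. *)
Lemma ex_series_mult u v : l2Z u -> l2Z v -> ex_series (zpair (fun k => u k * v k)).
Proof.
intros Hu Hv.
assert (H := ex_series_sq _ (l2Z_lin (1/2) (1/2) u v Hu Hv)).
assert (H' := ex_series_sq _ (l2Z_lin (1/2) (-1/2) u v Hu Hv)).
apply (ex_series_ext (fun i => minus (zpair (fun k => (1/2 * u k + 1/2 * v k) ^ 2) i)
  (zpair (fun k => (1/2 * u k + -1/2 * v k) ^ 2) i))).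
- intros i. match goal with |- minus ?a ?b = ?c => change (@eq R (a - b) c) end.
  unfold zpair. field.
- now apply (ex_series_minus (V := R_NormedModule)).
Qed.

Definition l2vec := {v : Z -> R | l2Z v}.
Definition vec (v : l2vec) : Z -> R := proj1_sig v.
Coercion vec : l2vec >-> Funclass.

Lemma l2Z_vec (u : l2vec) : l2Z u.
Proof. exact (proj2_sig u). Qed.

Lemma l2vec_ext (u v : l2vec) : (forall k, u k = v k) -> u = v.
Proof.
intros H. destruct u as [u Hu], v as [v Hv]. simpl in H.
assert (e : u = v) by (apply functional_extensionality; exact H).
subst v. f_equal. apply proof_irrelevance.
Qed.

Lemma l2Z_zero : l2Z (fun _ => 0).
Proof. rewrite l2ZE. exists 0. intros N. rewrite (zsum_ext _ (fun k => 0 * 0)), zsum_scal; [lra|]. intros; ring. Qed.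

Definition l2_zero : l2vec := exist _ _ l2Z_zero.

Lemma l2Z_add (u v : l2vec) : l2Z (fun k => u k + v k).
Proof.
assert (H := l2Z_lin 1 1 _ _ (l2Z_vec u) (l2Z_vec v)).
replace (fun k => u k + v k) with (fun k => 1 * u k + 1 * v k); trivial.
apply functional_extensionality. intros k. ring.
Qed.

Lemma l2Z_scal (c : R) (u : l2vec) : l2Z (fun k => c * u k).
Proof.
assert (H := l2Z_lin c 0 _ _ (l2Z_vec u) (l2Z_vec u)).
replace (fun k => c * u k) with (fun k => c * u k + 0 * u k); trivial.
apply functional_extensionality. intros k. ring.
Qed.

Definition l2_add (u v : l2vec) : l2vec := exist _ _ (l2Z_add u v).
Definition l2_scal (c : R) (u : l2vec) : l2vec := exist _ _ (l2Z_scal c u).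
Definition l2_ip (u v : l2vec) : R := Series (zpair (fun k => u k * v k)).

Lemma l2_ip_sq_le (u : l2vec) N : zsum (fun k => u k ^ 2) N <= l2_ip u u.
Proof.
unfold l2_ip. rewrite (zsum_ext _ (fun k => u k * u k)) by (intros; ring).
apply partial_sum_le.
- intros i. unfold zpair. nra.
- apply ex_series_mult; apply l2Z_vec.
Qed.

Lemma l2_ip_sq_bound (u : l2vec) M : (forall N, zsum (fun k => u k ^ 2) N <= M) -> l2_ip u u <= M.
Proof.
intros H. apply nonneg_bounded_series.
- intros i. unfold zpair. nra.
- intros N. rewrite <- (H N). right. apply zsum_ext. intros; ring.
Qed.

Lemma l2_coord_le (u : l2vec) k : u k ^ 2 <= l2_ip u u.
Proof.
apply Rle_trans with (2 := l2_ip_sq_le u (Z.abs_nat k)).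
apply (zsum_coord (fun k => u k ^ 2)); [intros; apply pow2_ge_0|trivial].
Qed.

Lemma l2_ip_comm u v : l2_ip u v = l2_ip v u.
Proof. apply Series_ext. intros i. unfold zpair. ring. Qed.

Lemma l2_ip_zero_l u : l2_ip l2_zero u = 0.
Proof.
unfold l2_ip. rewrite (Series_ext _ (fun i => 0 * zpair (fun k => u k * u k) i)).
- rewrite Series_scal_l. ring.
- intros i. unfold zpair; simpl. ring.
Qed.

Lemma l2_ip_add_l u v w : l2_ip (l2_add u v) w = l2_ip u w + l2_ip v w.
Proof.
unfold l2_ip. rewrite <- Series_plus; try (apply ex_series_mult; apply l2Z_vec).
apply Series_ext. intros i. unfold zpair; simpl. ring.
Qed.

Lemma l2_ip_scal_l c u v : l2_ip (l2_scal c u) v = c * l2_ip u v.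
Proof.
unfold l2_ip. rewrite <- Series_scal_l. apply Series_ext. intros i. unfold zpair; simpl. ring.
Qed.

Lemma l2_ip_ge0 u : 0 <= l2_ip u u.
Proof. apply Rle_trans with (2 := l2_coord_le u 0). apply pow2_ge_0. Qed.

Lemma l2_ip_sep u v : l2_ip (l2_add u (l2_scal (-1) v)) (l2_add u (l2_scal (-1) v)) = 0 -> u = v.
Proof.
intros H. apply l2vec_ext. intros k.
assert (h := l2_coord_le (l2_add u (l2_scal (-1) v)) k). rewrite H in h. simpl in h. nra.
Qed.

(** The limit is taken coordinatewise; Fatou in the second index of the Cauchy condition bounds the
    distance to it and shows that it is square summable. *)
Lemma l2_complete (s : nat -> l2vec) :
  (forall e, 0 < e -> exists N, forall n m, (N <= n)%nat -> (N <= m)%nat ->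
     l2_ip (l2_add (s n) (l2_scal (-1) (s m))) (l2_add (s n) (l2_scal (-1) (s m))) <= e) ->
  exists v, forall e, 0 < e -> exists N, forall n, (N <= n)%nat ->
     l2_ip (l2_add (s n) (l2_scal (-1) v)) (l2_add (s n) (l2_scal (-1) v)) <= e.
Proof.
intros H.
assert (Hc : forall k, Cauchy_crit (fun n => s n k)).
{ intros k e He. destruct (H ((e / 2) ^ 2)) as [N HN]; [apply pow_lt; lra|].
  exists N. intros n m Hn Hm. unfold R_dist.
  assert (h := l2_coord_le (l2_add (s n) (l2_scal (-1) (s m))) k).
  specialize (HN n m Hn Hm). simpl in h.
  apply Rle_lt_trans with (e / 2); [|lra].
  apply Rsqr_incr_0_var; [|lra]. rewrite <- Rsqr_abs, 2!Rsqr_pow2. simpl in *. lra. }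
pose (v := fun k => proj1_sig (Rcomplete.R_complete _ (Hc k))).
assert (Hv : forall k, Un_cv (fun n => s n k) (v k)) by (intros k; apply (proj2_sig (Rcomplete.R_complete _ (Hc k)))).
assert (Hd : forall e, 0 < e -> exists N, forall n, (N <= n)%nat ->
  forall M, zsum (fun k => (s n k - v k) ^ 2) M <= e).
{ intros e He. destruct (H e He) as [N HN]. exists N. intros n Hn M.
  apply (zsum_fatou (fun m k => s n k - s m k) (fun k => s n k - v k) e M N).
  - intros k. apply CV_minus; [|apply Hv]. intros eps Heps. exists 0%nat. intros. unfold R_dist.
    rewrite Rminus_diag, Rabs_R0. trivial.
  - intros m Hm. apply Rle_trans with (2 := HN n m Hn Hm).
    apply Rle_trans with (2 := l2_ip_sq_le _ M). right. apply zsum_ext. intros k; simpl. ring. }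
assert (Lv : l2Z v).
{ destruct (Hd 1 Rlt_0_1) as [N HN]. specialize (HN N (Nat.le_refl _)).
  assert (L : l2Z (fun k => s N k - v k)) by (apply l2ZE; now exists 1).
  assert (L' := l2Z_lin 1 (-1) _ _ (l2Z_vec (s N)) L).
  replace v with (fun k => 1 * s N k + -1 * (s N k - v k)); trivial.
  apply functional_extensionality. intros k. ring. }
exists (exist _ v Lv). intros e He. destruct (Hd e He) as [N HN]. exists N. intros n Hn.
apply l2_ip_sq_bound. intros M. apply Rle_trans with (2 := HN n Hn M).
right. apply zsum_ext. intros k. simpl. ring.
Qed.

Definition l2 : hilbert :=
  Hilbert l2vec l2_zero l2_add l2_scal l2_ip l2_ip_comm l2_ip_zero_l l2_ip_add_l l2_ip_scal_l
    l2_ip_ge0 l2_ip_sep l2_complete.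

(** * Two-sided Jacobi operators *)

Lemma l2Z_vanish v : l2Z v -> forall e, 0 < e -> exists N, forall k, (N <= Z.abs k)%Z -> Rabs (v k) <= e.
Proof.
intros Hv e He.
assert (H := ex_series_lim_0 _ (ex_series_sq v Hv)).
apply is_lim_seq_Reals in H. destruct (H (e ^ 2)) as [N HN]; [apply pow_lt; trivial|].
exists (Z.of_nat N + 1)%Z. intros k Hk.
assert (h : v k ^ 2 <= e ^ 2).
{ destruct (Z.le_ge_cases 0 k) as [g|g].
  - specialize (HN (Z.to_nat k) ltac:(lia)). unfold R_dist, zpair in HN.
    rewrite Z2Nat.id, Rminus_0_r in HN by trivial. apply Rabs_lt_between in HN.
    assert (h := pow2_ge_0 (v (- k - 1)%Z)). lra.
  - specialize (HN (Z.to_nat (- k - 1)) ltac:(lia)). unfold R_dist, zpair in HN.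
    rewrite Z2Nat.id, Rminus_0_r in HN by lia. replace (- (- k - 1) - 1)%Z with k in HN by lia.
    apply Rabs_lt_between in HN. assert (h := pow2_ge_0 (v (- k - 1)%Z)). lra. }
apply Rsqr_incr_0_var; [|lra]. rewrite <- Rsqr_abs, 2!Rsqr_pow2. trivial.
Qed.

Definition delta_fun (n k : Z) : R := if Z.eq_dec k n then 1 else 0.

(** The point mass at n is the difference of a step function, so the sum telescopes. *)
Lemma zsum_delta n v N : zsum (fun k => delta_fun n k * v k) N =
  (if Z_le_dec n (Z.of_nat N) then v n else 0) - (if Z_le_dec n (- Z.of_nat N - 2) then v n else 0).
Proof.
rewrite <- (zsum_telescope (fun k => if Z_le_dec n k then v n else 0)).
apply zsum_ext. intros k. unfold delta_fun.
destruct (Z.eq_dec k n); [subst|]; repeat destruct Z_le_dec; try lia; ring.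
Qed.

Lemma l2Z_delta n : l2Z (delta_fun n).
Proof.
apply l2ZE. exists 1. intros N.
rewrite (zsum_ext _ (fun k => delta_fun n k * 1)).
- rewrite zsum_delta. repeat destruct Z_le_dec; lra.
- intros k. unfold delta_fun. destruct Z.eq_dec; ring.
Qed.

Definition delta (n : Z) : l2vec := exist _ _ (l2Z_delta n).

Lemma ip_delta n (v : l2) : ip (delta n : l2) v = vec v n.
Proof.
change (Series (zpair (fun k => delta_fun n k * vec v k)) = vec v n).
apply is_series_unique.
assert (H : is_lim_seq (sum_n (zpair (fun k => delta_fun n k * vec v k))) (vec v n)); [|exact H].
apply is_lim_seq_ext_loc with (fun _ => vec v n); [|apply is_lim_seq_const].
exists (Z.to_nat (Z.abs n)). intros N HN. rewrite sum_n_Reals.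
change (vec v n = zsum (fun k => delta_fun n k * vec v k) N).
rewrite zsum_delta. repeat destruct Z_le_dec; try lia. ring.
Qed.

Section Jacobi.
Context (a b : Z -> R) (M : R) (Ha : forall k, Rabs (a k) <= M) (Hb : forall k, Rabs (b k) <= M).

(** Of the 9, one factor 3 comes from (p + q + r)^2 <= 3 (p^2 + q^2 + r^2) and the other from the
    three shifted copies of v, each inside the enlarged window. *)
Lemma twoJ_sq_le v N : zsum (fun k => twoJ a b v k ^ 2) N <= 9 * M ^ 2 * zsum (fun k => v k ^ 2) (S N).
Proof using Ha Hb.
apply Rle_trans with (zsum (fun k => 3 * M ^ 2 * (v (k - 1)%Z ^ 2 + v k ^ 2 + v (k + 1)%Z ^ 2)) N).
- apply zsum_le. intros k. unfold twoJ.
  assert (K : forall c t, Rabs c <= M -> (c * t) ^ 2 <= M ^ 2 * t ^ 2).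
  { intros c t Hc. rewrite Rpow_mult_distr. apply Rmult_le_compat_r; [apply pow2_ge_0|].
    rewrite <- pow2_abs. apply pow_incr. split; [apply Rabs_pos|trivial]. }
  assert (h1 := K _ (v (k - 1)%Z) (Ha (k - 1)%Z)). assert (h2 := K _ (v k) (Hb k)).
  assert (h3 := K _ (v (k + 1)%Z) (Ha k)).
  set (p := a (k - 1)%Z * v (k - 1)%Z) in *. set (q := b k * v k) in *. set (r := a k * v (k + 1)%Z) in *.
  assert ((p + q + r) ^ 2 <= 3 * (p ^ 2 + q ^ 2 + r ^ 2)).
  { assert (0 <= (p - q) ^ 2 + (q - r) ^ 2 + (p - r) ^ 2) by
      (assert (h := pow2_ge_0 (p - q)); assert (h' := pow2_ge_0 (q - r)); assert (h'' := pow2_ge_0 (p - r)); lra).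
    lra. }
  lra.
- rewrite zsum_scal, 2!zsum_plus.
  destruct (zsum_shift_le (fun k => v k ^ 2) N) as [h1 h2]; [intros; apply pow2_ge_0|].
  assert (h3 := zsum_incr (fun k => v k ^ 2) N (fun k => pow2_ge_0 _)).
  assert (h4 := pow2_ge_0 M). nra.
Qed.

Lemma l2Z_twoJ v : l2Z v -> l2Z (twoJ a b v).
Proof using Ha Hb.
rewrite 2!l2ZE. intros [C H]. exists (9 * M ^ 2 * C). intros N.
apply Rle_trans with (1 := twoJ_sq_le v N). apply Rmult_le_compat_l; [|apply H].
assert (h4 := pow2_ge_0 M). lra.
Qed.

Definition jacobi_op (v : l2) : l2 := exist _ _ (l2Z_twoJ _ (l2Z_vec v)).

Lemma jacobi_op_add u v : jacobi_op (hadd u v) = hadd (jacobi_op u) (jacobi_op v).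
Proof. apply l2vec_ext. intros k. simpl. unfold twoJ; simpl. ring. Qed.

Lemma jacobi_op_scal (c : R) u : jacobi_op (hscal c u) = hscal c (jacobi_op u).
Proof. apply l2vec_ext. intros k. simpl. unfold twoJ; simpl. ring. Qed.

(** The difference of the two pairings telescopes to values of the Wronskian [c] at the ends of the
    window, which tend to 0 because u and v vanish at infinity. *)
Lemma jacobi_op_sym u v : ip (jacobi_op u) v = ip u (jacobi_op v).
Proof using Ha.
assert (HM : 0 <= M) by (apply Rle_trans with (2 := Ha 0); apply Rabs_pos).
pose (c := fun k => a k * (vec u (k + 1)%Z * vec v k - vec u k * vec v (k + 1)%Z)).
apply Rminus_diag_uniq.
change (Series (zpair (fun k => twoJ a b (vec u) k * vec v k)) - Series (zpair (fun k => vec u k * twoJ a b (vec v) k)) = 0).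
rewrite <- Series_minus; try (apply ex_series_mult; try apply l2Z_twoJ; apply l2Z_vec).
apply is_series_unique.
assert (H : is_lim_seq (sum_n (fun i => zpair (fun k => twoJ a b (vec u) k * vec v k) i -
  zpair (fun k => vec u k * twoJ a b (vec v) k) i)) 0); [|exact H].
apply is_lim_seq_ext with (fun N => c (Z.of_nat N) - c (- Z.of_nat N - 2)%Z).
- intros N. rewrite sum_n_Reals, <- zsum_telescope. apply sum_eq. intros i _.
  unfold zpair, c, twoJ.
  replace (Z.of_nat i - 1 + 1)%Z with (Z.of_nat i) by lia.
  replace (- Z.of_nat i - 1 - 1 + 1)%Z with (- Z.of_nat i - 1)%Z by lia. ring.
- apply is_lim_seq_Reals. intros e He.
  pose (d := Rmin 1 (e / (4 * M + 1))).
  assert (Hd : 0 < d) by (apply Rmin_glb_lt; [lra|apply Rdiv_lt_0_compat; lra]).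
  assert (Hd1 : d <= 1) by apply Rmin_l.
  assert (Hde : 4 * M * d < e).
  { assert (h : d <= e / (4 * M + 1)) by apply Rmin_r.
    apply Rmult_le_compat_r with (r := 4 * M + 1) in h; [|lra].
    replace (e / (4 * M + 1) * (4 * M + 1)) with e in h by (field; lra). nra. }
  destruct (l2Z_vanish (vec u) (l2Z_vec u) d Hd) as [N1 H1].
  destruct (l2Z_vanish (vec v) (l2Z_vec v) d Hd) as [N2 H2].
  assert (Hc : forall k, (N1 + 1 <= Z.abs k)%Z -> (N2 + 1 <= Z.abs k)%Z -> Rabs (c k) <= 2 * M * d).
  { intros k h1 h2. unfold c. rewrite Rabs_mult.
    assert (g1 := H1 k ltac:(lia)). assert (g2 := H1 (k + 1)%Z ltac:(lia)).
    assert (g3 := H2 k ltac:(lia)). assert (g4 := H2 (k + 1)%Z ltac:(lia)).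
    apply Rle_trans with (M * (2 * d)); [|lra].
    apply Rmult_le_compat; try apply Rabs_pos; [apply Ha|].
    unfold Rminus. apply Rle_trans with (1 := Rabs_triang _ _). rewrite Rabs_Ropp, 2!Rabs_mult.
    assert (Rabs (vec u (k + 1)%Z) * Rabs (vec v k) <= d * 1) by (apply Rmult_le_compat; try apply Rabs_pos; lra).
    assert (Rabs (vec u k) * Rabs (vec v (k + 1)%Z) <= d * 1) by (apply Rmult_le_compat; try apply Rabs_pos; lra).
    lra. }
  exists (Z.to_nat (Z.max (N1 + 1) (N2 + 1))). intros N HN.
  assert (g1 := Hc (Z.of_nat N) ltac:(lia) ltac:(lia)).
  assert (g2 := Hc (- Z.of_nat N - 2)%Z ltac:(lia) ltac:(lia)).
  unfold R_dist. apply Rabs_le_between in g1, g2. apply Rabs_lt_between. lra.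
Qed.

Lemma jacobi_op_bound u : ip (jacobi_op u) (jacobi_op u) <= (3 * M) ^ 2 * ip u u.
Proof using Ha Hb.
apply l2_ip_sq_bound. intros N. apply Rle_trans with (1 := twoJ_sq_le (vec u) N).
replace ((3 * M) ^ 2) with (9 * M ^ 2) by ring.
apply Rmult_le_compat_l; [assert (h := pow2_ge_0 M); lra|]. apply l2_ip_sq_le.
Qed.

Lemma jacobi_norm_ge0 : 0 <= 3 * M.
Proof using Ha. assert (h := Ha 0). assert (h' := Rabs_pos (a 0)). lra. Qed.

Definition jacobi : selfadj l2 :=
  Selfadj l2 jacobi_op jacobi_op_add jacobi_op_scal jacobi_op_sym (3 * M) jacobi_norm_ge0 jacobi_op_bound.

Lemma shift_jacobi x (v : l2) k : vec (shift jacobi x v) k = twoJ a b (vec v) k - x * vec v k.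
Proof. unfold shift, hsub; simpl. ring. Qed.

End Jacobi.

(** * Diagonal extraction and bounded convergence *)

Lemma inv_INR_small e : 0 < e -> exists N, forall n, (N <= n)%nat -> / INR (S n) < e.
Proof.
intros He. destruct (archimed_cor1 e He) as [N [H1 H2]]. exists N. intros n Hn.
apply Rle_lt_trans with (2 := H1). apply Rinv_le_contravar; [apply lt_0_INR; lia|apply le_INR; lia].
Qed.

Lemma inv_INR_pos n : 0 < / INR (S n).
Proof. apply Rinv_0_lt_compat, lt_0_INR. lia. Qed.

(** [P e j] says that index j is good up to tolerance e. Such a predicate represents a family of
    subsequences that can be refined by further conditions before any subsequence is selected. *)
Definition frequently (P : R -> nat -> Prop) : Prop :=
  (forall e K, 0 < e -> exists j, (K <= j)%nat /\ P e j) /\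
  (forall e e' j, e <= e' -> P e j -> P e' j).

Lemma frequently_cluster P (s : nat -> R) B : frequently P -> (forall j, Rabs (s j) <= B) ->
  exists L, frequently (fun e j => P e j /\ Rabs (s j - L) < e).
Proof.
intros [HP Hm] HB.
destruct (choice (fun k j => (k <= j)%nat /\ P (/ INR (S k)) j)) as [g Hg].
{ intros k. apply HP, inv_INR_pos. }
destruct (Bolzano_Weierstrass (fun k => s (g k)) (fun t => - B <= t <= B)) as [L HL].
{ apply compact_P3. }
{ intros k. apply Rabs_le_between, HB. }
exists L. split.
- intros e K He. destruct (inv_INR_small e He) as [N HN].
  destruct (HL (disc L (mkposreal e He)) (N + K)%nat) as [p [Hp Hd]].
  { exists (mkposreal e He). intros t Ht. exact Ht. }
  destruct (Hg p) as [G1 G2]. exists (g p). repeat split; [lia| |exact Hd].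
  apply Hm with (2 := G2). apply Rlt_le, HN. lia.
- intros e e' j He [H1 H2]. split; [now apply Hm with e|lra].
Qed.

(** [Q (S i)] refines [Q i] by closeness of coordinate i to a cluster value. Choosing [phi k] from
    [Q k] with tolerance 1 / (k + 1) makes coordinate i converge along all k > i. *)
Lemma diagonal_extraction (s : nat -> nat -> R) :
  (forall i, exists B, forall j, Rabs (s j i) <= B) ->
  exists (phi : nat -> nat) (L : nat -> R), (forall k, (k <= phi k)%nat) /\
    forall i, Un_cv (fun k => s (phi k) i) (L i).
Proof.
intros HB.
assert (step : forall i (Q : {P | frequently P}),
  exists L, frequently (fun e j => proj1_sig Q e j /\ Rabs (s j i - L) < e)).
{ intros i [P HP]. destruct (HB i) as [B HBi]. now apply frequently_cluster with B. }
assert (H0 : frequently (fun _ _ => True)).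
{ split; trivial. intros e K _. now exists K. }
pose (lim i Q := proj1_sig (constructive_indefinite_description _ (step i Q))).
pose (next i Q := exist frequently _ (proj2_sig (constructive_indefinite_description _ (step i Q)))).
pose (Q := fix Q i := match i with O => exist frequently _ H0 | S i => next i (Q i) end).
assert (Hnext : forall i e j, proj1_sig (Q (S i)) e j <->
  (proj1_sig (Q i) e j /\ Rabs (s j i - lim i (Q i)) < e)) by (intros i e j; split; intros H; exact H).
assert (Hmono : forall i k e j, (i <= k)%nat -> proj1_sig (Q k) e j -> proj1_sig (Q i) e j).
{ intros i k e j Hik. induction Hik as [|k Hik IH]; trivial. intros H. apply IH. apply (proj1 (Hnext _ _ _) H). }
destruct (choice (fun k j => (k <= j)%nat /\ proj1_sig (Q k) (/ INR (S k)) j)) as [phi Hphi].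
{ intros k. destruct (proj2_sig (Q k)) as [HQ _]. apply HQ, inv_INR_pos. }
exists phi, (fun i => lim i (Q i)). split; [intros k; apply Hphi|].
intros i e He. destruct (inv_INR_small e He) as [N HN].
exists (N + S i)%nat. intros k Hk. unfold R_dist.
destruct (Hphi k) as [_ G]. apply (Hmono (S i) k) in G; [|lia]. apply (proj1 (Hnext _ _ _)) in G.
apply Rlt_trans with (1 := proj2 G). apply HN. lia.
Qed.

Lemma diagonal_extraction_Z (s : nat -> Z -> R) :
  (forall k, exists B, forall j, Rabs (s j k) <= B) ->
  exists (phi : nat -> nat) (L : Z -> R), (forall j, (j <= phi j)%nat) /\
    forall k, Un_cv (fun j => s (phi j) k) (L k).
Proof.
intros HB.
pose (dec := fun i => if Nat.even i then Z.of_nat (Nat.div2 i) else (- Z.of_nat (Nat.div2 i) - 1)%Z).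
pose (enc := fun k => if Z_le_dec 0 k then (2 * Z.to_nat k)%nat else S (2 * Z.to_nat (- k - 1))).
assert (He : forall k, dec (enc k) = k).
{ intros k. unfold dec, enc. destruct Z_le_dec as [h|h].
  - rewrite Nat.even_mul, Nat.div2_double. simpl. lia.
  - rewrite Nat.even_succ, Nat.odd_mul, Nat.div2_succ_double. simpl. lia. }
destruct (diagonal_extraction (fun j i => s j (dec i))) as [phi [L [H1 H2]]].
{ intros i. apply HB. }
exists phi, (fun k => L (enc k)). split; trivial.
intros k. specialize (H2 (enc k)). rewrite He in H2. exact H2.
Qed.

(** Four families are interleaved by residues modulo 4: two coefficient sequences, a vector and an
    energy in the application. *)
Lemma joint_extraction (s : Z -> nat -> Z -> R) :
  (forall r k, exists B, forall j, Rabs (s r j k) <= B) ->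
  exists (phi : nat -> nat) (L : Z -> Z -> R), (forall j, (j <= phi j)%nat) /\
    forall r k, (0 <= r < 4)%Z -> Un_cv (fun j => s r (phi j) k) (L r k).
Proof.
intros HB.
destruct (diagonal_extraction_Z (fun j i => s (i mod 4)%Z j (i / 4)%Z)) as [phi [L [H1 H2]]].
{ intros i. apply HB. }
exists phi, (fun r k => L (4 * k + r)%Z). split; trivial.
intros r k Hr. specialize (H2 (4 * k + r)%Z).
replace ((4 * k + r) mod 4)%Z with r in H2.
2:{ rewrite Z.add_comm, Z.mul_comm, Z.mod_add, Z.mod_small; lia. }
replace ((4 * k + r) / 4)%Z with k in H2; [exact H2|].
rewrite Z.add_comm, Z.mul_comm, Z.div_add, Z.div_small; lia.
Qed.

(** * Bounded convergence for Riemann integrals of continuous functions *)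

Lemma continuous_Rmax (f g : R -> R) x :
  continuous f x -> continuous g x -> continuous (fun t => Rmax (f t) (g t)) x.
Proof.
intros Hf Hg.
apply continuous_ext with (fun t => / 2 * ((f t + g t) + Rabs (f t - g t))).
- intros t. unfold Rmax. destruct (Rle_dec (f t) (g t)); [rewrite Rabs_left1|rewrite Rabs_pos_eq]; lra.
- apply (continuous_scal_r (/ 2) (fun t => (f t + g t) + Rabs (f t - g t))).
  apply (continuous_plus (fun t => f t + g t)).
  + now apply (continuous_plus f g).
  + apply (continuous_comp (fun t => f t - g t) Rabs).
    * now apply (continuous_minus f g).
    * apply continuous_Rabs.
Qed.

Lemma continuous_Rmin (f g : R -> R) x :
  continuous f x -> continuous g x -> continuous (fun t => Rmin (f t) (g t)) x.
Proof.
intros Hf Hg.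
apply continuous_ext with (fun t => - Rmax (- f t) (- g t)).
- intros t. rewrite Rmax_opp_Rmin. lra.
- apply (continuous_opp (fun t => Rmax (- f t) (- g t))).
  apply (continuous_Rmax (fun t => - f t) (fun t => - g t)).
  + now apply (continuous_opp f).
  + now apply (continuous_opp g).
Qed.

Lemma continuous_ex_RInt (f : R -> R) c d : (forall x, continuous f x) -> ex_RInt f c d.
Proof. intros H. apply (ex_RInt_continuous (V := R_CompleteNormedModule)). intros x _. apply H. Qed.

Lemma RInt_const_R (k c d : R) : RInt (fun _ => k) c d = (d - c) * k.
Proof. exact (RInt_const c d k). Qed.

Lemma RInt_le_cont (f g : R -> R) c d : c <= d -> (forall x, continuous f x) -> (forall x, continuous g x) ->
  (forall x, c < x < d -> f x <= g x) -> RInt f c d <= RInt g c d.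
Proof. intros H Hf Hg. apply RInt_le; trivial; now apply continuous_ex_RInt. Qed.

Lemma RInt_plus_cont (f g : R -> R) c d : (forall x, continuous f x) -> (forall x, continuous g x) ->
  RInt (fun x => f x + g x) c d = RInt f c d + RInt g c d.
Proof. intros Hf Hg. apply (RInt_plus f g c d); now apply continuous_ex_RInt. Qed.

(** A one-sided Dini theorem: the functions only have to drop below t at each point and may become
    negative. Otherwise points with D m >= t accumulate at some z, where continuity of one D m below
    t gives a contradiction. *)
Lemma dini (D : nat -> R -> R) c d t : c <= d ->
  (forall m x, continuous (D m) x) -> (forall m x, D (S m) x <= D m x) ->
  (forall x, c <= x <= d -> exists m, D m x < t) ->
  exists m, forall x, c <= x <= d -> D m x < t.
Proof.
intros Hcd Hc Hd Hp. apply NNPP. intros Hn.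
assert (Hmono : forall x m n, (m <= n)%nat -> D n x <= D m x).
{ intros x m n Hmn. induction Hmn; [lra|]. apply Rle_trans with (2 := IHHmn). apply Hd. }
destruct (choice (fun m x => c <= x <= d /\ t <= D m x)) as [u Hu].
{ intros m. apply NNPP. intros H. apply Hn. exists m. intros x Hx.
  apply Rnot_le_lt. intros H'. apply H. now exists x. }
destruct (Bolzano_Weierstrass u (fun x => c <= x <= d)) as [z Hz].
{ apply compact_P3. }
{ intros m. apply Hu. }
assert (Hzcd : c <= z <= d).
{ assert (K : forall e, 0 < e -> c - e <= z <= d + e).
  { intros e He. destruct (Hz (disc z (mkposreal e He)) 0%nat) as [p [_ Hp']].
    - exists (mkposreal e He). intros y Hy. exact Hy.
    - unfold disc in Hp'; simpl in Hp'. apply Rabs_lt_between in Hp'.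
      destruct (Hu p) as [G _]. lra. }
  split; apply le_epsilon; intros e He; specialize (K e He); lra. }
destruct (Hp z Hzcd) as [m Hm].
assert (Hcm := proj2 (continuity_pt_filterlim _ _) (Hc m z)).
destruct (Hcm (t - D m z)) as [e [He H]]; [lra|].
destruct (Hz (disc z (mkposreal e He)) m) as [p [Hp1 Hp2]].
{ exists (mkposreal e He). intros y Hy. exact Hy. }
unfold disc in Hp2; simpl in Hp2.
destruct (Hu p) as [_ G]. assert (G' := Hmono (u p) m p Hp1).
assert (D m (u p) < t); [|lra].
destruct (Req_dec z (u p)) as [e0|e0]; [now rewrite <- e0|].
assert (h : Rabs (D m (u p) - D m z) < t - D m z).
{ apply H. split; [split; [exact I|trivial]|exact Hp2]. }
apply Rabs_lt_between in h. lra.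
Qed.

Definition clip (t : R) : R := Rmax 0 (Rmin 1 t).

Lemma clip_bounds t : 0 <= clip t <= 1.
Proof.
unfold clip. split; [apply Rmax_l|]. apply Rmax_lub; [lra|apply Rmin_l].
Qed.

Lemma clip_le0 t : t <= 0 -> clip t = 0.
Proof. intros H. unfold clip. rewrite Rmin_right, Rmax_left; lra. Qed.

Lemma clip_ge1 t : 1 <= t -> clip t = 1.
Proof. intros H. unfold clip. rewrite Rmin_left, Rmax_right; lra. Qed.

Lemma clip_incr s t : s <= t -> clip s <= clip t.
Proof. intros H. unfold clip. apply Rle_max_compat_l, Rle_min_compat_l, H. Qed.

Lemma continuous_clip x : continuous clip x.
Proof.
apply (continuous_Rmax (fun _ => 0)); [apply continuous_const|].
apply (continuous_Rmin (fun _ => 1)); [apply continuous_const|apply continuous_id].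
Qed.

(* A bump above [(lo, hi)]: a clipped ramp minus its translate by [hi - lo + r], which makes the
   integral easy to bound. *)
Definition bump (lo hi r x : R) : R := clip ((x - lo + r) / r) - clip ((x - hi) / r).

Lemma continuous_affine_div s r x : continuous (fun t => (t + s) / r) x.
Proof.
apply (continuous_mult (fun t => t + s) (fun _ => / r)); [|apply continuous_const].
apply (continuous_plus (fun t : R => t) (fun _ => s)); [apply continuous_id|apply continuous_const].
Qed.

Lemma continuous_bump lo hi r x : continuous (bump lo hi r) x.
Proof.
unfold bump.
apply (continuous_minus (fun x => clip ((x - lo + r) / r)) (fun x => clip ((x - hi) / r))).
- apply continuous_ext with (fun x => clip ((x + (- lo + r)) / r)); [intros t; f_equal; f_equal; ring|].
  apply (continuous_comp (fun x => (x + (- lo + r)) / r) clip); [apply continuous_affine_div|apply continuous_clip].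
- apply (continuous_comp (fun x => (x + - hi) / r) clip); [apply continuous_affine_div|apply continuous_clip].
Qed.

Lemma bump_ge0 lo hi r x : lo <= hi -> 0 < r -> 0 <= bump lo hi r x.
Proof.
intros H Hr. unfold bump.
assert (h : clip ((x - hi) / r) <= clip ((x - lo + r) / r)); [|lra].
apply clip_incr. apply Rmult_le_compat_r; [apply Rlt_le, Rinv_0_lt_compat; trivial|lra].
Qed.

Lemma bump_ge1 lo hi r x : 0 < r -> lo < x < hi -> 1 <= bump lo hi r x.
Proof.
intros Hr Hx. unfold bump. rewrite clip_ge1, clip_le0; [lra| |].
- apply Rmult_le_reg_r with r; trivial. unfold Rdiv. rewrite Rmult_assoc, Rinv_l; lra.
- apply Rmult_le_reg_r with r; trivial. unfold Rdiv. rewrite Rmult_assoc, Rinv_l; lra.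
Qed.

(** The bump is F(x + s) - F(x) with 0 <= F <= 1 and s = hi - lo + r, so its integral is that of F
    over [d, d + s] minus that over [c, c + s]. *)
Lemma RInt_bump lo hi r c d : lo <= hi -> 0 < r -> RInt (bump lo hi r) c d <= hi - lo + r.
Proof.
intros Hl Hr.
pose (F := fun x => clip ((x - hi) / r)). pose (s := hi - lo + r).
assert (HF : forall x, continuous F x).
{ intros x. apply (continuous_comp (fun x => (x + - hi) / r) clip);
    [apply continuous_affine_div|apply continuous_clip]. }
assert (HFs : forall x, continuous (fun x => F (1 * x + s)) x).
{ intros x. apply (continuous_comp (fun x => 1 * x + s) F); [|apply HF].
  apply (continuous_plus (fun x => 1 * x) (fun _ => s)); [|apply continuous_const].
  apply (continuous_scal_r 1 (fun x : R => x)), continuous_id. }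
rewrite (RInt_ext _ (fun x => minus (F (1 * x + s)) (F x))).
2:{ intros x _. unfold bump, F, s. change minus with Rminus. f_equal. f_equal. f_equal. ring. }
rewrite (RInt_minus (V := R_CompleteNormedModule)) by now apply continuous_ex_RInt.
assert (e : RInt (fun x => F (1 * x + s)) c d = RInt F (c + s) (d + s)).
{ assert (h := RInt_comp_lin F 1 s c d). rewrite 2!Rmult_1_l in h.
  rewrite <- h by now apply continuous_ex_RInt.
  apply RInt_ext. intros x _. symmetry. apply Rmult_1_l. }
rewrite e.
assert (e1 := RInt_Chasles F (c + s) d (d + s) ltac:(now apply continuous_ex_RInt) ltac:(now apply continuous_ex_RInt)).
assert (e2 := RInt_Chasles F c (c + s) d ltac:(now apply continuous_ex_RInt) ltac:(now apply continuous_ex_RInt)).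
change plus with Rplus in e1, e2. change minus with Rminus.
assert (h1 : RInt F d (d + s) <= s).
{ apply Rle_trans with (RInt (fun _ => 1) d (d + s)); [|rewrite RInt_const_R; lra].
  apply RInt_le_cont; trivial; [unfold s; lra|intros; apply continuous_const|].
  intros; apply clip_bounds. }
assert (h2 : 0 <= RInt F c (c + s)).
{ apply RInt_ge_0; [unfold s; lra|now apply continuous_ex_RInt|]. intros; apply clip_bounds. }
fold s. lra.
Qed.

Section BoundedConvergence.
Context (c d : R) (Hcd : c <= d) (f : nat -> R -> R).
Context (f_cont : forall k x, continuous (f k) x) (f_bounds : forall k x, 0 <= f k x <= 1).

(** A finite stand-in for the supremum of f k over k >= m, which in general is only lower
    semicontinuous. *)
Fixpoint run_max (m p : nat) (x : R) : R :=
  match p with O => f m x | S p' => Rmax (run_max m p' x) (f (m + p) x) end.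

Lemma run_max_cont m p x : continuous (run_max m p) x.
Proof using f_cont.
induction p as [|p IH]; [apply f_cont|].
apply (continuous_Rmax (run_max m p)); [trivial|apply f_cont].
Qed.

Lemma run_max_bounds m p x : 0 <= run_max m p x <= 1.
Proof using f_bounds.
induction p as [|p IH]; [apply f_bounds|]. simpl. assert (h := f_bounds (m + S p) x).
split; [apply Rle_trans with (2 := Rmax_l _ _); lra|apply Rmax_lub; lra].
Qed.

Lemma run_max_le_len m p p' x : (p <= p')%nat -> run_max m p x <= run_max m p' x.
Proof. induction 1; [lra|]. apply Rle_trans with (1 := IHle). apply Rmax_l. Qed.

Lemma run_max_shift m p x : run_max (S m) p x <= run_max m (S p) x.
Proof.
induction p as [|p IH].
- simpl. rewrite Nat.add_1_r. apply Rmax_r.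
- change (Rmax (run_max (S m) p x) (f (S m + S p) x) <= Rmax (run_max m (S p) x) (f (m + S (S p)) x)).
  replace (m + S (S p))%nat with (S m + S p)%nat by lia. now apply Rle_max_compat_r.
Qed.

Lemma run_max_small m p x e : (forall k, (m <= k)%nat -> f k x < e) -> run_max m p x < e.
Proof.
intros H. induction p as [|p IH]; [now apply H|].
simpl. apply Rmax_lub_lt; trivial. apply H. lia.
Qed.

(** The integrals are bounded by d - c, so some length comes within e of their supremum. *)
Lemma run_max_near_sup m e : 0 < e -> exists p, forall p',
  RInt (run_max m p') c d <= RInt (run_max m p) c d + e.
Proof using Hcd f_bounds f_cont.
intros He.
destruct (completeness (fun t => exists p, t = RInt (run_max m p) c d)) as [L [H1 H2]].
- exists (d - c). intros t [p ->].
  apply Rle_trans with (RInt (fun _ => 1) c d); [|rewrite RInt_const_R; lra].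
  apply RInt_le_cont; trivial; [apply run_max_cont|intros; apply continuous_const|].
  intros; apply run_max_bounds.
- exists (RInt (run_max m 0) c d). now exists 0%nat.
- assert (h : exists p, L - e < RInt (run_max m p) c d).
  { apply NNPP. intros Hn. assert (L <= L - e); [|lra].
    apply H2. intros t [p ->]. apply Rnot_lt_le. intros Ht. apply Hn. now exists p. }
  destruct h as [p Hp]. exists p. intros p'.
  assert (RInt (run_max m p') c d <= L); [|lra]. apply H1. now exists p'.
Qed.

(* Egorov in disguise: the decreasing minima [q m] of suitable long running maxima keep almost all of
   the integral, tend to [0] off the null set, and are made uniformly small by subtracting bumps
   covering that set. *)
Lemma bounded_convergence_contra (N : R -> Prop) delta :
  leb_null N -> (forall x, c <= x <= d -> ~ N x -> Un_cv (fun k => f k x) 0) ->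
  0 < delta -> (forall k, delta <= RInt (f k) c d) -> False.
Proof using Hcd f_bounds f_cont.
intros HN Hcv Hdelta Hint.
(* The losses w i sum to less than delta / 2, so every [q m] keeps an integral of at least delta /
   2. *)
pose (w := fun i => delta / 4 * (/ 2) ^ i).
assert (Hw : forall i, 0 < w i).
{ intros i. apply Rmult_lt_0_compat; [lra|]. apply pow_lt. lra. }
assert (Hws : forall m, sum_f_R0 w m = delta / 2 - delta / 4 * (/ 2) ^ m).
{ induction m as [|m IH]; [unfold w; simpl; field|]. rewrite tech5, IH. unfold w. simpl. field. }
destruct (choice (fun m p => forall p', RInt (run_max m p') c d <= RInt (run_max m p) c d + w (S m))) as [p Hp].
{ intros m. now apply run_max_near_sup. }
pose (q := fix q m : R -> R := match m with
  | O => run_max 0 (p 0%nat) | S m' => fun x => Rmin (q m' x) (run_max (S m') (p (S m')) x) end).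
assert (Hqc : forall m x, continuous (q m) x).
{ induction m as [|m IH]; intros x; [apply run_max_cont|].
  apply (continuous_Rmin (q m)); [apply IH|apply run_max_cont]. }
assert (Hqle : forall m x, q m x <= run_max m (p m) x).
{ intros [|m] x; [apply Rle_refl|apply Rmin_r]. }
assert (Hqi : forall m, RInt (run_max m (p m)) c d - sum_f_R0 w m <= RInt (q m) c d).
{ induction m as [|m IH]; [assert (h := Hw 0%nat); change (RInt (run_max 0 (p 0%nat)) c d - w 0%nat <= RInt (run_max 0 (p 0%nat)) c d); lra|].
  pose (P := Nat.max (p m) (S (p (S m)))).
  pose (g := run_max (S m) (p (S m))).
  assert (hg : forall x, continuous g x) by (intros; apply run_max_cont).
  (* From min + max = sum: the maximum lies below a longer running maximum starting at m, which by
     the choice of [p m] exceeds the chosen one by at most [w (S m)] in integral. *)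
  assert (h1 : RInt (fun x => q (S m) x + Rmax (q m x) (g x)) c d = RInt (fun x => q m x + g x) c d).
  { apply RInt_ext. intros x _. simpl. fold g. unfold Rmin, Rmax. destruct Rle_dec; ring. }
  rewrite (RInt_plus_cont (q (S m)) (fun x => Rmax (q m x) (g x))), (RInt_plus_cont (q m) g) in h1; trivial.
  2:{ intros x. now apply (continuous_Rmax (q m)). }
  assert (h2 : RInt (fun x => Rmax (q m x) (g x)) c d <= RInt (run_max m P) c d).
  { apply RInt_le_cont; trivial; [intros x; now apply (continuous_Rmax (q m))|apply run_max_cont|].
    intros x _. apply Rmax_lub.
    - apply Rle_trans with (1 := Hqle m x). apply run_max_le_len. unfold P. lia.
    - apply Rle_trans with (1 := run_max_shift _ _ _). apply run_max_le_len. unfold P. lia. }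
  assert (h3 := Hp m P). assert (h4 := Hw (S m)). rewrite tech5. fold g. lra. }
assert (Hqd : forall m, delta / 2 <= RInt (q m) c d).
{ intros m. apply Rle_trans with (2 := Hqi m). rewrite Hws.
  assert (h1 : RInt (f m) c d <= RInt (run_max m (p m)) c d).
  { apply RInt_le_cont; trivial; [apply run_max_cont|].
    intros x _. apply (run_max_le_len m 0 (p m) x). lia. }
  assert (h2 : 0 < delta / 4 * (/ 2) ^ m) by apply Hw.
  specialize (Hint m). lra. }
(* Budget: the cover costs delta / 8, the ramps of the bumps at most delta / 8, and the uniform
   remainder t at most delta / 8, in total less than delta / 2. *)
destruct (HN (delta / 8)) as [lo [hi [HS [Hlh Hsum]]]]; [lra|].
pose (r := fun i => w i / 4).
assert (Hr : forall i, 0 < r i) by (intros i; specialize (Hw i); unfold r; lra).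
pose (G := fix G m : R -> R := match m with
  | O => bump (lo 0%nat) (hi 0%nat) (r 0%nat)
  | S m' => fun x => G m' x + bump (lo (S m')) (hi (S m')) (r (S m')) x end).
assert (HGc : forall m x, continuous (G m) x).
{ induction m as [|m IH]; intros x; [apply continuous_bump|].
  apply (continuous_plus (G m)); [apply IH|apply continuous_bump]. }
assert (HGi : forall m, RInt (G m) c d <= delta / 4).
{ intros m. apply Rle_trans with (sum_f_R0 (fun j => hi j - lo j) m + sum_f_R0 w m / 4).
  2:{ assert (h1 := Hsum m). rewrite Hws. assert (h2 : 0 < delta / 4 * (/ 2) ^ m) by apply Hw. lra. }
  induction m as [|m IH].
  - simpl. assert (h := RInt_bump (lo 0%nat) (hi 0%nat) (r 0%nat) c d (Hlh _) (Hr _)). unfold r in h at 2. lra.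
  - simpl G. rewrite (RInt_plus_cont (G m)); [|trivial|intros; apply continuous_bump].
    assert (h := RInt_bump (lo (S m)) (hi (S m)) (r (S m)) c d (Hlh _) (Hr _)). unfold r in h at 2.
    rewrite 2!tech5. lra. }
assert (HG0 : forall m x, 0 <= G m x).
{ induction m as [|m IH]; intros x; simpl; [now apply bump_ge0|].
  apply Rplus_le_le_0_compat; [trivial|now apply bump_ge0]. }
assert (HG1 : forall j x, lo j < x < hi j -> 1 <= G j x).
{ intros [|j] x Hx; simpl; [now apply bump_ge1|].
  assert (h := bump_ge1 _ _ (r (S j)) x (Hr _) Hx). specialize (HG0 j x). lra. }
pose (t := delta / (8 * (d - c + 1))).
assert (Ht : 0 < t) by (apply Rdiv_lt_0_compat; lra).
destruct (dini (fun m x => q m x - G m x) c d t) as [m Hm]; trivial.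
- intros m x. apply (continuous_minus (q m) (G m)); trivial.
- intros m x. simpl.
  assert (h1 : Rmin (q m x) (run_max (S m) (p (S m)) x) <= q m x) by apply Rmin_l.
  assert (h2 := bump_ge0 (lo (S m)) (hi (S m)) (r (S m)) x (Hlh _) (Hr _)). lra.
- intros x Hx. destruct (classic (N x)) as [Hs|Hs].
  + destruct (HS x Hs) as [j Hj]. exists j. specialize (HG1 j x Hj).
    specialize (Hqle j x). assert (h := run_max_bounds j (p j) x). lra.
  + destruct (Hcv x Hx Hs t Ht) as [K HK]. exists K.
    assert (h : run_max K (p K) x < t).
    { apply run_max_small. intros k Hk. specialize (HK k Hk). unfold R_dist in HK.
      rewrite Rminus_0_r in HK. apply Rle_lt_trans with (1 := Rle_abs _). trivial. }
    specialize (Hqle K x). specialize (HG0 K x). lra.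
- assert (h1 : RInt (q m) c d <= RInt (fun x => G m x + t) c d).
  { apply RInt_le_cont; trivial.
    - intros x. apply (continuous_plus (G m)); [trivial|apply continuous_const].
    - intros x Hx. specialize (Hm x ltac:(lra)). lra. }
  rewrite (RInt_plus_cont (G m)), RInt_const_R in h1; [|trivial|intros; apply continuous_const].
  assert (h2 : (d - c) * t <= delta / 8).
  { apply Rle_trans with ((d - c + 1) * t); [apply Rmult_le_compat_r; lra|].
    unfold t. right. field. lra. }
  specialize (Hqd m). specialize (HGi m). lra.
Qed.
End BoundedConvergence.

(** This converts almost everywhere vanishing of Re G_nn on e into vanishing of integrals. A failure
    would give a subsequence with integrals at least e, to which the previous argument applies. *)
Lemma bounded_convergence c d (f : nat -> R -> R) (N : R -> Prop) : c <= d ->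
  (forall k x, continuous (f k) x) -> (forall k x, 0 <= f k x <= 1) ->
  leb_null N -> (forall x, c <= x <= d -> ~ N x -> Un_cv (fun k => f k x) 0) ->
  Un_cv (fun k => RInt (f k) c d) 0.
Proof.
intros Hcd Hc Hb HN Hcv e He. apply NNPP. intros Hn.
destruct (choice (fun n k => (n <= k)%nat /\ e <= RInt (f k) c d)) as [g Hg].
{ intros n. apply NNPP. intros H. apply Hn. exists n. intros k Hk. unfold R_dist. rewrite Rminus_0_r.
  rewrite Rabs_pos_eq.
  - apply Rnot_le_lt. intros H'. apply H. now exists k.
  - apply RInt_ge_0; trivial; [now apply continuous_ex_RInt|]. intros; apply Hb. }
apply (bounded_convergence_contra c d Hcd (fun k => f (g k))) with (N := N) (delta := e); trivial.
- intros x Hx Hs t Ht. destruct (Hcv x Hx Hs t Ht) as [K HK]. exists K. intros k Hk. apply HK.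
  destruct (Hg k). lia.
- intros k. apply Hg.
Qed.

(** * Green functions of reflectionless operators *)

(** Treats right and left neighbourhoods of x0 alike through s = 1 or s = -1; for s = -1 the
    substitution reverses orientation. *)
Lemma RInt_reparam_le (g : R -> R) (x0 s eta L c d : R) :
  (forall x, continuous g x) -> (forall x, 0 <= g x) -> s = 1 \/ s = -1 -> eta <= L ->
  c <= x0 + s * eta <= d -> c <= x0 + s * L <= d ->
  RInt (fun t => g (x0 + s * t)) eta L <= RInt g c d.
Proof.
intros Hg Hp Hs HL He HLc.
assert (ex : forall u v, ex_RInt g u v) by (intros; now apply continuous_ex_RInt).
assert (sub : forall u v, c <= u -> u <= v -> v <= d -> RInt g u v <= RInt g c d).
{ intros u v h1 h2 h3.
  assert (e1 := RInt_Chasles g c u d (ex _ _) (ex _ _)).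
  assert (e2 := RInt_Chasles g u v d (ex _ _) (ex _ _)).
  change plus with Rplus in e1, e2.
  assert (p1 := RInt_ge_0 g c u h1 (ex _ _) (fun x _ => Hp x)).
  assert (p2 := RInt_ge_0 g v d h3 (ex _ _) (fun x _ => Hp x)). lra. }
destruct Hs as [-> | ->].
- assert (h := RInt_comp_lin g 1 x0 eta L (ex _ _)).
  apply Rle_trans with (RInt g (1 * eta + x0) (1 * L + x0)); [|apply sub; lra].
  right. rewrite <- h. apply RInt_ext. intros t _.
  change (g (x0 + 1 * t) = 1 * g (1 * t + x0) :> R). rewrite (Rplus_comm x0). ring.
- assert (h := RInt_comp_lin g (-1) x0 eta L (ex _ _)).
  apply Rle_trans with (RInt g (-1 * L + x0) (-1 * eta + x0)); [|apply sub; lra].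
  assert (h2 := opp_RInt_swap g (-1 * eta + x0) (-1 * L + x0) (ex _ _)).
  assert (h3 : RInt (fun t => Hierarchy.opp (scal (-1) (g (-1 * t + x0)))) eta L
    = Hierarchy.opp (RInt (fun t => scal (-1) (g (-1 * t + x0))) eta L)).
  { apply (RInt_opp (V := R_CompleteNormedModule)). apply continuous_ex_RInt. intros t.
    apply (continuous_scal_r (-1) (fun t => g (-1 * t + x0))).
    apply (continuous_comp (fun t => -1 * t + x0) g); [|apply Hg].
    apply (continuous_plus (fun t => -1 * t) (fun _ => x0)); [|apply continuous_const].
    apply (continuous_scal_r (-1) (fun t : R => t)), continuous_id. }
  right. rewrite <- h2, <- h. apply eq_trans with (2 := h3). apply RInt_ext. intros t _.
  change (g (x0 + -1 * t) = - (-1 * g (-1 * t + x0)) :> R). rewrite (Rplus_comm x0). ring.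
Qed.

(* [H = rho + i h] with [H^2 = 1 + 4 a^2 G_0 G_{-1}]; where the diagonal Green functions are almost
   purely imaginary so is [H], and then the quadratic form [P] is definite with discriminant close
   to [- a^2]. *)
Lemma quadratic_form_lower_bound (a a1 c e p0 p1 pm g0 gm rho h v M c0 c1 th : R) :
  0 <= a <= M -> 0 <= a1 <= M -> 0 < c0 -> c0 <= Rabs c <= c1 -> 0 <= e <= 1 -> 0 <= g0 -> 0 <= gm ->
  c * rho - e * h = (c ^ 2 - e ^ 2) * p0 - 2 * c * e * g0 - a1 ^ 2 * p1 + a ^ 2 * pm ->
  4 * a ^ 2 * g0 * gm - h ^ 2 = 1 + 4 * a ^ 2 * p0 * pm - rho ^ 2 ->
  Rabs h <= a * (g0 + gm) ->
  Rabs p0 <= th -> Rabs p1 <= th -> Rabs pm <= th -> e * (g0 + gm) <= th ->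
  th * (1 + 2 * M + (M + c1 ^ 2 + 1 + 2 * c1 + 2 * M ^ 2) / c0) <= 1 / 2 ->
  1 / 8 <= g0 * (a ^ 2 * (v ^ 2 * g0 + gm) - v * a * h).
Proof.
intros Ha Ha1 Hc0 Hc He Hg0 Hgm F1 F2 F3 Hp0 Hp1 Hpm Heg Hth.
(* T collects the coefficients of th in the bound for c rho: M from e h, c1^2 and 1 from c^2 p0 and
   e^2 p0, 2 c1 from 2 c e g0, and M^2 from each of the terms in p1 and pm. *)
pose (T := M + c1 ^ 2 + 1 + 2 * c1 + 2 * M ^ 2).
fold T in Hth.
assert (Hth0 : 0 <= th) by (apply Rle_trans with (2 := Hp0), Rabs_pos).
assert (HT : 0 <= T) by (unfold T; nra).
assert (HTc : 0 <= T / c0) by (apply Rdiv_le_0_compat; trivial).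
assert (Hrho : Rabs rho * c0 <= T * th).
{ assert (h1 : Rabs c * Rabs rho <= T * th).
  { rewrite <- Rabs_mult.
    replace (c * rho) with (e * h + c ^ 2 * p0 - e ^ 2 * p0 - 2 * (c * (e * g0)) - a1 ^ 2 * p1 + a ^ 2 * pm) by lra.
    assert (k1 : Rabs (e * h) <= M * th).
    { rewrite Rabs_mult, (Rabs_pos_eq e) by lra.
      apply Rle_trans with (a * (e * (g0 + gm))); [nra|].
      apply Rmult_le_compat; try lra. apply Rmult_le_pos; lra. }
    assert (sq : forall x y B, Rabs x <= B -> Rabs y <= th -> Rabs (x ^ 2 * y) <= B ^ 2 * th).
    { intros x y B hx hy. rewrite Rabs_mult, <- RPow_abs.
      apply Rmult_le_compat; [apply pow_le, Rabs_pos|apply Rabs_pos| |trivial].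
      apply pow_incr. split; [apply Rabs_pos|trivial]. }
    assert (k2 := sq c p0 c1 ltac:(lra) Hp0).
    assert (k3 := sq e p0 1 ltac:(rewrite Rabs_pos_eq; lra) Hp0).
    assert (k4 := sq a1 p1 M ltac:(rewrite Rabs_pos_eq; lra) Hp1).
    assert (k5 := sq a pm M ltac:(rewrite Rabs_pos_eq; lra) Hpm).
    assert (k6 : Rabs (c * (e * g0)) <= c1 * th).
    { rewrite Rabs_mult, (Rabs_pos_eq (e * g0)) by (apply Rmult_le_pos; lra).
      apply Rmult_le_compat; [apply Rabs_pos|apply Rmult_le_pos; lra|lra|]. nra. }
    unfold T. apply Rabs_le_between in k1, k2, k3, k4, k5, k6. apply Rabs_le_between. lra. }
  assert (h2 := Rabs_pos rho). nra. }
assert (Hrho' : Rabs rho <= T / c0 * th).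
{ apply Rmult_le_reg_r with c0; trivial.
  replace (T / c0 * th * c0) with (T * th) by (field; lra). trivial. }
assert (HMth : 0 <= 2 * M * th) by nra.
assert (HTth : 0 <= T / c0 * th) by (apply Rmult_le_pos; trivial).
assert (Hr2 : rho ^ 2 <= 1 / 4).
{ rewrite <- pow2_abs. replace (1 / 4) with ((1 / 2) ^ 2) by field. apply pow_incr.
  split; [apply Rabs_pos|]. lra. }
assert (Hp2 : - (1 / 4) <= 4 * a ^ 2 * p0 * pm).
{ assert (k : Rabs (2 * a * p0) <= 1 / 2 /\ Rabs (2 * a * pm) <= 1 / 2).
  { split; rewrite Rabs_mult, (Rabs_pos_eq (2 * a)) by lra; apply Rle_trans with (2 * M * th);
      try lra; apply Rmult_le_compat; try apply Rabs_pos; lra. }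
  destruct k as [k1 k2]. apply Rabs_le_between in k1, k2.
  replace (4 * a ^ 2 * p0 * pm) with ((2 * a * p0) * (2 * a * pm)) by ring. nra. }
(* Completing the square in v leaves (1 + 4 a^2 p0 pm - rho^2) / 4 >= (1 - 1/4 - 1/4) / 4 = 1/8. *)
replace (g0 * (a ^ 2 * (v ^ 2 * g0 + gm) - v * a * h)) with
  ((a * v * g0 - h / 2) ^ 2 + (4 * a ^ 2 * g0 * gm - h ^ 2) / 4) by field.
assert (h3 := pow2_ge_0 (a * v * g0 - h / 2)). lra.
Qed.

Section Green.
Context (a b : Z -> R) (M : R) (Ha : forall k, Rabs (a k) <= M) (Hb : forall k, Rabs (b k) <= M).
Let J := jacobi a b M Ha Hb.

Definition Gre x e m n : R := vec (resRe J x e (delta n)) m.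
Definition Gim x e m n : R := vec (resIm J x e (delta n)) m.

Lemma Gre_ip x e m n : Gre x e m n = ip (delta m : l2) (resRe J x e (delta n)).
Proof. symmetry. apply ip_delta. Qed.

Lemma Gim_ip x e m n : Gim x e m n = ip (delta m : l2) (resIm J x e (delta n)).
Proof. symmetry. apply ip_delta. Qed.

Lemma G_sym x e m n : e <> 0 -> Gre x e m n = Gre x e n m /\ Gim x e m n = Gim x e n m.
Proof.
intros He. rewrite !Gre_ip, !Gim_ip.
destruct (ip_res_sym J x e (delta m) (delta n) He) as [H1 H2].
rewrite H1, H2. split; apply ip_comm.
Qed.

Lemma G_eq x e n k : e <> 0 ->
  twoJ a b (fun m => Gre x e m n) k - x * Gre x e k n + e * Gim x e k n = delta_fun n k /\
  twoJ a b (fun m => Gim x e m n) k - x * Gim x e k n - e * Gre x e k n = 0.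
Proof.
intros He. destruct (resolventP J x e (delta n) He) as [H1 H2].
split.
- assert (h := f_equal (fun v : l2 => vec v k) H1). cbv beta in h.
  change (vec (shift J x (resRe J x e (delta n))) k + e * Gim x e k n = delta_fun n k) in h.
  unfold J in h at 1. rewrite shift_jacobi in h. exact h.
- assert (h := f_equal (fun v : l2 => vec v k) H2). cbv beta in h.
  change (vec (shift J x (resIm J x e (delta n))) k = e * Gre x e k n) in h.
  unfold J in h at 1. rewrite shift_jacobi in h.
  change (twoJ a b (fun m => Gim x e m n) k - x * Gim x e k n = e * Gre x e k n) in h. lra.
Qed.

Lemma G_resolvent_sol x e n : e <> 0 ->
  resolvent_sol a b n x e (fun m => Gre x e m n) (fun m => Gim x e m n).
Proof.
intros He. split; [apply l2Z_vec|split; [apply l2Z_vec|]]. intros k. now apply G_eq.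
Qed.

(** The real part of a_{-1} (G_00 G_{-1,-1} - G_{-1,0}^2) = - G_{-1,0}. [W] is the real part of the
    Wronskian of the columns 0 and -1: it is constant from 0 on, hence 0 by decay, and its jump at 0
    is G_{0,-1}. *)
Lemma G_wronskian x e : e <> 0 ->
  a (-1)%Z * ((Gre x e 0 0 * Gre x e (-1) (-1) - Gim x e 0 0 * Gim x e (-1) (-1))
    - (Gre x e (-1) 0 ^ 2 - Gim x e (-1) 0 ^ 2)) = - Gre x e (-1) 0.
Proof.
intros He.
pose (W := fun k => a k *
  ((Gre x e (k + 1) 0 * Gre x e k (-1) - Gim x e (k + 1) 0 * Gim x e k (-1))
  - (Gre x e k 0 * Gre x e (k + 1) (-1) - Gim x e k 0 * Gim x e (k + 1) (-1)))).
assert (HW : forall k, W k - W (k - 1)%Z = delta_fun 0 k * Gre x e k (-1) - delta_fun (-1) k * Gre x e k 0).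
{ intros k. destruct (G_eq x e 0 k He) as [E1 E2], (G_eq x e (-1) k He) as [E3 E4].
  unfold W. unfold twoJ in E1, E2, E3, E4. replace (k - 1 + 1)%Z with k by lia.
  rewrite <- E1, <- E3. clear E1 E3.
  assert (F2 : a k * Gim x e (k + 1) 0 = x * Gim x e k 0 + e * Gre x e k 0
    - a (k - 1)%Z * Gim x e (k - 1) 0 - b k * Gim x e k 0) by lra.
  assert (F4 : a k * Gim x e (k + 1) (-1) = x * Gim x e k (-1) + e * Gre x e k (-1)
    - a (k - 1)%Z * Gim x e (k - 1) (-1) - b k * Gim x e k (-1)) by lra.
  transitivity ((a k * Gre x e (k + 1) 0) * Gre x e k (-1) - (a k * Gim x e (k + 1) 0) * Gim x e k (-1)
    - Gre x e k 0 * (a k * Gre x e (k + 1) (-1)) + Gim x e k 0 * (a k * Gim x e (k + 1) (-1))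
    - a (k - 1)%Z * (Gre x e k 0 * Gre x e (k - 1) (-1) - Gim x e k 0 * Gim x e (k - 1) (-1)
      - (Gre x e (k - 1) 0 * Gre x e k (-1) - Gim x e (k - 1) 0 * Gim x e k (-1)))); [ring|].
  rewrite F2, F4. ring. }
assert (HW0 : forall k, (0 <= k)%Z -> W k = W 0%Z).
{ apply natlike_ind; trivial. intros k Hk IH.
  assert (h := HW (k + 1)%Z). unfold delta_fun in h.
  replace (k + 1 - 1)%Z with k in h by lia. unfold Z.succ.
  repeat destruct Z.eq_dec; try lia. lra. }
assert (HM : 0 <= M) by (assert (h := Ha 0); assert (h' := Rabs_pos (a 0)); lra).
assert (W0 : W 0%Z = 0).
{ apply Rabs_eq_0, Rle_antisym; [|apply Rabs_pos]. apply le_epsilon. intros d Hd.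
  pose (d' := Rmin 1 (d / (4 * M + 1))).
  assert (Hd' : 0 < d') by (apply Rmin_glb_lt; [lra|apply Rdiv_lt_0_compat; lra]).
  assert (Hd1 : d' <= 1) by apply Rmin_l.
  assert (Hde : 4 * M * d' <= d).
  { assert (h : d' <= d / (4 * M + 1)) by apply Rmin_r.
    apply Rmult_le_compat_r with (r := 4 * M + 1) in h; [|lra].
    replace (d / (4 * M + 1) * (4 * M + 1)) with d in h by (field; lra). nra. }
  destruct (l2Z_vanish (fun k => Gre x e k 0) (l2Z_vec _) d' Hd') as [N1 H1].
  destruct (l2Z_vanish (fun k => Gim x e k 0) (l2Z_vec _) d' Hd') as [N2 H2].
  destruct (l2Z_vanish (fun k => Gre x e k (-1)) (l2Z_vec _) d' Hd') as [N3 H3].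
  destruct (l2Z_vanish (fun k => Gim x e k (-1)) (l2Z_vec _) d' Hd') as [N4 H4].
  pose (k := Z.max (Z.max (Z.abs N1) (Z.abs N2)) (Z.max (Z.abs N3) (Z.abs N4))).
  rewrite <- (HW0 k) by lia. unfold W. rewrite Rabs_mult, Rplus_0_l.
  apply Rle_trans with (M * (4 * d')); [|lra].
  apply Rmult_le_compat; try apply Rabs_pos; [apply Ha|].
  assert (K : forall p q, Rabs p <= d' -> Rabs q <= d' -> Rabs (p * q) <= d').
  { intros p q hp hq. rewrite Rabs_mult. replace d' with (d' * 1) by ring.
    apply Rmult_le_compat; try apply Rabs_pos; lra. }
  assert (k1 := K _ _ (H1 (k + 1)%Z ltac:(lia)) (H3 k ltac:(lia))).
  assert (k2 := K _ _ (H2 (k + 1)%Z ltac:(lia)) (H4 k ltac:(lia))).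
  assert (k3 := K _ _ (H1 k ltac:(lia)) (H3 (k + 1)%Z ltac:(lia))).
  assert (k4 := K _ _ (H2 k ltac:(lia)) (H4 (k + 1)%Z ltac:(lia))).
  apply Rabs_le_between in k1, k2, k3, k4. apply Rabs_le_between. lra. }
assert (h := HW 0%Z). rewrite W0 in h. unfold W, delta_fun in h. simpl in h.
destruct (G_sym x e 0 (-1) He) as [S1 S2]. rewrite S1, S2 in h. lra.
Qed.

(** With H = rho + i h and zeta = z - b_0 these are the real parts of zeta H = zeta^2 G_00 - a_0^2
    G_11 + a_{-1}^2 G_{-1,-1} and of H^2 = 1 + 4 a_{-1}^2 G_00 G_{-1,-1}. The first comes from the
    equations at site 0 for the columns 1, 0 and -1, where the terms in G_{1,-1} cancel; the second
    restates the Wronskian relation. *)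
Lemma G_relations x e : e <> 0 ->
  let c := x - b 0%Z in
  let rho := 2 * a (-1)%Z * Gre x e (-1) 0 - 1 in
  let h := 2 * a (-1)%Z * Gim x e (-1) 0 in
  c * rho - e * h = (c ^ 2 - e ^ 2) * Gre x e 0 0 - 2 * c * e * Gim x e 0 0
    - a 0%Z ^ 2 * Gre x e 1 1 + a (-1)%Z ^ 2 * Gre x e (-1) (-1) /\
  4 * a (-1)%Z ^ 2 * Gim x e 0 0 * Gim x e (-1) (-1) - h ^ 2 =
    1 + 4 * a (-1)%Z ^ 2 * Gre x e 0 0 * Gre x e (-1) (-1) - rho ^ 2.
Proof.
intros He c rho h. split.
- destruct (G_eq x e 0 0 He) as [E1 E2], (G_eq x e 1 0 He) as [E3 _], (G_eq x e (-1) 0 He) as [E4 _].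
  unfold twoJ, delta_fun in E1, E2, E3, E4. simpl in E1, E2, E3, E4.
  destruct (G_sym x e 0 1 He) as [S1 S2], (G_sym x e 0 (-1) He) as [S3 S4], (G_sym x e (-1) 1 He) as [S5 _].
  rewrite S1, S2, S5 in E3. rewrite S3, S4 in E4.
  set (G1 := Gre x e 1 0) in *. set (I1 := Gim x e 1 0) in *.
  set (s := Gre x e (-1) 0) in *. set (t := Gim x e (-1) 0) in *.
  set (m := Gre x e 1 (-1)) in *. set (a0 := a 0%Z) in *. set (am := a (-1)%Z) in *.
  set (p0 := Gre x e 0 0) in *. set (g0 := Gim x e 0 0) in *.
  assert (A1 : a0 * G1 = 1 + c * p0 - e * g0 - am * s) by (unfold c; lra).
  assert (A2 : a0 * I1 = c * g0 + e * p0 - am * t) by (unfold c; lra).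
  assert (A3 : a0 * Gre x e 1 1 = c * G1 - am * m - e * I1) by (unfold c; lra).
  assert (A4 : am * Gre x e (-1) (-1) = c * s - a0 * m - e * t) by (unfold c; lra).
  replace (a0 ^ 2 * Gre x e 1 1) with (a0 * (a0 * Gre x e 1 1)) by ring.
  replace (am ^ 2 * Gre x e (-1) (-1)) with (am * (am * Gre x e (-1) (-1))) by ring.
  rewrite A3, A4. unfold rho, h.
  transitivity ((c ^ 2 - e ^ 2) * p0 - 2 * c * e * g0 - (c * (a0 * G1) - e * (a0 * I1)) + am * (c * s - e * t)).
  + rewrite A1, A2. ring.
  + ring.
- assert (w := G_wronskian x e He). unfold h, rho.
  set (s := Gre x e (-1) 0) in *. set (t := Gim x e (-1) 0) in *. set (am := a (-1)%Z) in *.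
  assert (w' : 4 * am * (am * (Gre x e 0 0 * Gre x e (-1) (-1) - Gim x e 0 0 * Gim x e (-1) (-1) - (s ^ 2 - t ^ 2)))
    = 4 * am * - s) by now rewrite w.
  lra.
Qed.

Lemma ip_delta_delta n : ip (delta n : l2) (delta n) = 1.
Proof. rewrite ip_delta. simpl. unfold delta_fun. destruct Z.eq_dec; [trivial|lia]. Qed.

Lemma resIm_form_ge0 x e (psi : l2) : 0 < e -> 0 <= ip psi (resIm J x e psi).
Proof.
intros He. rewrite ip_resIm_self by lra.
apply Rmult_le_pos; [lra|]. apply Rplus_le_le_0_compat; apply ip_ge0.
Qed.

Lemma G_form x e (s t : R) : 0 < e ->
  let f : l2 := hadd (hscal s (delta 0 : l2)) (hscal t (delta (-1) : l2)) in
  ip f (resIm J x e f) = s ^ 2 * Gim x e 0 0 + 2 * s * t * Gim x e (-1) 0 + t ^ 2 * Gim x e (-1) (-1).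
Proof.
intros He f. unfold f. rewrite (proj2 (res_lin J x e s t _ _ ltac:(lra))).
ip_expand. rewrite <- !Gim_ip. rewrite (proj2 (G_sym x e 0 (-1) ltac:(lra))). ring.
Qed.

(** Positivity of the imaginary part of the resolvent on delta_0, delta_{-1} and delta_0 +-
    delta_{-1}. *)
Lemma Gim_bounds x e : 0 < e -> 0 <= Gim x e 0 0 /\ 0 <= Gim x e (-1) (-1) /\
  2 * Rabs (Gim x e (-1) 0) <= Gim x e 0 0 + Gim x e (-1) (-1).
Proof.
intros He.
assert (h1 := resIm_form_ge0 x e _ He : 0 <= ip (hadd (hscal 1 (delta 0 : l2)) (hscal 0 (delta (-1) : l2))) _).
assert (h2 := resIm_form_ge0 x e _ He : 0 <= ip (hadd (hscal 0 (delta 0 : l2)) (hscal 1 (delta (-1) : l2))) _).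
assert (h3 := resIm_form_ge0 x e _ He : 0 <= ip (hadd (hscal 1 (delta 0 : l2)) (hscal 1 (delta (-1) : l2))) _).
assert (h4 := resIm_form_ge0 x e _ He : 0 <= ip (hadd (hscal 1 (delta 0 : l2)) (hscal (-1) (delta (-1) : l2))) _).
rewrite G_form in h1, h2, h3, h4 by trivial.
repeat split; try lra.
destruct (Rle_dec 0 (Gim x e (-1) 0)); [rewrite Rabs_pos_eq|rewrite Rabs_left]; lra.
Qed.

(* With [f = (J - x0) psi] one has [R_z f = psi + (z - x0) R_z psi]. *)
Lemma resIm_shift_bound x e x0 (psi : l2) : 0 < e ->
  ip (shift J x0 psi) (resIm J x e (shift J x0 psi)) <=
  2 * e * ip psi psi + 2 * ((x - x0) ^ 2 + e ^ 2) * ip psi (resIm J x e psi).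
Proof.
intros He. assert (Hen : e <> 0) by lra.
rewrite 2!ip_resIm_self by trivial.
destruct (resolventP J x e psi Hen) as [H1 H2].
set (u := resRe J x e psi) in *. set (v := resIm J x e psi) in *.
pose (s := x - x0).
(* p + i q = (z - x0) R_z psi, whose squared norm is ((x - x0)^2 + e^2) |R_z psi|^2. *)
pose (p := hsub (hscal s u) (hscal e v)). pose (q := hadd (hscal s v) (hscal e u)).
destruct (resolventE J x e (shift J x0 psi) (hadd psi p) q Hen) as [E1 E2].
{ split.
  - unfold p, q. rewrite shift_add, shift_sub, !shift_scal, H2.
    apply ip_ext. intros w.
    assert (e1 := f_equal (fun t => ip t w) H1). cbv beta in e1. rewrite ip_add_l, ip_scal_l in e1.
    assert (e2 := ip_shift_move J x x0 w psi). rewrite 2!(ip_comm _ w) in e2.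
    rewrite (ip_comm _ (shift J x0 psi) w), (ip_shift_move J x x0).
    ip_expand. rewrite (ip_comm _ w (shift J x psi)), (ip_comm _ w psi).
    replace (ip (shift J x u) w) with (ip psi w - e * ip v w) by lra. unfold s. ring.
  - unfold p, q. rewrite shift_add, !shift_scal, H2. rewrite <- H1 at 1.
    apply ip_ext. intros w.
    assert (e1 := f_equal (fun t => ip t w) H1). cbv beta in e1. rewrite ip_add_l, ip_scal_l in e1.
    ip_expand. unfold s. lra. }
rewrite E1, E2.
assert (h := ip_parallelogram psi p).
assert (h' : ip p p + ip q q = (s ^ 2 + e ^ 2) * (ip u u + ip v v)).
{ unfold p, q. ip_expand. rewrite (ip_comm _ v u). ring. }
assert (h4 := ip_ge0 l2 q). fold s.
replace (2 * (s ^ 2 + e ^ 2) * (e * (ip u u + ip v v))) with (2 * e * (ip p p + ip q q)) by (rewrite h'; ring).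
nra.
Qed.

End Green.

(** * Integrals of Green functions over a one-sided neighbourhood *)

Lemma RInt_scal_cont (k : R) (f : R -> R) c d : (forall x, continuous f x) ->
  RInt (fun x => k * f x) c d = k * RInt f c d.
Proof. intros Hf. apply (RInt_scal f c d k). now apply continuous_ex_RInt. Qed.

Lemma RInt_half_inv eta L : 0 < eta <= L ->
  is_RInt (fun t => / (2 * t)) eta L ((ln L - ln eta) / 2).
Proof.
intros H.
replace ((ln L - ln eta) / 2) with (minus (ln L / 2) (ln eta / 2)) by (change (ln L / 2 - ln eta / 2 = (ln L - ln eta) / 2 :> R); field).
apply (is_RInt_derive (fun t => ln t / 2)).
- intros t Ht. rewrite Rmin_left, Rmax_right in Ht by lra. auto_derive; [lra|field; lra].
- intros t Ht. rewrite Rmin_left, Rmax_right in Ht by lra.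
  apply (ex_derive_continuous (fun t => / (2 * t)) t). auto_derive. lra.
Qed.

(** In the application y is b_0, the zero of the factor in front of rho. If y lies strictly ahead of
    x0, the interval stops halfway and stays at distance at least L from y; otherwise it moves away
    from y and the distance is at least t. *)
Lemma in_fgs_one_sided l alpha beta x0 y : finite_gap_set l alpha beta -> in_fgs l alpha beta x0 ->
  exists s L, (s = 1 \/ s = -1) /\ 0 < L <= 1 /\
    (forall t, 0 <= t <= L -> in_fgs l alpha beta (x0 + s * t)) /\
    (forall t, 0 < t <= L -> t <= Rabs (x0 + s * t - y) \/ L <= Rabs (x0 + s * t - y)).
Proof.
intros [Hab _] [j [Hj Hx]].
specialize (Hab j Hj).
assert (K : exists s L, (s = 1 \/ s = -1) /\ 0 < L /\ (forall t, 0 <= t <= L -> in_fgs l alpha beta (x0 + s * t))).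
{ destruct (Rlt_dec x0 (beta j)) as [h|h].
  - exists 1, (beta j - x0). repeat split; [now left|lra|]. intros t Ht. exists j. split; [trivial|lra].
  - exists (-1), (beta j - alpha j). repeat split; [now right|lra|]. intros t Ht. exists j. split; [trivial|lra]. }
destruct K as [s [L [Hs [HL Hin]]]].
pose (q := s * (y - x0)).
assert (Hc : forall t, Rabs (x0 + s * t - y) = Rabs (t - q)).
{ intros t. unfold q. destruct Hs as [-> | ->].
  - f_equal. ring.
  - rewrite <- Rabs_Ropp. f_equal. ring. }
exists s, (Rmin (Rmin 1 L) (if Rlt_dec 0 q then q / 2 else 1)).
set (L' := Rmin _ _).
assert (h1 : L' <= 1) by (unfold L'; apply Rle_trans with (1 := Rmin_l _ _), Rmin_l).
assert (h2 : L' <= L) by (unfold L'; apply Rle_trans with (1 := Rmin_l _ _), Rmin_r).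
assert (h3 : L' <= if Rlt_dec 0 q then q / 2 else 1) by apply Rmin_r.
assert (h4 : 0 < L').
{ unfold L'. apply Rmin_glb_lt; [apply Rmin_glb_lt; lra|]. destruct Rlt_dec; lra. }
repeat split; trivial.
- intros t Ht. apply Hin. lra.
- intros t Ht. rewrite Hc. destruct (Rlt_dec 0 q) as [hq|hq].
  + right. rewrite Rabs_left; lra.
  + left. rewrite Rabs_pos_eq; lra.
Qed.

Section Integrals.
Context (a b : Z -> R) (M : R) (Ha : forall k, Rabs (a k) <= M) (Hb : forall k, Rabs (b k) <= M).
Let J := jacobi a b M Ha Hb.

Lemma continuous_Gre e m n x : 0 < e -> continuous (fun x => Gre a b M Ha Hb x e m n) x.
Proof.
intros He. apply continuous_ext with (fun x => ip (delta m : l2) (resRe J x e (delta n))).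
- intros t. symmetry. apply Gre_ip.
- now apply continuous_res.
Qed.

Lemma continuous_Gim e m n x : 0 < e -> continuous (fun x => Gim a b M Ha Hb x e m n) x.
Proof.
intros He. apply continuous_ext with (fun x => ip (delta m : l2) (resIm J x e (delta n))).
- intros t. symmetry. apply Gim_ip.
- now apply continuous_res.
Qed.

Lemma Gim_integral_bound D e n : 3 * M + 1 <= D -> 0 < e <= 1 ->
  RInt (fun x => Gim a b M Ha Hb x e n n) (- D) D <= 2 * D + 2.
Proof.
intros HD He.
rewrite (RInt_ext _ (fun x => ip (delta n : l2) (resIm J x e (delta n)))).
- apply Rle_trans with (1 := resIm_integral_bound J (delta n : l2) D e HD He).
  rewrite ip_delta_delta. lra.
- intros x _. apply Gim_ip.
Qed.

(** The truncation supplies the uniform bound that bounded convergence requires; below a threshold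
    less than 1 it agrees with |Re G_nn|. *)
Definition min1Gre e n x := Rmin 1 (Rabs (Gre a b M Ha Hb x e n n)).

Lemma continuous_min1Gre e n x : 0 < e -> continuous (min1Gre e n) x.
Proof.
intros He. apply (continuous_Rmin (fun _ => 1)); [apply continuous_const|].
apply (continuous_comp (fun x => Gre a b M Ha Hb x e n n) Rabs); [now apply continuous_Gre|apply continuous_Rabs].
Qed.

Lemma min1Gre_bounds e n x : 0 <= min1Gre e n x <= 1.
Proof. split; [apply Rmin_glb; [lra|apply Rabs_pos]|apply Rmin_l]. Qed.

Lemma min1Gre_integral_cv l alpha beta n c d : c <= d ->
  (forall x, c <= x <= d -> in_fgs l alpha beta x) ->
  leb_null (fun x => in_fgs l alpha beta x /\ ~ re_green_bv_zero a b n x) ->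
  Un_cv (fun k => RInt (min1Gre (/ INR (S k)) n) c d) 0.
Proof.
intros Hcd Hin Hnull.
apply (bounded_convergence c d (fun k => min1Gre (/ INR (S k)) n)
  (fun x => in_fgs l alpha beta x /\ ~ re_green_bv_zero a b n x)); trivial.
- intros k x. apply continuous_min1Gre, inv_INR_pos.
- intros k x. apply min1Gre_bounds.
- intros x Hx Hn e He.
  assert (Hg : re_green_bv_zero a b n x) by (apply NNPP; intros h; apply Hn; auto).
  destruct (Hg e He) as [eta [Heta H]]. destruct (inv_INR_small eta Heta) as [N HN].
  exists N. intros k Hk. unfold R_dist. rewrite Rminus_0_r, Rabs_pos_eq by apply min1Gre_bounds.
  assert (hp := inv_INR_pos k).
  apply Rle_lt_trans with (1 := Rmin_r _ _).
  apply (H (/ INR (S k)) (fun m => Gre a b M Ha Hb x (/ INR (S k)) m n)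
    (fun m => Gim a b M Ha Hb x (/ INR (S k)) m n)).
  + split; [trivial|now apply HN].
  + apply G_resolvent_sol. lra.
Qed.

End Integrals.

(** * Absence of decaying half-line solutions at points of e *)

Theorem torus_no_decaying_solution l alpha beta (a b : Z -> R) (x0 : R) (u : Z -> R) C :
  finite_gap_set l alpha beta -> in_iso_torus l alpha beta a b -> in_fgs l alpha beta x0 ->
  u 0%Z = 1 -> (forall N, sum_f_R0 (fun i => u (- Z.of_nat i)%Z ^ 2) N <= C) ->
  (forall k, (k <= -1)%Z -> twoJ a b u k = x0 * u k) -> False.
Proof.
intros Hfg [[Ma HMa] [[Mb HMb] [Hpos [_ Hrefl]]]] Hx0 Hu0 HC Hsol.
pose (M := Rmax Ma Mb).
assert (Ha : forall k, Rabs (a k) <= M) by (intros k; apply Rle_trans with (1 := HMa k), Rmax_l).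
assert (Hb : forall k, Rabs (b k) <= M) by (intros k; apply Rle_trans with (1 := HMb k), Rmax_r).
clearbody M. clear HMa HMb Ma Mb.
assert (HM : 0 <= M) by (assert (h := Ha 0%Z); assert (h' := Rabs_pos (a 0%Z)); lra).
pose (J := jacobi a b M Ha Hb).
pose (am := a (-1)%Z). pose (v := u (-1)%Z).
assert (Lpsi : l2Z (fun k => if Z_le_dec k (-1) then u k else 0)).
{ apply l2ZE. exists C. intros N. apply Rle_trans with (2 := HC (S N)).
  rewrite decomp_sum by lia. simpl pred.
  assert (h := pow2_ge_0 (u (- Z.of_nat 0)%Z)).
  match goal with |- zsum ?f N <= _ => assert (e : zsum f N = sum_f_R0 (fun i => u (- Z.of_nat (S i))%Z ^ 2) N) end.
  { apply sum_eq. intros i _. unfold zpair.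
    destruct (Z_le_dec (Z.of_nat i) (-1)) as [g|g]; [lia|].
    destruct (Z_le_dec (- Z.of_nat i - 1) (-1)) as [g'|g']; [|lia].
    replace (- Z.of_nat (S i))%Z with (- Z.of_nat i - 1)%Z by lia. ring. }
  rewrite e. lra. }
pose (psi := exist _ _ Lpsi : l2).
(* Cutting u off after site -1 leaves a_{-1} u_{-1} at site 0 and, at site -1, the missing term -
   a_{-1} u_0 with u_0 = 1. *)
pose (f := hadd (hscal (am * v) (delta 0 : l2)) (hscal (- am) (delta (-1) : l2))).
assert (Hf : shift J x0 psi = f).
{ apply l2vec_ext. intros k. unfold J. rewrite shift_jacobi.
  change (twoJ a b (fun k => if Z_le_dec k (-1) then u k else 0) k - x0 * (if Z_le_dec k (-1) then u k else 0)
    = am * v * delta_fun 0 k + - am * delta_fun (-1) k).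
  unfold twoJ, delta_fun.
  destruct (Z_lt_le_dec k (-1)) as [h|h].
  - assert (e := Hsol k ltac:(lia)). unfold twoJ in e.
    repeat destruct Z_le_dec; repeat destruct Z.eq_dec; try lia. lra.
  - destruct (Z.eq_dec k (-1)) as [-> |h1].
    + assert (e := Hsol (-1)%Z ltac:(lia)). unfold twoJ in e. simpl in e |- *.
      rewrite Hu0 in e. fold am v in e |- *. lra.
    + destruct (Z.eq_dec k 0) as [-> |h2].
      * simpl. fold am v. ring.
      * repeat destruct Z_le_dec; try lia. ring. }
pose (npsi := ip psi psi). assert (Hnpsi : 0 <= npsi) by apply ip_ge0.
destruct (in_fgs_one_sided l alpha beta x0 (b 0%Z) Hfg Hx0) as [s [L [Hs [HL [Hin Hc]]]]].
(* [-D, D] contains [x0 - 1, x0 + 1], and its ends exceed the operator bound 3 * M by at least 1. *)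
pose (D := 3 * M + 2 + Rabs x0). assert (Hx0' := Rabs_pos x0).
assert (Hx0D := Rle_abs x0). assert (Hx0D' := Rle_abs (- x0)). rewrite Rabs_Ropp in Hx0D'.
pose (I0 := 2 * D + 2). assert (HI0 : 0 <= I0) by (unfold I0, D; lra).
(* The summands bound the constant term, the integral of Im G_00 and that of 4 Im <psi, R_z psi>;
   the final 1 is reserved for the error terms. *)
pose (C1 := 2 * npsi + I0 + 4 * I0 * npsi + 1).
assert (HC1 : 0 <= C1) by (assert (0 <= I0 * npsi) by (apply Rmult_le_pos; trivial); unfold C1; lra).
(* This makes the integral of 1 / (2 t) over [eta, L] equal to C1 + 1/2. *)
pose (eta := L * exp (- (2 * C1 + 1))).
assert (Heta : 0 < eta < L).
{ unfold eta. assert (h := exp_pos (- (2 * C1 + 1))).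
  assert (h' : exp (- (2 * C1 + 1)) < 1) by (apply Rlt_le_trans with (exp 0); [apply exp_increasing; lra|rewrite exp_0; lra]). nra. }
assert (Hlog : (ln L - ln eta) / 2 > C1).
{ unfold eta. rewrite ln_mult, ln_exp by (try apply exp_pos; lra). lra. }
pose (c1 := D + 1 + M).
pose (T := 1 + 2 * M + (M + c1 ^ 2 + 1 + 2 * c1 + 2 * M ^ 2) / eta).
assert (HT : 1 <= T).
{ unfold T. assert (0 <= (M + c1 ^ 2 + 1 + 2 * c1 + 2 * M ^ 2) / eta); [|lra].
  apply Rdiv_le_0_compat; [|lra]. assert (h := pow2_ge_0 c1). assert (h' := pow2_ge_0 M). unfold c1, D in *. lra. }
pose (th := / (2 * T)).
assert (Hth : 0 < th < 1).
{ unfold th. split; [apply Rinv_0_lt_compat; lra|]. rewrite <- Rinv_1. apply Rinv_lt_contravar; lra. }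
assert (HthT : th * T <= 1 / 2) by (unfold th; right; field; lra).
(* An error err weakens the lower bound 1 / (2 t) by the factor 1 - err / th, a loss of at most K
   err for t >= eta. *)
pose (K := / (2 * eta * th)).
assert (HK : 0 < K) by (unfold K; apply Rinv_0_lt_compat; apply Rmult_lt_0_compat; lra).
pose (g := fun e n x => Gim a b M Ha Hb x e n n).
pose (m1 := fun e n => min1Gre a b M Ha Hb e n).
pose (E := fun e x => m1 e 0%Z x + (m1 e 1%Z x + m1 e (-1)%Z x)).
assert (Hpt : forall e t, 0 < e -> e <= 1 -> e <= eta ^ 2 -> eta <= t <= L ->
  / (2 * t) <= 2 * npsi + ((g e 0%Z (x0 + s * t) + (4 * ip psi (resIm J (x0 + s * t) e psi)
     + K * e * (g e 0%Z (x0 + s * t) + g e (-1)%Z (x0 + s * t)))) + K * E e (x0 + s * t))).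
{ intros e t He He1 He2 Ht. set (x := x0 + s * t).
  destruct (Gim_bounds a b M Ha Hb x e He) as [B1 [B2 B3]].
  fold (g e 0%Z x) in B1, B3. fold (g e (-1)%Z x) in B2, B3.
  assert (Hf1 := resIm_shift_bound a b M Ha Hb x e x0 psi He). fold J in Hf1. rewrite Hf in Hf1.
  assert (Hf2 := G_form a b M Ha Hb x e (am * v) (- am) He). cbv zeta in Hf2. fold f J in Hf2.
  assert (HN := resIm_form_ge0 a b M Ha Hb x e psi He). fold J in HN.
  set (P := ip f (resIm J x e f)) in *. set (N := ip psi (resIm J x e psi)) in *.
  assert (HP0 : 0 <= P) by apply (resIm_form_ge0 a b M Ha Hb x e f He).
  fold npsi in Hf1. fold (g e 0%Z x) (g e (-1)%Z x) in Hf2.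
  assert (Hst : (x - x0) ^ 2 = t ^ 2) by (unfold x; destruct Hs as [-> | ->]; ring).
  rewrite Hst in Hf1.
  assert (Ht2 : 0 < t ^ 2) by (apply pow_lt; lra).
  assert (Het2 : eta ^ 2 <= t ^ 2) by (apply pow_incr; lra).
  assert (Heta2 : 0 < eta ^ 2) by (apply pow_lt; lra).
  assert (HPt : P / t ^ 2 <= 2 * npsi + 4 * N).
  { apply Rmult_le_reg_r with (t ^ 2); trivial. unfold Rdiv. rewrite Rmult_assoc, Rinv_l, Rmult_1_r by lra.
    apply Rle_trans with (1 := Hf1).
    assert (h1 : e * npsi <= t ^ 2 * npsi) by (apply Rmult_le_compat_r; lra).
    assert (h2 : e ^ 2 * N <= t ^ 2 * N).
    { apply Rmult_le_compat_r; trivial. apply Rle_trans with e; [|lra]. nra. }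
    lra. }
  assert (HE0 : 0 <= m1 e 0%Z x /\ 0 <= m1 e 1%Z x /\ 0 <= m1 e (-1)%Z x) by (repeat split; apply min1Gre_bounds).
  pose (err := E e x + e * (g e 0%Z x + g e (-1)%Z x)).
  assert (Heg : 0 <= e * (g e 0%Z x + g e (-1)%Z x)) by (apply Rmult_le_pos; lra).
  assert (Herr : 0 <= err) by (unfold err, E; lra).
  assert (Hit : 0 < / (2 * t)) by (apply Rinv_0_lt_compat; lra).
  assert (HKerr : / (2 * t) * (err / th) <= K * err).
  { assert (h : / (2 * t) <= / (2 * eta)) by (apply Rinv_le_contravar; lra).
    replace (K * err) with (/ (2 * eta) * (err / th)) by (unfold K; field; lra).
    apply Rmult_le_compat_r; trivial. apply Rdiv_le_0_compat; lra. }
  assert (Hmain : / (2 * t) * (1 - err / th) <= g e 0%Z x + P / t ^ 2).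
  { assert (HPt0 : 0 <= P / t ^ 2) by (apply Rdiv_le_0_compat; trivial).
    (* Where the error reaches th the claimed lower bound is nonpositive; elsewhere every real part
       and e (g0 + gm) are below th, as the bound on the quadratic form requires. *)
    destruct (Rle_lt_dec th err) as [h|h].
    - assert (h1 : 1 <= err / th).
      { apply Rmult_le_reg_r with th; [lra|]. unfold Rdiv. rewrite Rmult_assoc, Rinv_l; lra. }
      nra.
    - assert (Hm : forall n, m1 e n x < th -> Rabs (Gre a b M Ha Hb x e n n) <= th).
      { intros n. unfold m1, min1Gre, Rmin. destruct Rle_dec; lra. }
      unfold err, E in h.
      assert (Hq : 1 / 8 <= g e 0%Z x * P).
      { destruct (G_relations a b M Ha Hb x e ltac:(lra)) as [F1 F2].
        rewrite Hf2.
        replace ((am * v) ^ 2 * g e 0%Z x + 2 * (am * v) * - am * Gim a b M Ha Hb x e (-1) 0 + (- am) ^ 2 * g e (-1)%Z x)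
          with (am ^ 2 * (v ^ 2 * g e 0%Z x + g e (-1)%Z x) - v * am * (2 * am * Gim a b M Ha Hb x e (-1) 0)) by ring.
        assert (pa : forall k, 0 <= a k <= M).
        { intros k. split; [apply Rlt_le, Hpos|]. apply Rle_trans with (2 := Ha k), Rle_abs. }
        apply quadratic_form_lower_bound with (a1 := a 0%Z) (c := x - b 0%Z) (e := e)
          (p0 := Gre a b M Ha Hb x e 0 0) (p1 := Gre a b M Ha Hb x e 1 1) (pm := Gre a b M Ha Hb x e (-1) (-1))
          (rho := 2 * am * Gre a b M Ha Hb x e (-1) 0 - 1) (M := M) (c0 := eta) (c1 := c1) (th := th);
          trivial; try lra; try (apply Hm; lra); try apply pa.
        - split.
          + destruct (Hc t ltac:(lra)); unfold x; lra.
          + unfold c1, D, x. apply Rabs_le. assert (hb := Hb 0%Z). apply Rabs_le_between in hb.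
            destruct Hs as [-> | ->]; lra.
        - rewrite Rabs_mult, (Rabs_pos_eq (2 * am)) by (assert (h9 := pa (-1)%Z); unfold am; lra).
          assert (h9 := pa (-1)%Z). fold am in h9. nra. }
      apply Rle_trans with (/ (2 * t)).
      { assert (h1 : 0 <= err / th) by (apply Rdiv_le_0_compat; lra). nra. }
      (* Arithmetic-geometric mean: (g + P / t^2)^2 >= 4 g P / t^2 >= 1 / (2 t^2), which exceeds (1
         / (2 t))^2. *)
      apply Rsqr_incr_0_var; [|lra]. rewrite 2!Rsqr_pow2.
      apply Rle_trans with (4 * (g e 0%Z x * (P / t ^ 2))).
      + replace ((/ (2 * t)) ^ 2) with (1 / 8 * (2 / t ^ 2)) by (field; lra).
        replace (4 * (g e 0%Z x * (P / t ^ 2))) with (g e 0%Z x * P * (4 / t ^ 2)) by (field; lra).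
        assert (h2 : 0 < / t ^ 2) by (apply Rinv_0_lt_compat; trivial).
        apply Rmult_le_compat; unfold Rdiv; lra.
      + assert (h3 := pow2_ge_0 (g e 0%Z x - P / t ^ 2)). lra. }
  rewrite Rmult_minus_distr_l, Rmult_1_r in Hmain. unfold err in *. fold x. lra. }
pose (c := Rmin x0 (x0 + s * L)). pose (d := Rmax x0 (x0 + s * L)).
assert (Hcd : c <= x0 <= d /\ c <= x0 + s * L <= d).
{ unfold c, d. repeat split; try apply Rmin_l; try apply Rmax_l; try apply Rmin_r; apply Rmax_r. }
assert (Hcd' : forall x, c <= x <= d -> in_fgs l alpha beta x).
{ intros x Hx. replace x with (x0 + s * (s * (x - x0))) by (destruct Hs as [-> | ->]; ring).
  apply Hin. revert Hx. unfold c, d.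
  destruct Hs as [-> | ->]; [rewrite Rmin_left, Rmax_right by lra|rewrite Rmin_right, Rmax_left by lra]; lra. }
assert (Hint : forall e, 0 < e -> e <= 1 -> e <= eta ^ 2 ->
  (ln L - ln eta) / 2 <= C1 - 1 + K * (2 * e * I0 + RInt (E e) c d)).
{ intros e He He1 He2.
  pose (R1 := fun x => g e 0%Z x + (4 * ip psi (resIm J x e psi) + K * e * (g e 0%Z x + g e (-1)%Z x))).
  assert (cg : forall n x, continuous (g e n) x) by (intros; now apply continuous_Gim).
  assert (cN : forall x, continuous (fun x => ip psi (resIm J x e psi)) x) by (intros; now apply continuous_res).
  assert (cgg : forall x, continuous (fun x => g e 0%Z x + g e (-1)%Z x) x).
  { intros x. now apply (continuous_plus (g e 0%Z) (g e (-1)%Z)). }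
  assert (c4 : forall x, continuous (fun x => 4 * ip psi (resIm J x e psi)) x).
  { intros x. now apply (continuous_scal_r 4 (fun x => ip psi (resIm J x e psi))). }
  assert (cK : forall x, continuous (fun x => K * e * (g e 0%Z x + g e (-1)%Z x)) x).
  { intros x. now apply (continuous_scal_r (K * e) (fun x => g e 0%Z x + g e (-1)%Z x)). }
  assert (c4K : forall x, continuous (fun x => 4 * ip psi (resIm J x e psi) + K * e * (g e 0%Z x + g e (-1)%Z x)) x).
  { intros x. now apply (continuous_plus (fun x => 4 * ip psi (resIm J x e psi))). }
  assert (cR1 : forall x, continuous R1 x).
  { intros x. now apply (continuous_plus (g e 0%Z)). }
  assert (cm : forall n x, continuous (m1 e n) x) by (intros; now apply continuous_min1Gre).
  assert (cE : forall x, continuous (E e) x).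
  { intros x. apply (continuous_plus (m1 e 0%Z)); [trivial|]. now apply (continuous_plus (m1 e 1%Z)). }
  assert (cKE : forall x, continuous (fun x => K * E e x) x).
  { intros x. now apply (continuous_scal_r K (E e)). }
  assert (cs : forall (h : R -> R), (forall x, continuous h x) -> forall t, continuous (fun t => h (x0 + s * t)) t).
  { intros h Hh t. apply (continuous_comp (fun t => x0 + s * t) h); [|apply Hh].
    apply (continuous_plus (fun _ => x0) (fun t => s * t)); [apply continuous_const|].
    apply (continuous_scal_r s (fun t : R => t)), continuous_id. }
  assert (pg : forall x, 0 <= g e 0%Z x /\ 0 <= g e (-1)%Z x).
  { intros x. destruct (Gim_bounds a b M Ha Hb x e He) as [h1 [h2 _]]. now split. }
  assert (pN : forall x, 0 <= ip psi (resIm J x e psi)) by (intros x; now apply resIm_form_ge0).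
  assert (pR1 : forall x, 0 <= R1 x).
  { intros x. unfold R1. destruct (pg x) as [h1 h2]. specialize (pN x).
    assert (0 <= K * e * (g e 0%Z x + g e (-1)%Z x)) by (repeat apply Rmult_le_pos; lra). lra. }
  assert (pE : forall x, 0 <= E e x).
  { intros x. unfold E. assert (h := fun n => proj1 (min1Gre_bounds a b M Ha Hb e n x)).
    repeat apply Rplus_le_le_0_compat; apply h. }
  assert (h1 : (ln L - ln eta) / 2 <= RInt (fun t => 2 * npsi + (R1 (x0 + s * t) + K * E e (x0 + s * t))) eta L).
  { rewrite <- (is_RInt_unique _ _ _ _ (RInt_half_inv eta L ltac:(lra))).
    apply RInt_le; [lra| | |].
    - eexists. apply RInt_half_inv. lra.
    - apply continuous_ex_RInt. intros t.
      apply (continuous_plus (fun _ => 2 * npsi)); [apply continuous_const|].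
      apply (continuous_plus (fun t => R1 (x0 + s * t)) (fun t => K * E e (x0 + s * t))); [now apply cs|].
      now apply (cs (fun x => K * E e x)).
    - intros t Ht. apply Hpt; lra. }
  rewrite (RInt_plus_cont (fun _ => 2 * npsi)) in h1.
  2:{ intros; apply continuous_const. }
  2:{ intros t. apply (continuous_plus (fun t => R1 (x0 + s * t)) (fun t => K * E e (x0 + s * t))); [now apply cs|].
      now apply (cs (fun x => K * E e x)). }
  rewrite RInt_const_R in h1.
  rewrite (RInt_plus_cont (fun t => R1 (x0 + s * t)) (fun t => K * E e (x0 + s * t))) in h1;
    [|now apply cs|now apply (cs (fun x => K * E e x))].
  assert (h2 : RInt (fun t => R1 (x0 + s * t)) eta L <= RInt R1 (- D) D).
  { apply RInt_reparam_le; trivial; [lra| |]; unfold D; destruct Hs as [-> | ->]; lra. }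
  assert (h3 : RInt (fun t => K * E e (x0 + s * t)) eta L <= RInt (fun x => K * E e x) c d).
  { apply (RInt_reparam_le (fun x => K * E e x)); trivial; [|lra| |lra].
    - intros x. apply Rmult_le_pos; [lra|trivial].
    - destruct Hs as [-> | ->]; lra. }
  rewrite (RInt_scal_cont K (E e)) in h3 by exact cE.
  assert (h4 : RInt R1 (- D) D <= I0 + 4 * I0 * npsi + K * (2 * e * I0)).
  { unfold R1. rewrite (RInt_plus_cont (g e 0%Z)), RInt_plus_cont, 2!RInt_scal_cont, RInt_plus_cont; trivial.
    assert (HD : 3 * M + 1 <= D) by (unfold D; lra).
    assert (k1 := Gim_integral_bound a b M Ha Hb D e 0%Z HD ltac:(lra)).
    assert (k2 := Gim_integral_bound a b M Ha Hb D e (-1)%Z HD ltac:(lra)).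
    assert (k3 := resIm_integral_bound J psi D e HD ltac:(lra)).
    fold I0 npsi in k1, k2, k3.
    change (RInt (g e 0%Z) (- D) D <= I0) in k1. change (RInt (g e (-1)%Z) (- D) D <= I0) in k2.
    assert (k4 : K * e * (RInt (g e 0%Z) (- D) D + RInt (g e (-1)%Z) (- D) D) <= K * e * (2 * I0)).
    { apply Rmult_le_compat_l; [apply Rmult_le_pos; lra|lra]. }
    lra. }
  assert (h5 : (L - eta) * (2 * npsi) <= 2 * npsi).
  { apply Rle_trans with (1 * (2 * npsi)); [apply Rmult_le_compat_r; lra|lra]. }
  unfold C1. lra. }
assert (Hcv : forall n, Un_cv (fun k => RInt (m1 (/ INR (S k)) n) c d) 0).
{ intros n. apply min1Gre_integral_cv with l alpha beta; trivial. lra. }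
(* With e and the three integrals of truncated real parts below w, the error is at most K w (2 I0 +
   3) <= 1, within the reserve in C1. *)
pose (w := / (K * (2 * I0 + 4))).
assert (Hw : 0 < w) by (apply Rinv_0_lt_compat, Rmult_lt_0_compat; lra).
destruct (Hcv 0%Z w Hw) as [N1 H1]. destruct (Hcv 1%Z w Hw) as [N2 H2]. destruct (Hcv (-1)%Z w Hw) as [N3 H3].
destruct (inv_INR_small (Rmin w (eta ^ 2))) as [N4 H4].
{ apply Rmin_glb_lt; trivial. apply pow_lt. lra. }
pose (k := (N1 + N2 + N3 + N4)%nat). pose (e := / INR (S k)).
specialize (H1 k ltac:(unfold k; lia)). specialize (H2 k ltac:(unfold k; lia)).
specialize (H3 k ltac:(unfold k; lia)). specialize (H4 k ltac:(unfold k; lia)).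
fold e in H1, H2, H3, H4. unfold R_dist in H1, H2, H3. rewrite Rminus_0_r in H1, H2, H3.
assert (He : 0 < e) by apply inv_INR_pos.
assert (Hew := Rlt_le_trans _ _ _ H4 (Rmin_l _ _)). assert (Hee := Rlt_le_trans _ _ _ H4 (Rmin_r _ _)).
assert (He1 : e <= 1).
{ apply Rle_trans with (eta ^ 2); [lra|]. rewrite <- (pow1 2). apply pow_incr. lra. }
specialize (Hint e He He1 ltac:(lra)).
assert (cm : forall n x, continuous (m1 e n) x) by (intros; now apply continuous_min1Gre).
unfold E in Hint.
rewrite (RInt_plus_cont (m1 e 0%Z)), RInt_plus_cont in Hint; trivial.
2:{ intros x. now apply (continuous_plus (m1 e 1%Z)). }
apply Rabs_lt_between in H1, H2, H3.
assert (Hlast : K * (2 * e * I0 + (RInt (m1 e 0%Z) c d + (RInt (m1 e 1%Z) c d + RInt (m1 e (-1)%Z) c d))) <= 1).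
{ apply Rle_trans with (K * (w * (2 * I0 + 4))).
  - apply Rmult_le_compat_l; [lra|].
    assert (e * I0 <= w * I0) by (apply Rmult_le_compat_r; lra). lra.
  - right. unfold w. field. split; lra. }
lra.
Qed.

(** * Solutions near infinity on the half-line *)

Lemma Un_cv_const c : Un_cv (fun _ => c) c.
Proof. intros e He. exists 0%nat. intros. unfold R_dist. rewrite Rminus_diag, Rabs_R0. trivial. Qed.

Lemma Un_cv_eventually (u v : nat -> R) (K : nat) l : (forall j, (K <= j)%nat -> u j = v j) -> Un_cv u l -> Un_cv v l.
Proof.
intros H Hu e He. destruct (Hu e He) as [N HN]. exists (N + K)%nat. intros n Hn.
rewrite <- H by lia. apply HN. lia.
Qed.

Lemma Un_cv_squeeze0 (u : nat -> R) (K : nat) : (forall j, (K <= j)%nat -> Rabs (u j) <= / INR (S j)) -> Un_cv u 0.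
Proof.
intros H e He. destruct (inv_INR_small e He) as [N HN]. exists (N + K)%nat. intros n Hn.
unfold R_dist. rewrite Rminus_0_r. apply Rle_lt_trans with (1 := H n ltac:(lia)). apply HN. lia.
Qed.

Lemma Un_cv_le_abs (u : nat -> R) l B : (forall j, Rabs (u j) <= B) -> Un_cv u l -> Rabs l <= B.
Proof.
intros H Hu. apply le_epsilon. intros e He. destruct (Hu e He) as [N HN].
specialize (HN N (Nat.le_refl _)). specialize (H N). unfold R_dist in HN.
apply Rabs_lt_between in HN. apply Rabs_le_between in H. apply Rabs_le. lra.
Qed.

(* A bounded solution [w] is orthogonal to the range of [J - x]: pairing [(J - x) h = delta_0]
   with [w] leaves only boundary terms, which vanish. *)
Lemma no_bounded_solution l alpha beta a b x w B : in_iso_torus l alpha beta a b ->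
  ~ in_fgs l alpha beta x -> (forall k, Rabs (w k) <= B) ->
  (forall k, twoJ a b w k = x * w k) -> w 0%Z = 0.
Proof.
intros [[M Ha] [_ [_ [Hspec _]]]] Hx HB Hw.
assert (Hs : ~ spec_two a b x) by (intros h; apply Hx, Hspec, h).
apply NNPP in Hs. destruct Hs as [Hsurj _].
destruct (Hsurj (delta_fun 0) (l2Z_delta 0)) as [h [Lh Hh]].
assert (HM : 0 <= M) by (assert (g := Ha 0%Z); assert (g' := Rabs_pos (a 0%Z)); lra).
assert (HB0 : 0 <= B) by (assert (g := HB 0%Z); assert (g' := Rabs_pos (w 0%Z)); lra).
pose (c := fun k => a k * (h (k + 1)%Z * w k - h k * w (k + 1)%Z)).
assert (Hc : forall N, w 0%Z = c (Z.of_nat N) - c (- Z.of_nat N - 2)%Z).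
{ intros N. rewrite <- zsum_telescope.
  rewrite (zsum_ext _ (fun k => delta_fun 0 k * w k)).
  - rewrite zsum_delta. repeat destruct Z_le_dec; try lia. ring.
  - intros k. rewrite <- Hh. unfold c. replace (k - 1 + 1)%Z with k by lia.
    transitivity (twoJ a b h k * w k - h k * twoJ a b w k); [unfold twoJ; ring|].
    rewrite Hw. ring. }
apply Rabs_eq_0, Rle_antisym; [|apply Rabs_pos]. apply le_epsilon. intros e He.
pose (d := e / (4 * (M * B) + 1)).
assert (HMB : 0 <= M * B) by (apply Rmult_le_pos; trivial).
assert (Hd : 0 < d) by (apply Rdiv_lt_0_compat; lra).
assert (Hde : 4 * (M * B) * d <= e).
{ assert (g : d * (4 * (M * B) + 1) = e) by (unfold d; field; lra). lra. }
destruct (l2Z_vanish h Lh d Hd) as [N HN].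
assert (Hck : forall k, (N + 1 <= Z.abs k)%Z -> Rabs (c k) <= 2 * (M * B) * d).
{ intros k Hk. unfold c. rewrite Rabs_mult.
  assert (g1 := HN k ltac:(lia)). assert (g2 := HN (k + 1)%Z ltac:(lia)).
  apply Rle_trans with (M * (2 * (d * B))); [|lra].
  apply Rmult_le_compat; try apply Rabs_pos; [apply Ha|].
  unfold Rminus. apply Rle_trans with (1 := Rabs_triang _ _). rewrite Rabs_Ropp, 2!Rabs_mult.
  assert (Rabs (h (k + 1)%Z) * Rabs (w k) <= d * B) by (apply Rmult_le_compat; try apply Rabs_pos; trivial).
  assert (Rabs (h k) * Rabs (w (k + 1)%Z) <= d * B) by (apply Rmult_le_compat; try apply Rabs_pos; trivial).
  lra. }
pose (m := Z.to_nat (N + 1)).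
assert (g1 := Hck (Z.of_nat m) ltac:(lia)). assert (g2 := Hck (- Z.of_nat m - 2)%Z ltac:(lia)).
rewrite (Hc m). apply Rabs_le_between in g1, g2. apply Rabs_le. lra.
Qed.

(** Extends half-line coefficients by the constant t to sites k <= 0. With t = 0 for the
    off-diagonal coefficients, the coupling between sites 0 and 1 is cut. *)
Definition zext (s : nat -> R) (t : R) (k : Z) : R := if Z_le_dec 1 k then s (Z.to_nat k) else t.

Lemma zext_pos s t k : (1 <= k)%Z -> zext s t k = s (Z.to_nat k).
Proof. intros H. unfold zext. destruct Z_le_dec; [trivial|lia]. Qed.

Lemma zext_neg s t k : (k <= 0)%Z -> zext s t k = t.
Proof. intros H. unfold zext. destruct Z_le_dec; [lia|trivial]. Qed.

Definition embed (f : nat -> R) (k : Z) : R := if Z_le_dec 1 k then f (Z.to_nat (k - 1)) else 0.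

(** Compactness: the coefficients seen from the sites m j, a bounded vector and an energy all
    converge along one subsequence. When the selected sites tend to infinity, the limit coefficients
    form a right limit. *)
Lemma joint_right_limit a b M : (forall i, Rabs (a i) <= M) -> (forall i, Rabs (b i) <= M) ->
  forall (m : nat -> nat) (v : nat -> Z -> R) (x : nat -> R) B,
  (forall j k, Rabs (v j k) <= B) -> (forall j, Rabs (x j) <= B) ->
  exists phi a' b' w x', (forall j, (j <= phi j)%nat) /\
    (forall n, Un_cv (fun j => a (Z.to_nat (Z.of_nat (m (phi j)) + n))) (a' n)) /\
    (forall n, Un_cv (fun j => b (Z.to_nat (Z.of_nat (m (phi j)) + n))) (b' n)) /\
    (forall n, Un_cv (fun j => v (phi j) n) (w n)) /\ Un_cv (fun j => x (phi j)) x'.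
Proof.
intros HaM HbM m v x B Hv Hx.
pose (s := fun (r : Z) j n =>
  if Z.eq_dec r 0 then a (Z.to_nat (Z.of_nat (m j) + n)) else
  if Z.eq_dec r 1 then b (Z.to_nat (Z.of_nat (m j) + n)) else
  if Z.eq_dec r 2 then v j n else x j).
destruct (joint_extraction s) as [phi [L [H1 H2]]].
{ intros r k. exists (Rmax M B). intros j. unfold s.
  repeat destruct Z.eq_dec; (eapply Rle_trans; [first [apply HaM|apply HbM|apply Hv|apply Hx]|]);
  first [apply Rmax_l|apply Rmax_r]. }
exists phi, (L 0%Z), (L 1%Z), (L 2%Z), (L 3%Z 0%Z). repeat split; trivial.
- intros n. exact (H2 0%Z n ltac:(lia)).
- intros n. exact (H2 1%Z n ltac:(lia)).
- intros n. exact (H2 2%Z n ltac:(lia)).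
- exact (H2 3%Z 0%Z ltac:(lia)).
Qed.

Lemma twoJ_limit (a b v : nat -> Z -> R) (x : nat -> R) (a' b' w : Z -> R) x' k :
  (forall n, Un_cv (fun j => a j n) (a' n)) -> (forall n, Un_cv (fun j => b j n) (b' n)) ->
  (forall n, Un_cv (fun j => v j n) (w n)) -> Un_cv x x' ->
  Un_cv (fun j => twoJ (a j) (b j) (v j) k - x j * v j k) 0 ->
  twoJ a' b' w k = x' * w k.
Proof.
intros Ha Hb Hv Hx H.
apply Rminus_diag_uniq.
assert (H' : Un_cv (fun j => twoJ (a j) (b j) (v j) k - x j * v j k) (twoJ a' b' w k - x' * w k)).
{ unfold twoJ. apply (CV_minus (fun j => a j (k - 1)%Z * v j (k - 1)%Z + b j k * v j k + a j k * v j (k + 1)%Z)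
    (fun j => x j * v j k)).
  - apply (CV_plus (fun j => a j (k - 1)%Z * v j (k - 1)%Z + b j k * v j k) (fun j => a j k * v j (k + 1)%Z)).
    + apply (CV_plus (fun j => a j (k - 1)%Z * v j (k - 1)%Z)); apply (CV_mult); trivial.
    + apply CV_mult; trivial.
  - apply CV_mult; trivial. }
apply UL_sequence with (1 := H') (2 := H).
Qed.

Section HalfLine.
Context (l : nat) (alpha beta : nat -> R) (a b : nat -> R) (M : R).
Context (HaM : forall i, Rabs (a i) <= M) (HbM : forall i, Rabs (b i) <= M).
Context (Hpos : forall n, (1 <= n)%nat -> 0 < a n) (Hnevai : nevai_class l alpha beta a b).

(* Far out, at energies near a point outside [e], a solution of [(J - x) v = f] cannot have a local
   maximum on a window of fixed size unless [f] is large there: a sequence of counterexamples would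
   converge to a bounded solution for some right limit. *)
Lemma window_estimate y : ~ in_fgs l alpha beta y ->
  exists q, forall x t s v B F, Rabs (x - y) <= / INR (S q) -> (2 * Z.of_nat q + 1 <= s)%Z ->
    (forall k, (Z.abs (k - s) <= Z.of_nat q)%Z -> Rabs (v k) <= B) ->
    (forall k, (Z.abs (k - s) <= Z.of_nat q)%Z ->
       Rabs (twoJ (zext a 0) (zext b t) v k - x * v k) <= F) ->
    Rabs (v s) <= B / 2 + INR (S q) * F.
Proof using HaM HbM Hnevai.
intros Hy. apply NNPP. intros Hn.
destruct (choice (fun q (p : (R * R * R * R) * (Z * (Z -> R))) =>
  let '((x, t, B, F), (s, v)) := p in
  Rabs (x - y) <= / INR (S q) /\ (2 * Z.of_nat q + 1 <= s)%Z /\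
    (forall k, (Z.abs (k - s) <= Z.of_nat q)%Z -> Rabs (v k) <= B) /\
    (forall k, (Z.abs (k - s) <= Z.of_nat q)%Z ->
       Rabs (twoJ (zext a 0) (zext b t) v k - x * v k) <= F) /\
    B / 2 + INR (S q) * F < Rabs (v s))) as [g Hg].
{ intros q. apply NNPP. intros H. apply Hn. exists q. intros x t s v B F h1 h2 h3 h4.
  apply Rnot_lt_le. intros h5. apply H. exists ((x, t, B, F), (s, v)). repeat split; trivial. }
pose (x := fun q => let '((x, t, B, F), (s, v)) := g q in x).
pose (t := fun q => let '((x, t, B, F), (s, v)) := g q in t).
pose (B := fun q => let '((x, t, B, F), (s, v)) := g q in B).
pose (F := fun q => let '((x, t, B, F), (s, v)) := g q in F).
pose (s := fun q => let '((x, t, B, F), (s, v)) := g q in s).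
pose (v := fun q => let '((x, t, B, F), (s, v)) := g q in v).
assert (Hg' : forall q, Rabs (x q - y) <= / INR (S q) /\ (2 * Z.of_nat q + 1 <= s q)%Z /\
    (forall k, (Z.abs (k - s q) <= Z.of_nat q)%Z -> Rabs (v q k) <= B q) /\
    (forall k, (Z.abs (k - s q) <= Z.of_nat q)%Z ->
       Rabs (twoJ (zext a 0) (zext b (t q)) (v q) k - x q * v q k) <= F q) /\
    B q / 2 + INR (S q) * F q < Rabs (v q (s q))).
{ intros q. specialize (Hg q). unfold x, t, B, F, s, v.
  destruct (g q) as [[[[? ?] ?] ?] [? ?]]. exact Hg. }
clearbody x t B F s v. clear g Hg Hn.
(* Centred at s and normalized there. The negated estimate gives B < 2 |v s| and (q + 1) F < |v s|,
   so the rescaled vectors are bounded by 2 with residuals below 1 / (q + 1). *)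
pose (w := fun q k => if Z_le_dec (Z.abs k) (Z.of_nat q) then v q (s q + k)%Z / v q (s q) else 0).
assert (Hv0 : forall q, 0 <= B q /\ 0 <= F q /\ 0 < Rabs (v q (s q))).
{ intros q. destruct (Hg' q) as [_ [_ [h3 [h4 h5]]]].
  specialize (h3 (s q) ltac:(lia)). specialize (h4 (s q) ltac:(lia)).
  assert (0 <= B q) by (apply Rle_trans with (2 := h3), Rabs_pos).
  assert (0 <= F q) by (apply Rle_trans with (2 := h4), Rabs_pos).
  assert (0 < INR (S q)) by (apply lt_0_INR; lia).
  assert (0 <= INR (S q) * F q) by (apply Rmult_le_pos; lra). repeat split; lra. }
assert (Hv0' : forall q, v q (s q) <> 0).
{ intros q h. destruct (Hv0 q) as [_ [_ h']]. rewrite h, Rabs_R0 in h'. lra. }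
destruct (joint_right_limit a b M HaM HbM (fun q => Z.to_nat (s q)) w x (Rmax 2 (Rabs y + 1)))
  as [phi [a' [b' [u [x' [H1 [Ha' [Hb' [Hu Hx']]]]]]]]].
{ intros q k. apply Rle_trans with (2 := Rmax_l _ _). unfold w.
  destruct Z_le_dec as [h|h]; [|rewrite Rabs_R0; lra].
  destruct (Hg' q) as [_ [_ [h3 [h4 h5]]]]. destruct (Hv0 q) as [h6 [h7 h8]].
  specialize (h3 (s q + k)%Z ltac:(lia)). unfold Rdiv. rewrite Rabs_mult, Rabs_inv.
  apply Rmult_le_reg_r with (Rabs (v q (s q))); trivial. rewrite Rmult_assoc, Rinv_l by lra.
  assert (0 < INR (S q)) by (apply lt_0_INR; lia).
  assert (0 <= INR (S q) * F q) by (apply Rmult_le_pos; lra). lra. }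
{ intros q. apply Rle_trans with (2 := Rmax_r _ _). destruct (Hg' q) as [h _].
  assert (h' : / INR (S q) <= 1).
  { rewrite <- Rinv_1. apply Rinv_le_contravar; [lra|]. apply (le_INR 1). lia. }
  replace (x q) with (y + (x q - y)) by ring. apply Rle_trans with (1 := Rabs_triang _ _). lra. }
assert (Hphi : forall q, / INR (S (phi q)) <= / INR (S q)).
{ intros q. apply Rinv_le_contravar; [apply lt_0_INR; lia|apply le_INR; specialize (H1 q); lia]. }
assert (ex : x' = y).
{ apply Rminus_diag_uniq. apply UL_sequence with (fun j => x (phi j) - y).
  - apply CV_minus; [trivial|apply Un_cv_const].
  - apply Un_cv_squeeze0 with 0%nat. intros j _. apply Rle_trans with (2 := Hphi j). apply Hg'. }
subst x'.
assert (Hlim : in_iso_torus l alpha beta a' b').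
{ apply Hnevai. exists (fun j => Z.to_nat (s (phi j))). repeat split; trivial.
  intros K. exists K. intros j Hj. specialize (H1 j). destruct (Hg' (phi j)) as [_ [h _]]. lia. }
assert (e1 : u 0%Z = 1).
{ apply UL_sequence with (1 := Hu 0%Z). apply Un_cv_eventually with (fun _ => 1) 0%nat; [|apply Un_cv_const].
  intros j _. unfold w. destruct Z_le_dec as [h|h]; [|simpl in h; lia]. rewrite Z.add_0_r. field. apply Hv0'. }
assert (e0 : u 0%Z = 0); [|lra].
apply (no_bounded_solution l alpha beta a' b' y u (Rmax 2 (Rabs y + 1))); trivial.
{ intros k. apply Un_cv_le_abs with (2 := Hu k). intros j. apply Rle_trans with (2 := Rmax_l _ _).
  unfold w. destruct Z_le_dec as [h|h]; [|rewrite Rabs_R0; lra].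
  destruct (Hg' (phi j)) as [_ [_ [h3 [h4 h5]]]]. destruct (Hv0 (phi j)) as [h6 [h7 h8]].
  specialize (h3 (s (phi j) + k)%Z ltac:(lia)). unfold Rdiv. rewrite Rabs_mult, Rabs_inv.
  apply Rmult_le_reg_r with (Rabs (v (phi j) (s (phi j)))); trivial. rewrite Rmult_assoc, Rinv_l by lra.
  assert (0 < INR (S (phi j))) by (apply lt_0_INR; lia).
  assert (0 <= INR (S (phi j)) * F (phi j)) by (apply Rmult_le_pos; lra). lra. }
intros k.
apply (twoJ_limit (fun j n => a (Z.to_nat (Z.of_nat (Z.to_nat (s (phi j))) + n)))
  (fun j n => b (Z.to_nat (Z.of_nat (Z.to_nat (s (phi j))) + n))) (fun j => w (phi j))
  (fun j => x (phi j))); trivial.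
apply Un_cv_squeeze0 with (Z.to_nat (Z.abs k + 1)). intros j Hj.
specialize (H1 j). set (q := phi j) in *.
apply Rle_trans with (2 := Hphi j). fold q.
destruct (Hg' q) as [_ [h2 [h3 [h4 h5]]]]. destruct (Hv0 q) as [h6 [h7 h8]].
specialize (h4 (s q + k)%Z ltac:(lia)).
match goal with |- Rabs ?X <= _ => assert (eX : X = (twoJ (zext a 0) (zext b (t q)) (v q) (s q + k) - x q * v q (s q + k)%Z) / v q (s q)) end.
{ unfold twoJ, w. repeat (destruct Z_le_dec; [|lia]).
  rewrite !zext_pos by lia. rewrite Z2Nat.id by lia.
  replace (s q + (k - 1))%Z with (s q + k - 1)%Z by lia.
  replace (s q + (k + 1))%Z with (s q + k + 1)%Z by lia. field. apply Hv0'. }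
rewrite eX. unfold Rdiv. rewrite Rabs_mult, Rabs_inv.
assert (hq : 0 < INR (S q)) by (apply lt_0_INR; lia).
apply Rmult_le_reg_r with (Rabs (v q (s q))); trivial. rewrite Rmult_assoc, Rinv_l, Rmult_1_r by lra.
apply Rmult_le_reg_l with (INR (S q)); trivial. rewrite <- (Rmult_assoc _ (/ _)), Rinv_r, Rmult_1_l by lra.
apply Rle_trans with (INR (S q) * F q); [apply Rmult_le_compat_l; lra|lra].
Qed.

(** The window estimate iterated r times, uniformly for x near y: every q sites halve the bound, and
    the residual contributes a fixed multiple of F. It serves both exact solutions, with F = 0, and
    approximate eigenvectors. *)
Definition contracting y q := forall r x t s v B F, Rabs (x - y) <= / INR (S q) ->
    (2 * Z.of_nat q + 1 + Z.of_nat r * Z.of_nat q <= s)%Z ->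
    (forall k, (Z.abs (k - s) <= Z.of_nat r * Z.of_nat q)%Z -> Rabs (v k) <= B) ->
    (forall k, (Z.abs (k - s) <= Z.of_nat r * Z.of_nat q)%Z ->
       Rabs (twoJ (zext a 0) (zext b t) v k - x * v k) <= F) ->
    Rabs (v s) <= B / 2 ^ r + 2 * INR (S q) * F.

(** The bound after r steps holds on the whole window around s, so one more window estimate halves
    it and adds INR (S q) * F; 2 * INR (S q) * F is the fixed point of this recursion. *)
Lemma iterated_window_estimate y : ~ in_fgs l alpha beta y -> exists q, contracting y q.
Proof using HaM HbM Hnevai.
intros Hy. destruct (window_estimate y Hy) as [q Hq]. exists q.
assert (hq : 0 < INR (S q)) by (apply lt_0_INR; lia).
intros r. induction r as [|r IH]; intros x t s v B F Hx Hs Hv HF.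
- specialize (Hv s ltac:(lia)). specialize (HF s ltac:(lia)).
  assert (0 <= F) by (apply Rle_trans with (2 := HF), Rabs_pos).
  assert (0 <= INR (S q) * F) by (apply Rmult_le_pos; lra). simpl pow. lra.
- assert (h := Hq x t s v (B / 2 ^ r + 2 * INR (S q) * F) F Hx ltac:(lia)).
  replace (B / 2 ^ S r + 2 * INR (S q) * F) with ((B / 2 ^ r + 2 * INR (S q) * F) / 2 + INR (S q) * F).
  2:{ simpl pow. field. apply pow_nonzero. lra. }
  apply h.
  + intros k Hk. apply (IH x t k v B F Hx); [nia| |]; intros k' Hk'; [apply Hv|apply HF]; nia.
  + intros k Hk. apply HF. nia.
Qed.

Lemma opoly_rec x : opoly a b 0 x = 1 /\ a 1%nat * opoly a b 1 x = x - b 1%nat /\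
  forall k, a (S (S k)) * opoly a b (S (S k)) x = (x - b (S (S k))) * opoly a b (S k) x - a (S k) * opoly a b k x.
Proof using Hpos.
assert (Hn : forall k, (1 <= k)%nat -> a k <> 0) by (intros k Hk; specialize (Hpos k Hk); lra).
assert (E : forall k, opoly a b (S k) x = snd (Defs.opp a b x k)).
{ intros k. unfold opoly. simpl. now destruct (Defs.opp a b x k). }
repeat split.
- rewrite E. simpl. field. apply Hn. lia.
- intros k. rewrite E. simpl. rewrite E. unfold opoly. destruct (Defs.opp a b x k) as [p q]. simpl. field. apply Hn. lia.
Qed.

Definition pZ (x : R) : Z -> R := embed (fun n => opoly a b n x).

Lemma pZ_solution x t k : (1 <= k)%Z -> twoJ (zext a 0) (zext b t) (pZ x) k = x * pZ x k.
Proof using Hpos.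
intros Hk. destruct (opoly_rec x) as [E0 [E1 E2]]. unfold twoJ.
destruct (Z.eq_dec k 1) as [-> |h].
- simpl Z.sub. rewrite (zext_neg a 0 0) by lia. rewrite !zext_pos by lia. unfold pZ, embed.
  simpl. change (Pos.to_nat 1) with 1%nat. rewrite E0. lra.
- rewrite !zext_pos by lia. unfold pZ, embed. repeat (destruct Z_le_dec; [|lia]).
  pose (n := Z.to_nat (k - 2)).
  replace (Z.to_nat (k - 1)) with (S n) by lia. replace (Z.to_nat k) with (S (S n)) by lia.
  replace (Z.to_nat (k - 1 - 1)) with n by lia. replace (Z.to_nat (k + 1 - 1)) with (S (S n)) by lia.
  specialize (E2 n). lra.
Qed.

(** Since [zext a 0] vanishes at site 0, the recursion is determined by the value at site 1; site n
    + 1 carries p_n. *)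
Lemma opoly_of_solution x t (v : Z -> R) :
  (forall k, (1 <= k)%Z -> twoJ (zext a 0) (zext b t) v k = x * v k) ->
  forall n, v (Z.of_nat n + 1)%Z = v 1%Z * opoly a b n x.
Proof using Hpos.
intros Hv. destruct (opoly_rec x) as [E0 [E1 E2]].
assert (Hn : forall k, (1 <= k)%nat -> a k <> 0) by (intros k Hk; specialize (Hpos k Hk); lra).
assert (H : forall n, v (Z.of_nat n + 1)%Z = v 1%Z * opoly a b n x /\
  v (Z.of_nat (S n) + 1)%Z = v 1%Z * opoly a b (S n) x).
{ induction n as [|n [IH1 IH2]].
  - rewrite E0. split; [simpl; ring|]. simpl.
    specialize (Hv 1%Z ltac:(lia)). unfold twoJ in Hv. simpl Z.sub in Hv. simpl Z.add in Hv.
    rewrite (zext_neg a 0 0) in Hv by lia. rewrite !zext_pos in Hv by lia.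
    change (Z.to_nat 1) with 1%nat in Hv.
    apply Rmult_eq_reg_l with (a 1%nat); [|apply Hn; lia].
    transitivity (v 1%Z * (a 1%nat * opoly a b 1 x)); [rewrite E1; lra|ring].
  - split; trivial.
    specialize (Hv (Z.of_nat (S n) + 1)%Z ltac:(lia)). unfold twoJ in Hv.
    rewrite !zext_pos in Hv by lia.
    replace (Z.of_nat (S n) + 1 - 1)%Z with (Z.of_nat n + 1)%Z in Hv by lia.
    replace (Z.of_nat (S n) + 1 + 1)%Z with (Z.of_nat (S (S n)) + 1)%Z in Hv by lia.
    replace (Z.to_nat (Z.of_nat n + 1)) with (S n) in Hv by lia.
    replace (Z.to_nat (Z.of_nat (S n) + 1)) with (S (S n)) in Hv by lia.
    rewrite IH1, IH2 in Hv.
    apply Rmult_eq_reg_l with (a (S (S n))); [|apply Hn; lia].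
    transitivity (v 1%Z * (a (S (S n)) * opoly a b (S (S n)) x)); [rewrite E2; lra|ring]. }
intros n. apply H.
Qed.

Lemma CD_kernel_diag_ge x n k : (k <= n)%nat -> opoly a b k x ^ 2 <= CD_kernel a b n x x.
Proof.
intros Hk. unfold CD_kernel. induction Hk as [|n Hk IH].
- destruct k as [|k]; [simpl; lra|]. rewrite tech5.
  assert (h : 0 <= sum_f_R0 (fun j => opoly a b j x * opoly a b j x) k) by (apply cond_pos_sum; intros; nra). lra.
- rewrite tech5. nra.
Qed.

(** Let B be the supremum of |p_k(x)|. From index 3 q on the values are at most B / 2, so B is
    already the supremum over k < 3 q, whence B^2 <= K_n(x,x). The iterated estimate then gives
    |p_n(x)| <= B / 2^r. *)
Lemma bounded_opoly_decay y q x C : contracting y q -> Rabs (x - y) <= / INR (S q) ->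
  (forall n, Rabs (opoly a b n x) <= C) ->
  forall r n, (3 * q + r * q <= n)%nat ->
  opoly a b n x ^ 2 <= CD_kernel a b n x x / 4 ^ r.
Proof using Hpos.
intros Hq Hx HC r n Hn.
destruct (completeness (fun t => exists k, t = Rabs (opoly a b k x))) as [B [HB1 HB2]].
{ exists C. intros t [k ->]. apply HC. }
{ exists (Rabs (opoly a b 0 x)). now exists 0%nat. }
assert (HB : forall k, Rabs (opoly a b k x) <= B) by (intros k; apply HB1; now exists k).
assert (HpZ : forall k, Rabs (pZ x k) <= B).
{ intros k. unfold pZ, embed. destruct Z_le_dec; [apply HB|]. rewrite Rabs_R0. apply Rle_trans with (2 := HB 0%nat), Rabs_pos. }
assert (Hstep : forall r k, (2 * q + r * q <= k)%nat -> Rabs (opoly a b k x) <= B / 2 ^ r).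
{ intros r' k Hk.
  assert (h := Hq r' x 0 (Z.of_nat k + 1)%Z (pZ x) B 0 Hx ltac:(nia) (fun k _ => HpZ k)).
  replace (B / 2 ^ r') with (B / 2 ^ r' + 2 * INR (S q) * 0) by ring.
  replace (opoly a b k x) with (pZ x (Z.of_nat k + 1)).
  - apply h. intros k' Hk'. rewrite pZ_solution by nia. rewrite Rminus_diag, Rabs_R0. lra.
  - unfold pZ, embed. destruct Z_le_dec; [|lia]. f_equal. lia. }
destruct (opoly_rec x) as [E0 _].
assert (HB0 : 1 <= B) by (specialize (HB 0%nat); rewrite E0, Rabs_R1 in HB; trivial).
set (K := CD_kernel a b n x x).
assert (HK0 : 0 <= K) by (apply Rle_trans with (2 := CD_kernel_diag_ge x n 0 ltac:(lia)), pow2_ge_0).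
assert (HBK : B <= Rmax (sqrt K) (B / 2)).
{ apply HB2. intros t [k ->]. destruct (Nat.le_gt_cases (2 * q + 1 * q) k) as [h|h].
  - apply Rle_trans with (2 := Rmax_r _ _). replace (B / 2) with (B / 2 ^ 1) by (simpl; field). now apply Hstep.
  - apply Rle_trans with (2 := Rmax_l _ _).
    apply Rsqr_incr_0_var; [|apply sqrt_pos].
    rewrite <- Rsqr_abs, 2!Rsqr_pow2, pow2_sqrt by trivial. apply CD_kernel_diag_ge. lia. }
assert (HBK' : B <= sqrt K).
{ revert HBK. unfold Rmax. destruct Rle_dec; lra. }
assert (h := Hstep r n ltac:(lia)).
assert (h2r : 0 < 2 ^ r) by (apply pow_lt; lra).
rewrite <- pow2_abs. apply Rle_trans with ((B / 2 ^ r) ^ 2).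
- apply pow_incr. split; [apply Rabs_pos|trivial].
- replace (4 ^ r) with (2 ^ r * 2 ^ r) by (rewrite <- Rpow_mult_distr; f_equal; lra).
  replace ((B / 2 ^ r) ^ 2) with (B ^ 2 * / (2 ^ r * 2 ^ r)) by (field; lra).
  apply Rmult_le_compat_r; [apply Rlt_le, Rinv_0_lt_compat, Rmult_lt_0_compat; trivial|].
  rewrite <- (pow2_sqrt K) by trivial. apply pow_incr. lra.
Qed.

End HalfLine.

(** * Points of the half-line spectrum *)

Lemma sum_f_R0_member (f : nat -> R) i n : (forall i, 0 <= f i) -> (i <= n)%nat -> f i <= sum_f_R0 f n.
Proof.
intros H Hi. induction Hi as [|n Hi IH].
- destruct i as [|i]; [simpl; lra|]. rewrite tech5. assert (h := cond_pos_sum f i H). lra.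
- rewrite tech5. specialize (H (S n)). lra.
Qed.

Lemma zsum_sum (h : nat -> Z -> R) n N :
  zsum (fun s => sum_f_R0 (fun i => h i s) n) N = sum_f_R0 (fun i => zsum (h i) N) n.
Proof.
induction n as [|n IH]; [reflexivity|].
rewrite tech5, <- IH, <- zsum_plus. apply zsum_ext. intros k. now rewrite tech5.
Qed.

Lemma zsum_shift_bound d : forall (g : Z -> R) C, (forall k, 0 <= g k) -> (forall N, zsum g N <= C) ->
  forall N, zsum (fun s => g (s + d)%Z) N <= C.
Proof.
induction d as [|d IH|d IH] using Z.peano_ind; intros g C Hg HC N.
- rewrite (zsum_ext _ g); [apply HC|]. intros k. f_equal. lia.
- apply Rle_trans with (zsum (fun s => g (s + d)%Z) (S N)); [|now apply IH].
  rewrite (zsum_ext _ (fun s => (fun s => g (s + d)%Z) (s + 1)%Z)).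
  + apply (zsum_shift_le (fun s => g (s + d)%Z)). intros k; apply Hg.
  + intros k. f_equal. lia.
- apply Rle_trans with (zsum (fun s => g (s + d)%Z) (S N)); [|now apply IH].
  rewrite (zsum_ext _ (fun s => (fun s => g (s + d)%Z) (s - 1)%Z)).
  + apply (zsum_shift_le (fun s => g (s + d)%Z)). intros k; apply Hg.
  + intros k. f_equal. lia.
Qed.

Definition window_sum (g : Z -> R) (W : nat) (s : Z) : R :=
  sum_f_R0 (fun i => g (s + (Z.of_nat i - Z.of_nat W))%Z) (2 * W).

Lemma window_sum_member g W s k : (forall k, 0 <= g k) -> (Z.abs (k - s) <= Z.of_nat W)%Z ->
  g k <= window_sum g W s.
Proof.
intros Hg Hk. unfold window_sum.
assert (h := sum_f_R0_member (fun i => g (s + (Z.of_nat i - Z.of_nat W))%Z) (Z.to_nat (k - s + Z.of_nat W)) (2 * W)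
  (fun i => Hg _) ltac:(lia)). cbv beta in h.
replace (s + (Z.of_nat (Z.to_nat (k - s + Z.of_nat W)) - Z.of_nat W))%Z with k in h by lia. exact h.
Qed.

(** Each site belongs to 2 W + 1 windows. *)
Lemma zsum_window_sum g W C N : (forall k, 0 <= g k) -> (forall N, zsum g N <= C) ->
  zsum (window_sum g W) N <= C * INR (S (2 * W)).
Proof.
intros Hg HC. unfold window_sum. rewrite zsum_sum, <- sum_cte. apply sum_Rle. intros i _.
now apply (zsum_shift_bound (Z.of_nat i - Z.of_nat W) g).
Qed.

Lemma embed_succ f i : embed f (Z.of_nat i + 1) = f i.
Proof. unfold embed. destruct Z_le_dec; [f_equal; lia|lia]. Qed.

Lemma l2Z_embed f : l2N f -> l2Z (embed f).
Proof.
intros [C HC]. apply l2ZE. exists C. intros N. apply Rle_trans with (2 := HC N).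
apply Rle_trans with (zsum (fun k => embed f k ^ 2) (S N)); [apply zsum_incr; intros; apply pow2_ge_0|].
right. unfold zsum. rewrite decomp_sum by lia. simpl pred.
replace (zpair (fun k => embed f k ^ 2) 0) with 0.
- rewrite Rplus_0_l. apply sum_eq. intros i _. unfold zpair.
  replace (Z.of_nat (S i)) with (Z.of_nat i + 1)%Z by lia. rewrite embed_succ.
  unfold embed. destruct Z_le_dec; [lia|]. ring.
- unfold zpair, embed. repeat destruct Z_le_dec; try lia. ring.
Qed.

Lemma l2N_restrict v : l2Z v -> l2N (fun i => v (Z.of_nat i + 1)%Z).
Proof.
rewrite l2ZE. intros [C HC]. exists C. intros N. apply Rle_trans with (2 := HC (S N)).
unfold zsum. rewrite (decomp_sum _ (S N)) by lia. simpl pred.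
assert (h : 0 <= zpair (fun k => v k ^ 2) 0).
{ unfold zpair. apply Rplus_le_le_0_compat; apply pow2_ge_0. }
apply Rle_trans with (sum_f_R0 (fun i => zpair (fun k => v k ^ 2) (S i)) N); [|lra].
apply sum_Rle. intros i _. unfold zpair. replace (Z.of_nat (S i)) with (Z.of_nat i + 1)%Z by lia.
assert (h' := pow2_ge_0 (v (- (Z.of_nat i + 1) - 1)%Z)). lra.
Qed.

Lemma halfJ_twoJ a b t v i :
  twoJ (zext a 0) (zext b t) v (Z.of_nat i + 1) = halfJ a b (fun i => v (Z.of_nat i + 1)%Z) i.
Proof.
unfold twoJ, halfJ. rewrite 2!(zext_pos _ _ (Z.of_nat i + 1)) by lia.
replace (Z.to_nat (Z.of_nat i + 1)) with (S i) by lia.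
replace (Z.of_nat (S i) + 1)%Z with (Z.of_nat i + 1 + 1)%Z by lia.
replace (Z.of_nat i + 1 - 1)%Z with (Z.of_nat i) by lia.
destruct i as [|i].
- rewrite zext_neg by lia. ring.
- rewrite zext_pos by lia. replace (Z.to_nat (Z.of_nat (S i))) with (S i) by lia.
  replace (Z.of_nat (S i)) with (Z.of_nat i + 1)%Z by lia. ring.
Qed.

Definition far_value (x : R) : R := if Rle_dec 1 (Rabs x) then 0 else 2.

Lemma far_value_bound x : Rabs (far_value x) <= 2 /\ 1 <= Rabs (far_value x - x).
Proof.
unfold far_value. destruct Rle_dec as [h|h].
- rewrite Rabs_R0, Rminus_0_l, Rabs_Ropp. split; lra.
- apply Rnot_le_lt, Rabs_lt_between in h. rewrite 2!Rabs_pos_eq by lra. lra.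
Qed.

Section Spectrum.
Context (l : nat) (alpha beta : nat -> R) (a b : nat -> R) (M : R).
Context (HaM : forall i, Rabs (a i) <= M) (HbM : forall i, Rabs (b i) <= M).
Context (Hpos : forall n, (1 <= n)%nat -> 0 < a n).

Lemma zext_bound s t k : (forall i, Rabs (s i) <= M) -> Rabs t <= 2 -> Rabs (zext s t k) <= M + 2.
Proof.
intros Hs Ht. assert (h := Hs 0%nat). assert (h' := Rabs_pos (s 0%nat)).
unfold zext. destruct Z_le_dec; [specialize (Hs (Z.to_nat k)); lra|lra].
Qed.

Lemma za_bound k : Rabs (zext a 0 k) <= M + 2.
Proof using HaM. apply zext_bound; trivial. rewrite Rabs_R0. lra. Qed.

Lemma zb_bound x k : Rabs (zext b (far_value x) k) <= M + 2.
Proof using HbM. apply zext_bound; trivial. apply far_value_bound. Qed.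

(* The half-line matrix as the restriction of a two-sided one that is decoupled at [0] and equals
   the scalar [far_value x], at distance [>= 1] from [x], on the negative half-line. *)
Definition half_jacobi x : selfadj l2 :=
  jacobi (zext a 0) (zext b (far_value x)) (M + 2) za_bound (zb_bound x).

(** If instead |(A - x) v|^2 >= c |v|^2 for all v, then A - x is onto and injective; solving for
    data supported on sites >= 1 and restricting shows that x is in the resolvent set of J. *)
Lemma spec_half_not_below x c : spec_half a b x -> 0 < c ->
  exists v : l2, ip (shift (half_jacobi x) x v) (shift (half_jacobi x) x v) < c * ip v v.
Proof.
intros Hs Hc. apply NNPP. intros Hn. apply Hs.
assert (Hb : forall v : l2, c * ip v v <= ip (shift (half_jacobi x) x v) (shift (half_jacobi x) x v)).
{ intros v. apply Rnot_lt_le. intros h. apply Hn. now exists v. }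
split.
- intros f Hf. destruct (shift_surjective (half_jacobi x) x c Hc Hb (exist _ _ (l2Z_embed f Hf) : l2)) as [w Hw].
  exists (fun i => vec w (Z.of_nat i + 1)%Z). split; [apply l2N_restrict, l2Z_vec|].
  intros i. rewrite <- (halfJ_twoJ a b (far_value x)).
  assert (h := f_equal (fun v : l2 => vec v (Z.of_nat i + 1)%Z) Hw). cbv beta in h.
  unfold half_jacobi in h. rewrite shift_jacobi in h. rewrite h. apply embed_succ.
- intros v w Hv Hw Heq i.
  assert (Ld : l2N (fun i => v i - w i)).
  { destruct Hv as [C1 H1], Hw as [C2 H2]. exists (2 * C1 + 2 * C2). intros N.
    apply Rle_trans with (sum_f_R0 (fun i => v i ^ 2 * 2 + w i ^ 2 * 2) N).
    - apply sum_Rle. intros k _. assert (h := pow2_ge_0 (v k + w k)). lra.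
    - rewrite sum_plus, <- 2!scal_sum. specialize (H1 N). specialize (H2 N). lra. }
  pose (d := exist _ _ (l2Z_embed _ Ld) : l2).
  assert (Hd : shift (half_jacobi x) x d = hzero).
  { apply l2vec_ext. intros k. unfold half_jacobi. rewrite shift_jacobi.
    change (vec (hzero : l2) k) with 0.
    change (vec d) with (embed (fun i => v i - w i)).
    destruct (Z_le_dec 1 k) as [h|h].
    - replace k with (Z.of_nat (Z.to_nat (k - 1)) + 1)%Z by lia.
      set (n := Z.to_nat (k - 1)). rewrite halfJ_twoJ, embed_succ. specialize (Heq n).
      unfold halfJ in *. rewrite !embed_succ. destruct n as [|n]; [lra|]. rewrite embed_succ. lra.
    - unfold twoJ. rewrite (zext_neg a 0 (k - 1)), (zext_neg a 0 k) by lia.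
      unfold embed at 2 4. destruct Z_le_dec; [lia|]. ring. }
  specialize (Hb d). rewrite Hd, ip_zero_l in Hb.
  assert (h := l2_coord_le d (Z.of_nat i + 1)). change (l2_ip d d) with (ip d d) in h.
  change (vec d (Z.of_nat i + 1)%Z) with (embed (fun i => v i - w i) (Z.of_nat i + 1)) in h.
  rewrite embed_succ in h. assert (h' := ip_ge0 l2 d).
  assert (h0 : ip d d = 0) by nra. rewrite h0 in h.
  apply Rminus_diag_uniq, Rsqr_0_uniq, Rle_antisym; [rewrite Rsqr_pow2; exact h|apply Rle_0_sqr].
Qed.

Lemma spec_half_bounded x : spec_half a b x -> Rabs x <= 3 * (M + 2) + 1.
Proof.
intros Hs. apply Rnot_lt_le. intros h.
destruct (spec_half_not_below x 1 Hs Rlt_0_1) as [v Hv].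
assert (h' := shift_below (half_jacobi x) x v (Rlt_le _ _ h)). lra.
Qed.

(** An approximate eigenvector cannot escape to infinity. Far out |v_s|^2 is at most a small
    multiple of the mass in a window plus a multiple of the residual there; summed over s, the mass
    term is absorbed on the left. On sites s <= 0 the operator is the scalar [far_value x], so the
    residual controls v. *)
Lemma approx_eigenvector_head y q x : contracting a b y q -> Rabs (x - y) <= / INR (S q) ->
  exists n C, 0 <= C /\ forall v : l2, ip v v <= 2 * sum_f_R0 (fun i => vec v (Z.of_nat i + 1)%Z ^ 2) n +
    C * ip (shift (half_jacobi x) x v) (shift (half_jacobi x) x v).
Proof.
intros Hq Hx.
(* Absorption needs 2 w / 4^r <= 1/2 with w = 2 r q + 1. Indeed w <= (2 q + 1) (r + 1) while 8 (2 q
   + 1) <= r + 1 <= 2^r. *)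
pose (r := (8 * (2 * q + 1))%nat). pose (W := (r * q)%nat). pose (n := (2 * q + 1 + W)%nat).
pose (Q := INR (S q)). pose (w := INR (S (2 * W))).
assert (Hw : 0 <= w) by apply pos_INR.
pose (C := 8 * Q ^ 2 * w + 1).
assert (HC : 0 <= C).
{ assert (0 <= 8 * Q ^ 2 * w); [|unfold C; lra]. apply Rmult_le_pos; trivial. assert (h := pow2_ge_0 Q). lra. }
exists n, (2 * C). split; [lra|]. intros v.
set (f := shift (half_jacobi x) x v).
assert (Hfk : forall k, vec f k = twoJ (zext a 0) (zext b (far_value x)) (vec v) k - x * vec v k).
{ intros k. unfold f, half_jacobi. apply shift_jacobi. }
assert (h2r : 0 < 2 ^ r) by (apply pow_lt; lra).
assert (Hpt : forall s, vec v s ^ 2 <= sum_f_R0 (fun i => delta_fun (Z.of_nat i + 1) s * vec v s ^ 2) n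
  + (2 / (2 ^ r) ^ 2 * window_sum (fun k => vec v k ^ 2) W s
  + (8 * Q ^ 2 * window_sum (fun k => vec f k ^ 2) W s + vec f s ^ 2))).
{ intros s.
  assert (w1 : 0 <= window_sum (fun k => vec v k ^ 2) W s) by (apply cond_pos_sum; intros; apply pow2_ge_0).
  assert (w2 : 0 <= window_sum (fun k => vec f k ^ 2) W s) by (apply cond_pos_sum; intros; apply pow2_ge_0).
  assert (dp : forall i, 0 <= delta_fun (Z.of_nat i + 1) s * vec v s ^ 2).
  { intros i. apply Rmult_le_pos; [unfold delta_fun; destruct Z.eq_dec; lra|apply pow2_ge_0]. }
  assert (w3 := cond_pos_sum _ n dp).
  assert (w4 : 0 <= 2 / (2 ^ r) ^ 2 * window_sum (fun k => vec v k ^ 2) W s).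
  { apply Rmult_le_pos; trivial. apply Rdiv_le_0_compat; [lra|]. now apply pow_lt. }
  assert (w5 : 0 <= 8 * Q ^ 2 * window_sum (fun k => vec f k ^ 2) W s).
  { apply Rmult_le_pos; trivial. assert (h := pow2_ge_0 Q). lra. }
  assert (w6 := pow2_ge_0 (vec f s)).
  destruct (Z_le_dec s 0) as [h|h].
  - assert (e : vec f s ^ 2 = Rabs (far_value x - x) ^ 2 * vec v s ^ 2).
    { rewrite Hfk. unfold twoJ. rewrite 2!(zext_neg a 0), (zext_neg b) by lia.
      rewrite pow2_abs. ring. }
    assert (h' : 1 <= Rabs (far_value x - x) ^ 2).
    { rewrite <- (pow1 2). apply pow_incr. split; [lra|apply far_value_bound]. }
    assert (h'' := pow2_ge_0 (vec v s)). nra.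
  - destruct (Z_le_dec s (Z.of_nat n)) as [h1|h1].
    + assert (g := sum_f_R0_member _ (Z.to_nat (s - 1)) n dp ltac:(lia)). cbv beta in g.
      replace (delta_fun (Z.of_nat (Z.to_nat (s - 1)) + 1) s) with 1 in g; [lra|].
      unfold delta_fun. destruct Z.eq_dec; [trivial|lia].
    + set (B2 := window_sum (fun k => vec v k ^ 2) W s) in *. set (F2 := window_sum (fun k => vec f k ^ 2) W s) in *.
      assert (g : Rabs (vec v s) <= sqrt B2 / 2 ^ r + 2 * Q * sqrt F2).
      { assert (K : forall (u : Z -> R) k, (Z.abs (k - s) <= Z.of_nat r * Z.of_nat q)%Z ->
          Rabs (u k) <= sqrt (window_sum (fun k => u k ^ 2) W s)).
        { intros u k Hk. rewrite <- sqrt_Rsqr_abs. apply sqrt_le_1_alt. rewrite Rsqr_pow2.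
          apply (window_sum_member (fun k => u k ^ 2)); [intros; apply pow2_ge_0|unfold W; lia]. }
        apply (Hq r x (far_value x) s (vec v)); trivial.
        - unfold n, W in h1. lia.
        - intros k Hk. now apply K.
        - intros k Hk. rewrite <- Hfk. now apply K. }
      assert (s1 := sqrt_pos B2). assert (s2 := sqrt_pos F2).
      assert (g2 : vec v s ^ 2 <= 2 * (sqrt B2 / 2 ^ r) ^ 2 + 2 * (2 * Q * sqrt F2) ^ 2).
      { rewrite <- pow2_abs. apply Rle_trans with ((sqrt B2 / 2 ^ r + 2 * Q * sqrt F2) ^ 2).
        - apply pow_incr. split; [apply Rabs_pos|trivial].
        - assert (k := pow2_ge_0 (sqrt B2 / 2 ^ r - 2 * Q * sqrt F2)). lra. }
      replace (2 * (sqrt B2 / 2 ^ r) ^ 2) with (2 / (2 ^ r) ^ 2 * sqrt B2 ^ 2) in g2 by (field; lra).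
      replace (2 * (2 * Q * sqrt F2) ^ 2) with (8 * Q ^ 2 * sqrt F2 ^ 2) in g2 by ring.
      rewrite 2!pow2_sqrt in g2 by trivial. lra. }
set (H := sum_f_R0 (fun i => vec v (Z.of_nat i + 1)%Z ^ 2) n).
assert (Hnn : ip v v <= H + (2 / (2 ^ r) ^ 2 * (ip v v * w) + (8 * Q ^ 2 * (ip f f * w) + ip f f))).
{ apply l2_ip_sq_bound. intros N. apply Rle_trans with (1 := zsum_le _ _ N Hpt).
  rewrite 3!zsum_plus, 2!zsum_scal, zsum_sum.
  assert (k1 : sum_f_R0 (fun i => zsum (fun s => delta_fun (Z.of_nat i + 1) s * vec v s ^ 2) N) n <= H).
  { apply sum_Rle. intros i _. rewrite (zsum_delta _ (fun s => vec v s ^ 2)).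
    assert (k := pow2_ge_0 (vec v (Z.of_nat i + 1)%Z)). repeat destruct Z_le_dec; try lia; lra. }
  assert (k2 : zsum (window_sum (fun k => vec v k ^ 2) W) N <= ip v v * w).
  { apply zsum_window_sum; [intros; apply pow2_ge_0|apply (l2_ip_sq_le v)]. }
  assert (k3 : zsum (window_sum (fun k => vec f k ^ 2) W) N <= ip f f * w).
  { apply zsum_window_sum; [intros; apply pow2_ge_0|apply (l2_ip_sq_le f)]. }
  assert (k4 := l2_ip_sq_le f N). change (l2_ip f f) with (ip f f) in k4.
  assert (k5 : 0 <= 2 / (2 ^ r) ^ 2) by (apply Rdiv_le_0_compat; [lra|now apply pow_lt]).
  assert (k6 : 0 <= 8 * Q ^ 2) by (assert (k := pow2_ge_0 Q); lra).
  apply Rmult_le_compat_l with (r := 2 / (2 ^ r) ^ 2) in k2; trivial.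
  apply Rmult_le_compat_l with (r := 8 * Q ^ 2) in k3; trivial.
  change (zsum (fun k => window_sum (fun k0 => vec v k0 ^ 2) W k)) with (zsum (window_sum (fun k => vec v k ^ 2) W)).
  change (zsum (fun k => window_sum (fun k0 => vec f k0 ^ 2) W k)) with (zsum (window_sum (fun k => vec f k ^ 2) W)).
  lra. }
assert (Hrw : 2 / (2 ^ r) ^ 2 * w <= 1 / 2).
{ assert (k1 : INR (S r) <= 2 ^ r).
  { rewrite <- (pow_INR 2). apply le_INR. apply Nat.pow_gt_lin_r. lia. }
  assert (k2 : w <= INR (2 * q + 1) * INR (S r)).
  { unfold w, W. rewrite <- mult_INR. apply le_INR. nia. }
  assert (k3 : 8 * INR (2 * q + 1) <= INR (S r)).
  { replace 8 with (INR 8) by (simpl; ring). rewrite <- mult_INR. apply le_INR. unfold r. lia. }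
  assert (k4 : 0 <= INR (2 * q + 1)) by apply pos_INR.
  assert (k5 : 4 * w <= (2 ^ r) ^ 2).
  { apply Rle_trans with (4 * (INR (2 * q + 1) * 2 ^ r)).
    - apply Rmult_le_compat_l; [lra|]. apply Rle_trans with (1 := k2). now apply Rmult_le_compat_l.
    - simpl pow. rewrite Rmult_1_r, <- Rmult_assoc. apply Rmult_le_compat_r; lra. }
  apply Rmult_le_reg_r with ((2 ^ r) ^ 2); [now apply pow_lt|].
  replace (2 / (2 ^ r) ^ 2 * w * (2 ^ r) ^ 2) with (2 * w) by (field; lra). lra. }
assert (Hv0 := ip_ge0 l2 v).
assert (Hrw' : 2 / (2 ^ r) ^ 2 * (ip v v * w) <= 1 / 2 * ip v v).
{ replace (2 / (2 ^ r) ^ 2 * (ip v v * w)) with (2 / (2 ^ r) ^ 2 * w * ip v v) by ring.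
  now apply Rmult_le_compat_r. }
unfold C. lra.
Qed.

(** Normalized approximate eigenvectors have a coordinatewise limit w solving the equation exactly.
    Mass stays in the head, so w_1 <> 0, as otherwise w would vanish on all sites >= 1. Then w_{n+1}
    = w_1 p_n(x) and |w| <= 1 give the bound 1 / |w_1|. *)
Lemma spectral_opoly_bounded y q x : contracting a b y q -> Rabs (x - y) <= / INR (S q) ->
  spec_half a b x -> exists B, forall n, Rabs (opoly a b n x) <= B.
Proof using Hpos HaM HbM.
intros Hq Hx Hs.
destruct (approx_eigenvector_head y q x Hq Hx) as [n [C [HC Hhead]]].
destruct (choice (fun (k : nat) (v : l2) => ip v v = 1 /\
  ip (shift (half_jacobi x) x v) (shift (half_jacobi x) x v) <= (/ INR (S k)) ^ 2)) as [v Hv].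
{ intros k. assert (hk := inv_INR_pos k).
  destruct (spec_half_not_below x ((/ INR (S k)) ^ 2) Hs) as [u Hu]; [now apply pow_lt|].
  assert (h0 := ip_ge0 l2 (shift (half_jacobi x) x u)). assert (h1 := ip_ge0 l2 u).
  assert (hp : 0 < (/ INR (S k)) ^ 2) by now apply pow_lt.
  assert (h2 : 0 < ip u u).
  { destruct (Req_dec (ip u u) 0) as [e|e]; [rewrite e in Hu; lra|lra]. }
  assert (h3 : / hnorm u * / hnorm u * ip u u = 1).
  { rewrite <- hnorm_sq. field. intros e. assert (h := hnorm_sq u). rewrite e in h. lra. }
  exists (hscal (/ hnorm u) u). rewrite shift_scal. ip_expand. split; [lra|].
  assert (h4 : 0 <= / hnorm u * / hnorm u).
  { apply Rle_0_sqr. }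
  apply Rlt_le in Hu. apply Rmult_le_compat_l with (1 := h4) in Hu.
  replace (/ hnorm u * / hnorm u * ((/ INR (S k)) ^ 2 * ip u u))
    with ((/ INR (S k)) ^ 2 * (/ hnorm u * / hnorm u * ip u u)) in Hu by ring.
  rewrite h3 in Hu. lra. }
assert (Hv1 : forall j k, Rabs (vec (v j) k) <= 1).
{ intros j k. assert (h := l2_coord_le (v j) k). change (l2_ip (v j) (v j)) with (ip (v j) (v j)) in h.
  rewrite (proj1 (Hv j)) in h. rewrite <- (pow1 2) in h.
  apply Rsqr_incr_0_var; [|lra]. rewrite <- Rsqr_abs, 2!Rsqr_pow2. trivial. }
destruct (diagonal_extraction_Z (fun j k => vec (v j) k)) as [phi [w [H1 H2]]].
{ intros k. exists 1. intros j. apply Hv1. }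
assert (Hphi : forall j, / INR (S (phi j)) <= / INR (S j)).
{ intros j. apply Rinv_le_contravar; [apply lt_0_INR; lia|apply le_INR; specialize (H1 j); lia]. }
assert (Hw : forall k, twoJ (zext a 0) (zext b (far_value x)) w k = x * w k).
{ intros k. apply (twoJ_limit (fun _ => zext a 0) (fun _ => zext b (far_value x)) (fun j => vec (v (phi j))) (fun _ => x));
    trivial; try (intros; apply Un_cv_const).
  apply Un_cv_squeeze0 with 0%nat. intros j _. apply Rle_trans with (2 := Hphi j).
  destruct (Hv (phi j)) as [_ h].
  assert (h' := l2_coord_le (shift (half_jacobi x) x (v (phi j))) k).
  change (l2_ip ?u ?u) with (ip (u : l2) u) in h'.
  unfold half_jacobi in h' at 1. rewrite shift_jacobi in h'.
  apply Rsqr_incr_0_var; [|apply Rlt_le, inv_INR_pos]. rewrite <- Rsqr_abs, 2!Rsqr_pow2. lra. }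
assert (Hw' := opoly_of_solution a b Hpos x (far_value x) w (fun k _ => Hw k)).
assert (Hw1 : w 1%Z <> 0).
{ intros e.
  assert (Hcv : Un_cv (fun j => sum_f_R0 (fun i => vec (v (phi j)) (Z.of_nat i + 1)%Z ^ 2) n)
    (sum_f_R0 (fun i => w (Z.of_nat i + 1)%Z ^ 2) n)).
  { assert (sq : forall k, Un_cv (fun j => vec (v (phi j)) k ^ 2) (w k ^ 2)).
    { intros k. simpl. apply (CV_mult (fun j => vec (v (phi j)) k)); [apply H2|].
      apply (CV_mult (fun j => vec (v (phi j)) k)); [apply H2|apply Un_cv_const]. }
    clear - sq. induction n as [|n IH]; [apply sq|].
    rewrite tech5. apply (CV_plus (fun j => sum_f_R0 (fun i => vec (v (phi j)) (Z.of_nat i + 1)%Z ^ 2) n)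
      (fun j => vec (v (phi j)) (Z.of_nat (S n) + 1)%Z ^ 2)); [exact IH|apply sq]. }
  replace (sum_f_R0 (fun i => w (Z.of_nat i + 1)%Z ^ 2) n) with 0 in Hcv.
  2:{ symmetry. rewrite (sum_eq _ (fun _ => 0)); [rewrite sum_cte; ring|].
      intros i _. rewrite Hw', e. ring. }
  (* With head mass below 1/8 and C times the residual below 1/2, the head estimate would give 1 <
     2/8 + 1/2. *)
  destruct (Hcv (1 / 8)) as [N1 HN1]; [lra|].
  destruct (inv_INR_small (/ (2 * (C + 1)))) as [N2 HN2]; [apply Rinv_0_lt_compat; lra|].
  pose (j := (N1 + N2)%nat).
  specialize (HN1 j ltac:(unfold j; lia)). specialize (HN2 j ltac:(unfold j; lia)).
  unfold R_dist in HN1. rewrite Rminus_0_r in HN1. apply Rabs_lt_between in HN1.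
  assert (h := Hhead (v (phi j))). destruct (Hv (phi j)) as [h1 h2]. rewrite h1 in h.
  assert (hj := Hphi j). assert (hp := inv_INR_pos (phi j)).
  set (c := / INR (S (phi j))) in *.
  assert (hc : c < / (2 * (C + 1))) by lra.
  assert (hc1 : c * (2 * (C + 1)) < 1).
  { apply Rmult_lt_compat_r with (r := 2 * (C + 1)) in hc; [|lra]. rewrite Rinv_l in hc; lra. }
  assert (hc2 : c ^ 2 <= c) by nra.
  apply Rmult_le_compat_l with (r := C) in h2; trivial.
  assert (C * c ^ 2 <= C * c) by now apply Rmult_le_compat_l. lra. }
exists (/ Rabs (w 1%Z)). intros k.
assert (h0 : 0 < Rabs (w 1%Z)) by now apply Rabs_pos_lt.
assert (h : Rabs (w (Z.of_nat k + 1)%Z) <= 1).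
{ apply Un_cv_le_abs with (2 := H2 (Z.of_nat k + 1)%Z). intros j. apply Hv1. }
rewrite Hw', Rabs_mult in h.
apply Rmult_le_reg_l with (Rabs (w 1%Z)); trivial. rewrite Rinv_r; lra.
Qed.

End Spectrum.

(** * Passage to a right limit *)

Lemma reversed_sum_le (q : nat -> R) : (forall i, 0 <= q i) -> forall N n,
  sum_f_R0 (fun i => if le_dec i n then q (n - i)%nat else 0) N <= sum_f_R0 q n.
Proof.
intros Hq N. induction N as [|N IH]; intros n.
- simpl. rewrite Nat.sub_0_r. now apply sum_f_R0_member.
- rewrite decomp_sum by lia. simpl pred.
  destruct n as [|n].
  + rewrite (sum_eq _ (fun _ => 0)); [rewrite sum_cte; simpl; lra|].
    intros i _. destruct le_dec; [lia|trivial].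
  + rewrite tech5. specialize (IH n).
    rewrite (sum_eq _ (fun i => if le_dec i n then q (n - i)%nat else 0)); [simpl in *; lra|].
    intros i _. repeat destruct le_dec; try lia; trivial.
Qed.

(* Seen from site [n + 1], the orthonormal polynomials up to degree [n], normalized at [n]. *)
Definition backward_ratio (a b : nat -> R) (n : nat) (x : R) (k : Z) : R :=
  if Z_le_dec k 0 then if Z_le_dec (- Z.of_nat n) k
    then opoly a b (Z.to_nat (Z.of_nat n + k)) x / opoly a b n x else 0 else 0.

(** The full sum is K_n(x,x) / p_n(x)^2, read backwards from index n. *)
Lemma backward_ratio_sq_sum a b n x eps : 0 < eps ->
  eps * CD_kernel a b n x x <= opoly a b n x ^ 2 -> 0 < opoly a b n x ^ 2 ->
  forall N, sum_f_R0 (fun i => backward_ratio a b n x (- Z.of_nat i) ^ 2) N <= / eps.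
Proof.
intros He HK Hp N.
assert (Hp' : opoly a b n x <> 0) by (intros e; rewrite e in Hp; simpl in Hp; lra).
pose (q := fun i => opoly a b i x ^ 2).
rewrite (sum_eq _ (fun i => (if le_dec i n then q (n - i)%nat else 0) * / q n)).
- rewrite <- scal_sum. apply Rmult_le_reg_l with (q n); trivial.
  rewrite <- Rmult_assoc, Rinv_r, Rmult_1_l by (unfold q; lra).
  apply Rle_trans with (sum_f_R0 q n); [apply reversed_sum_le; intros; apply pow2_ge_0|].
  apply Rmult_le_reg_l with eps; trivial. replace (eps * (q n * / eps)) with (q n) by (field; lra).
  apply Rle_trans with (2 := HK). right. f_equal. unfold CD_kernel. apply sum_eq. intros; unfold q; ring.
- intros i _. unfold backward_ratio, q.
  destruct Z_le_dec; [|lia]. destruct (le_dec i n) as [h|h]; destruct Z_le_dec; try lia.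
  + replace (Z.to_nat (Z.of_nat n + - Z.of_nat i)) with (n - i)%nat by lia. field. trivial.
  + ring.
Qed.

Theorem theorem8p2 (l : nat) (alpha beta : nat -> R) (a b : nat -> R) :
  finite_gap_set l alpha beta ->
  bounded_nat a -> bounded_nat b ->
  (forall n, (1 <= n)%nat -> 0 < a n) ->
  nevai_class l alpha beta a b ->
  forall eps, 0 < eps -> exists N, forall n x0, (N <= n)%nat -> spec_half a b x0 ->
    opoly a b n x0 ^ 2 / CD_kernel a b n x0 x0 <= eps.
Proof.
intros Hfg [Ma HMa] [Mb HMb] Hpos Hnevai eps Heps.
pose (M := Rmax Ma Mb).
assert (Ha : forall k, Rabs (a k) <= M) by (intros k; apply Rle_trans with (1 := HMa k), Rmax_l).
assert (Hb : forall k, Rabs (b k) <= M) by (intros k; apply Rle_trans with (1 := HMb k), Rmax_r).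
apply NNPP. intros Hn.
destruct (choice (fun N (p : nat * R) => (N <= fst p)%nat /\ spec_half a b (snd p) /\
  eps < opoly a b (fst p) (snd p) ^ 2 / CD_kernel a b (fst p) (snd p) (snd p))) as [g Hg].
{ intros N. apply NNPP. intros H. apply Hn. exists N. intros n x0 h1 h2. apply Rnot_lt_le. intros h3.
  apply H. now exists (n, x0). }
pose (n := fun j => fst (g j)). pose (x := fun j => snd (g j)).
assert (Hnj : forall j, (j <= n j)%nat) by (intros j; apply Hg).
assert (Hxs : forall j, spec_half a b (x j)) by (intros j; apply Hg).
assert (HK1 : forall j, 1 <= CD_kernel a b (n j) (x j) (x j)).
{ intros j. apply Rle_trans with (2 := CD_kernel_diag_ge a b (x j) (n j) 0 ltac:(lia)).
  rewrite (proj1 (opoly_rec a b Hpos (x j))). lra. }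
assert (Hbig : forall j, eps * CD_kernel a b (n j) (x j) (x j) < opoly a b (n j) (x j) ^ 2).
{ intros j. destruct (Hg j) as [_ [_ h]]. specialize (HK1 j). fold (n j) (x j) in h.
  apply Rmult_lt_compat_r with (r := CD_kernel a b (n j) (x j) (x j)) in h; [|lra].
  unfold Rdiv in h. rewrite Rmult_assoc, Rinv_l in h by lra. lra. }
clearbody n x. clear g Hg Hn.
assert (Hp2 : forall j, 0 < opoly a b (n j) (x j) ^ 2).
{ intros j. specialize (Hbig j). specialize (HK1 j). nra. }
assert (Hp : forall j, opoly a b (n j) (x j) <> 0).
{ intros j e. specialize (Hp2 j). rewrite e in Hp2. simpl in Hp2. lra. }
pose (w := fun j => backward_ratio a b (n j) (x j)).
assert (Hwsum : forall j N, sum_f_R0 (fun i => w j (- Z.of_nat i)%Z ^ 2) N <= / eps).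
{ intros j. apply backward_ratio_sq_sum; trivial. apply Rlt_le, Hbig. }
assert (Hie : 0 < / eps) by now apply Rinv_0_lt_compat.
(* The centre is site n + 1, which carries p_n, so the normalization becomes u_0 = 1. *)
destruct (joint_right_limit a b M Ha Hb (fun j => S (n j)) w x (Rmax (1 + / eps) (3 * (M + 2) + 1)))
  as [phi [a' [b' [u [y [H1 [Ha' [Hb' [Hu Hy]]]]]]]]].
{ intros j k. apply Rle_trans with (2 := Rmax_l _ _).
  destruct (Z_le_dec k 0) as [h|h].
  - assert (h2 := sum_f_R0_member (fun i => w j (- Z.of_nat i)%Z ^ 2) (Z.to_nat (- k)) (Z.to_nat (- k))
      (fun i => pow2_ge_0 _) (Nat.le_refl _)). cbv beta in h2.
    replace (- Z.of_nat (Z.to_nat (- k)))%Z with k in h2 by lia.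
    specialize (Hwsum j (Z.to_nat (- k))).
    apply Rsqr_incr_0_var; [|lra]. rewrite <- Rsqr_abs, 2!Rsqr_pow2.
    apply Rle_trans with (/ eps); [lra|nra].
  - unfold w, backward_ratio. destruct Z_le_dec; [lia|]. rewrite Rabs_R0. lra. }
{ intros j. apply Rle_trans with (2 := Rmax_r _ _). now apply (spec_half_bounded a b M Ha Hb). }
destruct (classic (in_fgs l alpha beta y)) as [Hin|Hout].
- apply (torus_no_decaying_solution l alpha beta a' b' y u (/ eps)); trivial.
  + apply Hnevai. exists (fun j => S (n (phi j))). repeat split; trivial.
    intros K. exists K. intros j Hj. specialize (H1 j). specialize (Hnj (phi j)). lia.
  + apply UL_sequence with (1 := Hu 0%Z). apply Un_cv_eventually with (fun _ => 1) 0%nat; [|apply Un_cv_const].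
    intros j _. unfold w, backward_ratio. repeat (destruct Z_le_dec; [|lia]).
    rewrite Z.add_0_r, Nat2Z.id. field. apply Hp.
  + intros N.
    assert (Hcv : Un_cv (fun j => sum_f_R0 (fun i => w (phi j) (- Z.of_nat i)%Z ^ 2) N)
      (sum_f_R0 (fun i => u (- Z.of_nat i)%Z ^ 2) N)).
    { assert (sq : forall k, Un_cv (fun j => w (phi j) k ^ 2) (u k ^ 2)).
      { intros k. simpl. apply (CV_mult (fun j => w (phi j) k)); [apply Hu|].
        apply (CV_mult (fun j => w (phi j) k)); [apply Hu|apply Un_cv_const]. }
      clear - sq. induction N as [|N IH]; [apply sq|].
      rewrite tech5. apply (CV_plus (fun j => sum_f_R0 (fun i => w (phi j) (- Z.of_nat i)%Z ^ 2) N)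
        (fun j => w (phi j) (- Z.of_nat (S N))%Z ^ 2)); [exact IH|apply sq]. }
    apply Rle_trans with (1 := Rle_abs _). apply Un_cv_le_abs with (2 := Hcv).
    intros j. rewrite Rabs_pos_eq; [apply Hwsum|]. apply cond_pos_sum. intros; apply pow2_ge_0.
  + intros k Hk.
    apply (twoJ_limit (fun j n0 => a (Z.to_nat (Z.of_nat (S (n (phi j))) + n0)))
      (fun j n0 => b (Z.to_nat (Z.of_nat (S (n (phi j))) + n0))) (fun j => w (phi j)) (fun j => x (phi j))); trivial.
    (* Once n + k >= 1 the recursion holds exactly at k <= -1; at k = 0 it would involve p_{n+1},
       which the cutoff removes. *)
    apply Un_cv_eventually with (fun _ => 0) (Z.to_nat (2 - k)); [|apply Un_cv_const].
    intros j Hj. specialize (H1 j). specialize (Hnj (phi j)).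
    set (m := n (phi j)) in *. set (z := x (phi j)).
    pose (i := Z.to_nat (Z.of_nat m + k - 1)).
    destruct (opoly_rec a b Hpos z) as [_ [_ E]]. specialize (E i).
    unfold twoJ, w, backward_ratio. fold m z. repeat (destruct Z_le_dec; [|lia]).
    replace (Z.to_nat (Z.of_nat (S m) + (k - 1))) with (S i) by lia.
    replace (Z.to_nat (Z.of_nat (S m) + k)) with (S (S i)) by lia.
    replace (Z.to_nat (Z.of_nat m + (k - 1))) with i by lia.
    replace (Z.to_nat (Z.of_nat m + k)) with (S i) by lia.
    replace (Z.to_nat (Z.of_nat m + (k + 1))) with (S (S i)) by lia.
    assert (hp := Hp (phi j)). fold m z in hp.
    transitivity ((a (S i) * opoly a b i z + b (S (S i)) * opoly a b (S i) z
      + a (S (S i)) * opoly a b (S (S i)) z - z * opoly a b (S i) z) / opoly a b m z); [|field; trivial].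
    rewrite E. field. trivial.
- destruct (iterated_window_estimate l alpha beta a b M Ha Hb Hnevai y Hout) as [q Hq].
  destruct (Hy (/ INR (S q)) (inv_INR_pos q)) as [N HN].
  (* Decay by 4^r over 3 q + r q sites then contradicts p_n^2 > eps K_n. *)
  assert (Hr : exists r, / 4 ^ r < eps).
  { destruct (pow_lt_1_zero (/ 4)) with (y := eps) as [r Hr]; trivial.
    - rewrite Rabs_pos_eq; lra.
    - exists r. rewrite <- pow_inv. apply Rle_lt_trans with (1 := Rle_abs _). apply Hr. lia. }
  destruct Hr as [r Hr].
  pose (j := (N + 3 * q + r * q)%nat). specialize (HN j ltac:(unfold j; lia)). unfold R_dist in HN.
  destruct (spectral_opoly_bounded a b M Ha Hb Hpos y q (x (phi j)) Hq (Rlt_le _ _ HN) (Hxs _)) as [C HC].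
  specialize (H1 j). specialize (Hnj (phi j)).
  assert (h := bounded_opoly_decay a b Hpos y q (x (phi j)) C Hq (Rlt_le _ _ HN) HC r (n (phi j)) ltac:(unfold j in *; lia)).
  specialize (Hbig (phi j)). specialize (HK1 (phi j)). unfold Rdiv in h. nra.
Qed.
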